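(* Consider the real analytic planar system $\dot x=y+P_2(x,y)$, $\dot y=Q_2(x,y)$, with $P_2,Q_2$ analytic near the origin without constant nor linear terms. Assume that the origin is a nilpotent focus with Andreev number $n$, and that there exists an inverse integrating factor $V_0(x,y)$ of this system which is analytic in a neighborhood of the origin. Then $n$ is odd.
   Context: A focus is an isolated singular point having a neighborhood in which all orbits spiral to it in forward or in backward time. Andreev number: let $y=F(x)$ be the solution of $y+P_2(x,y)=0$ through $(0,0)$, $f(x)=Q_2(x,F(x))=ax^\alpha+\cdots$ ($a\ne0$, $\alpha\ge2$) and $\phi(x)=(\partial P_2/\partial x+\partial Q_2/\partial y)(x,F(x))$, which is either $bx^\beta+\cdots$ with $b\ne0$, $\beta\ge1$, or $\equiv0$. By Andreev's theorem the origin is monodromic (a center or a focus) iff $a<0$, $\alpha=2n-1$ is odd and one of: $\beta>n-1$; $\beta=n-1$ and $b^2+4an<0$; $\phi\equiv0$. The integer $n\ge2$ is the Andreev number. An inverse integrating factor of $\dot x=P$, $\dot y=Q$ in a neighborhood $\mathcal{U}$ of the origin is a function $V_0:\mathcal{U}\to\mathbb{R}$ of class $\mathcal{C}^1$, not locally null, with $P\,\frac{\partial V_0}{\partial x}+Q\,\frac{\partial V_0}{\partial y}=\left(\frac{\partial P}{\partial x}+\frac{\partial Q}{\partial y}\right)V_0$. *)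

(* Defs.v *)
From Stdlib Require Import Reals Arith.
From Coquelicot Require Import Coquelicot.
Open Scope R_scope.

(* Functions defined near the origin are represented by total functions, whose
   values away from the origin are arbitrary. *)

(* f is, near the origin, the sum of the absolutely convergent double power
   series with coefficients c. *)
Definition has_expansion2 (c : nat -> nat -> R) (f : R -> R -> R) : Prop :=
  locally ((0, 0) : R * R) (fun p : R * R =>
    let t := fun i j : nat => c i j * fst p ^ i * snd p ^ j in
    (forall i, ex_series (fun j => Rabs (t i j))) /\
    ex_series (fun i => Series (fun j => Rabs (t i j))) /\
    is_series (fun i => Series (fun j => t i j)) (f (fst p) (snd p))).

Definition analytic2 (f : R -> R -> R) : Prop :=
  exists c, has_expansion2 c f.

(* Analytic near the origin, without terms of total degree less than k. *)
Definition analytic2_order_ge (k : nat) (f : R -> R -> R) : Prop :=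
  exists c, has_expansion2 c f /\
    (forall i j : nat, (i + j < k)%nat -> c i j = 0).

Definition has_expansion1 (u : nat -> R) (f : R -> R) : Prop :=
  locally (0 : R) (fun x => is_pseries u x (f x)).

Definition analytic1 (f : R -> R) : Prop := exists u, has_expansion1 u f.

(* f(x) = c x^k + (higher order terms), with c <> 0. *)
Definition leading_term (f : R -> R) (c : R) (k : nat) : Prop :=
  c <> 0 /\
  exists u, has_expansion1 u f /\ (forall i, (i < k)%nat -> u i = 0) /\ u k = c.

Definition dx (f : R -> R -> R) (x y : R) : R := Derive (fun u => f u y) x.
Definition dy (f : R -> R -> R) (x y : R) : R := Derive (fun v => f x v) y.

(* The integral curve of (P, Q) starting at (x0, y0) remains in W and tends to
   the origin as t -> +oo, its polar angle (a continuous determination)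
   tending to +oo or to -oo. *)
Definition spirals_forward (P Q : R -> R -> R) (W : R * R -> Prop)
    (x0 y0 : R) : Prop :=
  exists x y rho theta : R -> R,
    x 0 = x0 /\ y 0 = y0 /\
    (forall t, 0 <= t ->
       W (x t, y t) /\
       is_derive x t (P (x t) (y t)) /\ is_derive y t (Q (x t) (y t)) /\
       0 < rho t /\ continuous theta t /\
       x t = rho t * cos (theta t) /\ y t = rho t * sin (theta t)) /\
    is_lim rho p_infty 0 /\
    (is_lim theta p_infty p_infty \/ is_lim theta p_infty m_infty).

(* Time is reversed by changing the sign of the vector field. *)
Definition spirals_backward (P Q : R -> R -> R) (W : R * R -> Prop)
    (x0 y0 : R) : Prop :=
  spirals_forward (fun x y => - P x y) (fun x y => - Q x y) W x0 y0.

Definition is_focus (P Q : R -> R -> R) : Prop :=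
  P 0 0 = 0 /\ Q 0 0 = 0 /\
  exists W : R * R -> Prop,
    locally ((0, 0) : R * R) W /\
    forall x y, W (x, y) -> (x, y) <> (0, 0) ->
      ~ (P x y = 0 /\ Q x y = 0) /\
      (spirals_forward P Q W x y \/ spirals_backward P Q W x y).

(* n is the integer attached by Andreev's theorem to the monodromic nilpotent
   singularity at the origin of x' = y + P2(x,y), y' = Q2(x,y). *)
Definition andreev_number (P2 Q2 : R -> R -> R) (n : nat) : Prop :=
  (2 <= n)%nat /\
  exists (F : R -> R) (a : R),
    let f := fun x => Q2 x (F x) in
    let phi := fun x => dx P2 x (F x) + dy Q2 x (F x) in
    analytic1 F /\ F 0 = 0 /\
    locally (0 : R) (fun x => F x + P2 x (F x) = 0) /\
    leading_term f a (2 * n - 1) /\ a < 0 /\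
    (locally (0 : R) (fun x => phi x = 0) \/
     exists (b : R) (beta : nat),
       (1 <= beta)%nat /\ leading_term phi b beta /\
       ((n - 1 < beta)%nat \/
        (beta = (n - 1)%nat /\ b ^ 2 + 4 * a * INR n < 0))).

Definition C1_on (U : R * R -> Prop) (f : R -> R -> R) : Prop :=
  forall x y, U (x, y) ->
    ex_derive (fun u => f u y) x /\ ex_derive (fun v => f x v) y /\
    continuous (fun p : R * R => dx f (fst p) (snd p)) (x, y) /\
    continuous (fun p : R * R => dy f (fst p) (snd p)) (x, y).

Definition not_locally_null (U : R * R -> Prop) (f : R -> R -> R) : Prop :=
  forall x y, U (x, y) ->
    ~ locally ((x, y) : R * R) (fun p : R * R => f (fst p) (snd p) = 0).

Definition inverse_integrating_factor (P Q : R -> R -> R)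
    (U : R * R -> Prop) (V : R -> R -> R) : Prop :=
  open U /\ U (0, 0) /\ C1_on U V /\ not_locally_null U V /\
  forall x y, U (x, y) ->
    P x y * dx V x y + Q x y * dy V x y = (dx P x y + dy Q x y) * V x y.

(* Main.v *)
Require Import Defs.
From Stdlib Require Import Reals Arith Ranalysis5 Lra Lia Classical.
From Coquelicot Require Import Coquelicot.
Open Scope R_scope.

(** Suppose that n is even, and shear the curve y = F(x) to the x-axis.  Give x weight 1 and y
    weight n, and let W, of weighted degree k, be the leading part of the inverse integrating
    factor V.  The equation of V and Euler's relation express the gradient of W as a multiple of
    W; the multiple is continuous off the origin because b^2 + 4 a n < 0, so W, and hence V near
    the origin, has no zero off the origin.  The form (P dy - Q dx) / V is therefore closed on a
    punctured neighborhood.  Its period over the rectangle [-e, e] x [-e^n, e^n], written as a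
    sum of integrals that make sense for both signs of e, is e^(-k) times a function with an
    asymptotic expansion in powers of e.  It is constant for e > 0, and changes sign with e since
    x -> -x reverses the orientation of the rectangle (here n is even); hence it vanishes.  So the
    form has a primitive, a single-valued first integral whose derivative along the positive
    y-axis does not vanish, whereas a spiral crosses that half-axis at several points where the
    first integral takes one and the same value. *)

(** * Double series *)

(** The three cases of Andreev's criterion become one: with b = 0 unless beta = n - 1, the
    inequality b^2 + 4 a n < 0 always holds. The shear has Jacobian 1, so it preserves the
    divergence and the equation of V. The leading part W exists because an analytic V that is flat
    in the weighted scale would vanish near the origin. The period is c for e > 0 and -c for e < 0,
    so e^k times it is c sgn(e) e^k. For k > 0 a limit as e -> 0 does not exclude this; only an
    expansion that includes the term in e^k does. Hence expansions of all orders, valid for both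
    signs of e, defined recursively and stable under products, inverses and integration. For odd n
    the substitution e -> -e is a half-turn of the rectangle, which keeps the orientation, and
    nothing follows. The period is read off from two potentials on slit boxes instead of Green's
    theorem, and Rolle's theorem on the half-axis replaces the return map. *)

Lemma ex_series_nonneg_bounded (a : nat -> R) (M : R) :
  (forall n, 0 <= a n) -> (forall N, sum_n a N <= M) ->
  ex_series a /\ Series a <= M.
Proof.
  intros Ha HM.
  assert (Hinc : forall n, sum_n a n <= sum_n a (S n)).
  { intros n. rewrite sum_Sn. unfold plus; simpl. specialize (Ha (S n)). lra. }
  destruct (ex_finite_lim_seq_incr (sum_n a) M Hinc HM) as [l Hl].
  assert (Hs : is_series a l) by exact Hl.
  split; [ now exists l | ].
  rewrite (is_series_unique _ _ Hs).
  apply (is_lim_seq_le (sum_n a) (fun _ => M) l M); auto.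
  apply is_lim_seq_const.
Qed.

Lemma sum_n_nonneg (a : nat -> R) (N : nat) : (forall n, 0 <= a n) -> 0 <= sum_n a N.
Proof.
  intros Ha. induction N as [|N IH]; [ rewrite sum_O; auto | ].
  rewrite sum_Sn. unfold plus; simpl. specialize (Ha (S N)). lra.
Qed.

Lemma sum_n_le_Series (a : nat -> R) (N : nat) :
  (forall n, 0 <= a n) -> ex_series a -> sum_n a N <= Series a.
Proof.
  intros Ha Hs.
  assert (Hl : is_lim_seq (sum_n a) (Series a)) by exact (Series_correct _ Hs).
  apply (is_lim_seq_incr_compare _ _ Hl).
  intros n. rewrite sum_Sn. unfold plus; simpl. specialize (Ha (S n)). lra.
Qed.

Lemma term_le_Series (a : nat -> R) (n : nat) :
  (forall n, 0 <= a n) -> ex_series a -> a n <= Series a.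
Proof.
  intros Ha Hs. apply Rle_trans with (sum_n a n); [ | now apply sum_n_le_Series ].
  destruct n as [|n]; [ rewrite sum_O; lra | ].
  rewrite sum_Sn. unfold plus; simpl.
  generalize (sum_n_nonneg a n Ha). lra.
Qed.

Lemma Series_nonneg (a : nat -> R) :
  (forall n, 0 <= a n) -> ex_series a -> 0 <= Series a.
Proof.
  intros Ha Hs. apply Rle_trans with (a O); auto. now apply term_le_Series.
Qed.

Lemma ex_series_le_R (a b : nat -> R) :
  (forall n, Rabs (a n) <= b n) -> ex_series b -> ex_series a.
Proof. intros H Hb. apply (ex_series_le a b); auto. Qed.

Lemma ex_series_ext_R (a b : nat -> R) :
  (forall n, a n = b n) -> ex_series a -> ex_series b.
Proof. apply ex_series_ext. Qed.

Lemma is_series_single (x : R) : is_series (fun i => match i with O => x | S _ => 0 end) x.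
Proof.
  apply is_series_decr_1. replace (plus x _) with (@zero R_NormedModule).
  - apply is_series_ext with (fun n => scal 0 ((/2) ^ n)).
    + intros n. apply Rmult_0_l.
    + replace (@zero R_NormedModule) with (scal 0 (/ (1 - / 2))) by apply Rmult_0_l.
      apply (is_series_scal 0 (fun n => (/2)^n)), is_series_geom. rewrite Rabs_pos_eq; lra.
  - symmetry. apply (plus_opp_r x).
Qed.

Lemma Series_zero (a : nat -> R) : (forall n, a n = 0) -> Series a = 0.
Proof.
  intros H. rewrite (Series_ext _ (fun n => 0 * a n)).
  - rewrite Series_scal_l. apply Rmult_0_l.
  - intros n. rewrite H. ring.
Qed.

Lemma ex_series_zero (a : nat -> R) : (forall n, a n = 0) -> ex_series a.
Proof.
  intros H. apply ex_series_ext_R with (fun i => match i with O => 0 | S _ => 0 end).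
  - intros [|n]; now rewrite H.
  - exists 0. apply is_series_single.
Qed.

Lemma Series_sum_n (a : nat -> nat -> R) (J : nat) :
  (forall j, ex_series (fun i => a i j)) ->
  ex_series (fun i => sum_n (a i) J) /\
  Series (fun i => sum_n (a i) J) = sum_n (fun j => Series (fun i => a i j)) J.
Proof.
  intros H. induction J as [|J [IH1 IH2]].
  - split.
    + apply ex_series_ext_R with (2 := H O). intros i. now rewrite sum_O.
    + rewrite sum_O. apply Series_ext. intros i. now rewrite sum_O.
  - split.
    + apply ex_series_ext_R with (fun i => plus (sum_n (a i) J) (a i (S J))).
      * intros i. now rewrite sum_Sn.
      * now apply (ex_series_plus (V := R_NormedModule)).
    + rewrite sum_Sn, <- IH2. unfold plus; simpl. rewrite <- Series_plus; auto.
      apply Series_ext. intros i. now rewrite sum_Sn.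
Qed.

(** A finite sum of columns is the series of the partial row sums, hence at most the total; the
    bound passes to the limit. *)
Lemma tonelli_le (a : nat -> nat -> R) :
  (forall i j, 0 <= a i j) -> (forall i, ex_series (a i)) ->
  ex_series (fun i => Series (a i)) ->
  (forall j, ex_series (fun i => a i j)) /\
  ex_series (fun j => Series (fun i => a i j)) /\
  Series (fun j => Series (fun i => a i j)) <= Series (fun i => Series (a i)).
Proof.
  intros H0 H1 H2.
  assert (H3 : forall j, ex_series (fun i => a i j)).
  { intros j. apply ex_series_le_R with (2 := H2). intros i.
    rewrite Rabs_pos_eq by auto. apply (term_le_Series (a i)); auto. }
  split; [ exact H3 | ].
  apply ex_series_nonneg_bounded.
  - intros j. apply Series_nonneg; auto.
  - intros J. rewrite <- (proj2 (Series_sum_n a J H3)).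
    apply Series_le; auto. intros i. split.
    + now apply sum_n_nonneg.
    + apply sum_n_le_Series; auto.
Qed.

(** The inequality [tonelli_le], applied to the array and to its transpose. *)
Lemma tonelli_eq (a : nat -> nat -> R) :
  (forall i j, 0 <= a i j) -> (forall i, ex_series (a i)) ->
  ex_series (fun i => Series (a i)) ->
  Series (fun j => Series (fun i => a i j)) = Series (fun i => Series (a i)).
Proof.
  intros H0 H1 H2. destruct (tonelli_le a H0 H1 H2) as [H3 [H4 H5]].
  destruct (tonelli_le (fun j i => a i j)) as [_ [_ H6]]; auto.
  apply Rle_antisym; auto.
Qed.

Lemma fubini_series (a : nat -> nat -> R) :
  (forall i, ex_series (fun j => Rabs (a i j))) ->
  ex_series (fun i => Series (fun j => Rabs (a i j))) ->
  Series (fun j => Series (fun i => a i j)) = Series (fun i => Series (a i)).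
Proof.
  intros H1 H2.
  (* An absolutely summable array is the difference of the nonnegative arrays [p] and [q], to which
     Tonelli's theorem applies. *)
  set (p := fun i j => a i j + Rabs (a i j)). set (q := fun i j => Rabs (a i j)).
  assert (Hq : forall i j, 0 <= q i j) by (intros; apply Rabs_pos).
  assert (Hp : forall i j, 0 <= p i j <= 2 * q i j).
  { intros i j. unfold p, q. split_Rabs; lra. }
  assert (Hp1 : forall i, ex_series (p i)).
  { intros i. apply ex_series_le_R with (fun j => 2 * q i j).
    - intros j. rewrite Rabs_pos_eq; apply Hp.
    - apply (ex_series_scal_l 2 (q i)), H1. }
  assert (Hp2 : ex_series (fun i => Series (p i))).
  { apply ex_series_le_R with (fun i => 2 * Series (q i)).
    - intros i. rewrite Rabs_pos_eq.
      + rewrite <- Series_scal_l. apply Series_le; [ apply Hp | ].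
        apply (ex_series_scal_l 2 (q i)), H1.
      + apply Series_nonneg; auto. apply Hp.
    - now apply (ex_series_scal_l 2 (fun i => Series (q i))). }
  assert (Hp0 : forall i j, 0 <= p i j) by apply Hp.
  destruct (tonelli_le p Hp0 Hp1 Hp2) as [Hp3 [Hp4 _]].
  destruct (tonelli_le q Hq H1 H2) as [Hq3 [Hq4 _]].
  assert (Hq1 : forall i, ex_series (q i)) by exact H1.
  assert (Hq2 : ex_series (fun i => Series (q i))) by exact H2.
  assert (E : forall i j, a i j = p i j - q i j) by (intros; unfold p, q; ring).
  rewrite (Series_ext _ (fun j => Series (fun i => p i j) - Series (fun i => q i j))).
  2:{ intros j. rewrite <- Series_minus by auto. apply Series_ext. intros i. apply E. }
  rewrite Series_minus, (tonelli_eq p), (tonelli_eq q), <- Series_minus; auto.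
  apply Series_ext. intros i. rewrite <- (Series_minus (p i) (q i)) by auto.
  symmetry. apply Series_ext, E.
Qed.

(** * Analytic functions of two variables *)

(** Absolute summability at the corner ([r], [r]), as an iterated series; it dominates the double
    series on the whole closed box. *)
Definition abs_summable (c : nat -> nat -> R) (r : R) : Prop :=
  (forall i, ex_series (fun j => Rabs (c i j) * r ^ j)) /\
  ex_series (fun i => Series (fun j => Rabs (c i j) * r ^ j) * r ^ i).

Definition sum2 (c : nat -> nat -> R) (x y : R) : R :=
  Series (fun i => Series (fun j => c i j * y ^ j) * x ^ i).

Definition expands2 (c : nat -> nat -> R) (r : R) (f : R -> R -> R) : Prop :=
  0 < r /\ abs_summable c r /\
  forall x y, Rabs x <= r -> Rabs y <= r -> f x y = sum2 c x y.

Definition Analytic (f : R -> R -> R) : Prop := exists c r, expands2 c r f.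

Lemma ball_R (x e y : R) : ball x e y = (Rabs (y - x) < e).
Proof. reflexivity. Qed.

Lemma ball_R_0 (e y : R) : ball (0 : R) e y = (Rabs y < e).
Proof. now rewrite ball_R, Rminus_0_r. Qed.

Lemma locally_box (P : R * R -> Prop) :
  locally ((0, 0) : R * R) P ->
  exists r, 0 < r /\ forall x y, Rabs x < r -> Rabs y < r -> P (x, y).
Proof.
  intros [e He]. exists e. split; [ apply cond_pos | ]. intros x y Hx Hy.
  apply He. split; simpl; now rewrite ball_R_0.
Qed.

Lemma locally_0_iff (P : R -> Prop) :
  locally (0 : R) P <-> exists r, 0 < r /\ forall x, Rabs x < r -> P x.
Proof.
  split.
  - intros [e He]. exists e. split; [ apply cond_pos | ]. intros x Hx.
    apply He. now rewrite ball_R_0.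
  - intros [r [Hr H]]. exists (mkposreal r Hr). intros x Hx. apply H.
    now rewrite ball_R_0 in Hx.
Qed.

Lemma pow_abs_le (x r : R) (n : nat) : Rabs x <= r -> Rabs (x ^ n) <= r ^ n.
Proof. intros H. rewrite <- RPow_abs. apply pow_incr. split; auto. apply Rabs_pos. Qed.

Lemma expands2_of_has_expansion2 (c : nat -> nat -> R) (f : R -> R -> R) :
  has_expansion2 c f -> exists r, expands2 c r f.
Proof.
  intros H. apply locally_box in H. destruct H as [r0 [Hr0 H]]. simpl in H.
  (* Half the radius puts the corner ([r], [r]) inside the open box on which the expansion is
     known. *)
  exists (r0 / 2). assert (Hr : 0 < r0 / 2) by lra. set (r := r0 / 2) in *.
  split; [ exact Hr | ].
  destruct (H r r) as [H1 [H2 _]]; try (rewrite Rabs_pos_eq; unfold r; lra).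
  assert (Hri : forall i, 0 < r ^ i) by (intros; now apply pow_lt).
  assert (E : forall i j, Rabs (c i j * r ^ i * r ^ j) = Rabs (c i j) * r ^ j * r ^ i).
  { intros i j. rewrite !Rabs_mult, (Rabs_pos_eq (r ^ i)), (Rabs_pos_eq (r ^ j)) by (left; auto).
    ring. }
  split; [ split | ].
  - intros i. apply ex_series_ext_R with (fun j => Rabs (c i j * r ^ i * r ^ j) * / r ^ i).
    + intros j. rewrite E. field. apply Rgt_not_eq, Hri.
    + now apply ex_series_scal_r.
  - apply ex_series_ext_R with (2 := H2). intros i. rewrite <- Series_scal_r.
    apply Series_ext. intros j. now rewrite E.
  - intros x y Hx Hy. destruct (H x y) as [_ [_ H3]]; try (unfold r in *; lra).
    rewrite <- (is_series_unique _ _ H3). apply Series_ext. intros i.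
    rewrite <- Series_scal_r. apply Series_ext. intros j. ring.
Qed.

Lemma abs_summable_le (c : nat -> nat -> R) (r s : R) :
  0 <= s <= r -> abs_summable c r -> abs_summable c s.
Proof.
  intros Hs [H1 H2].
  assert (T : forall i j, 0 <= Rabs (c i j) * s ^ j <= Rabs (c i j) * r ^ j).
  { intros i j. split.
    - apply Rmult_le_pos; [ apply Rabs_pos | now apply pow_le ].
    - apply Rmult_le_compat_l; [ apply Rabs_pos | now apply pow_incr ]. }
  assert (T1 : forall i, ex_series (fun j => Rabs (c i j) * s ^ j)).
  { intros i. apply ex_series_le_R with (2 := H1 i). intros j.
    rewrite Rabs_pos_eq; apply T. }
  split; auto.
  apply ex_series_le_R with (2 := H2). intros i.
  assert (0 <= Series (fun j => Rabs (c i j) * s ^ j)) by (apply Series_nonneg; auto; apply T).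
  rewrite Rabs_pos_eq.
  - apply Rmult_le_compat; auto; [ now apply pow_le | | now apply pow_incr ].
    apply Series_le; auto.
  - apply Rmult_le_pos; auto. now apply pow_le.
Qed.

Lemma expands2_le (c : nat -> nat -> R) (r s : R) (f : R -> R -> R) :
  0 < s <= r -> expands2 c r f -> expands2 c s f.
Proof.
  intros Hs [Hr [H1 H2]]. split; [ lra | split ].
  - apply abs_summable_le with r; auto. lra.
  - intros x y Hx Hy. apply H2; lra.
Qed.

Section Summable.
Context (c : nat -> nat -> R) (r : R) (Hr : 0 < r) (Hc : abs_summable c r).

Definition row_bound (i : nat) : R := Series (fun j => Rabs (c i j) * r ^ j).

Lemma row_bound_nonneg (i : nat) : 0 <= row_bound i.
Proof.
  apply Series_nonneg; [ | apply Hc ]. intros j.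
  apply Rmult_le_pos; [ apply Rabs_pos | apply pow_le; lra ].
Qed.

Lemma row_abs_summable (i : nat) (y : R) : Rabs y <= r ->
  ex_series (fun j => Rabs (c i j * y ^ j)).
Proof.
  intros Hy. apply ex_series_le_R with (2 := proj1 Hc i). intros j.
  rewrite Rabs_Rabsolu, Rabs_mult. apply Rmult_le_compat_l; [ apply Rabs_pos | ].
  now apply pow_abs_le.
Qed.

Lemma row_le_bound (i : nat) (y : R) : Rabs y <= r ->
  Rabs (Series (fun j => c i j * y ^ j)) <= row_bound i.
Proof.
  intros Hy. eapply Rle_trans; [ apply Series_Rabs; now apply row_abs_summable | ].
  apply Series_le; [ | apply Hc ]. intros j. split; [ apply Rabs_pos | ].
  rewrite Rabs_mult. apply Rmult_le_compat_l; [ apply Rabs_pos | ].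
  now apply pow_abs_le.
Qed.

Lemma rows_abs_summable (x y : R) : Rabs x <= r -> Rabs y <= r ->
  ex_series (fun i => Rabs (Series (fun j => c i j * y ^ j) * x ^ i)).
Proof.
  intros Hx Hy. apply ex_series_le_R with (2 := proj2 Hc). intros i.
  rewrite Rabs_Rabsolu, Rabs_mult. apply Rmult_le_compat; try apply Rabs_pos.
  - now apply row_le_bound.
  - now apply pow_abs_le.
Qed.

Lemma sum2_bounded (x y : R) : Rabs x <= r -> Rabs y <= r ->
  Rabs (sum2 c x y) <= Series (fun i => row_bound i * r ^ i).
Proof.
  intros Hx Hy. eapply Rle_trans; [ apply Series_Rabs; now apply rows_abs_summable | ].
  apply Series_le; [ | apply Hc ]. intros i. split; [ apply Rabs_pos | ].
  rewrite Rabs_mult. apply Rmult_le_compat; try apply Rabs_pos.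
  - now apply row_le_bound.
  - now apply pow_abs_le.
Qed.

(** Transposing the coefficients exchanges the variables, so that facts proved about x carry over to
    y; summability survives by Tonelli's theorem. *)
Lemma abs_summable_flip : abs_summable (fun i j => c j i) r.
Proof.
  set (a := fun i j => Rabs (c i j) * r ^ j * r ^ i).
  assert (Hp : forall i, 0 < r ^ i) by (intros; now apply pow_lt).
  destruct (tonelli_le a) as [H3 [H4 _]].
  - intros i j. unfold a. repeat apply Rmult_le_pos; try (left; apply Hp). apply Rabs_pos.
  - intros i. apply ex_series_scal_r, Hc.
  - apply ex_series_ext_R with (2 := proj2 Hc). intros i. symmetry. apply Series_scal_r.
  - split.
    + intros j. apply ex_series_ext_R with (fun i => a i j * / r ^ j).
      * intros i. unfold a. field. apply Rgt_not_eq, Hp.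
      * now apply ex_series_scal_r.
    + apply ex_series_ext_R with (2 := H4). intros j. rewrite <- Series_scal_r.
      apply Series_ext. intros i. unfold a. ring.
Qed.

Lemma sum2_flip (x y : R) : Rabs x <= r -> Rabs y <= r ->
  sum2 (fun i j => c j i) y x = sum2 c x y.
Proof.
  intros Hx Hy. unfold sum2.
  rewrite (Series_ext _ (fun j => Series (fun i => c i j * y ^ j * x ^ i))).
  2:{ intros j. rewrite <- Series_scal_r. apply Series_ext. intros i. ring. }
  rewrite (fubini_series (fun i j => c i j * y ^ j * x ^ i)).
  - apply Series_ext. intros i. apply Series_scal_r.
  - intros i. apply ex_series_ext_R with (fun j => Rabs (c i j * y ^ j) * Rabs (x ^ i)).
    + intros j. now rewrite <- Rabs_mult.
    + now apply ex_series_scal_r, row_abs_summable.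
  - apply ex_series_le_R with (2 := proj2 Hc). intros i.
    rewrite (Series_ext _ (fun j => Rabs (c i j * y ^ j) * Rabs (x ^ i))).
    2:{ intros j. now rewrite <- Rabs_mult. }
    rewrite Series_scal_r, Rabs_mult, Rabs_Rabsolu.
    apply Rmult_le_compat; try apply Rabs_pos; [ | now apply pow_abs_le ].
    rewrite Rabs_pos_eq.
    2:{ apply Series_nonneg; [ intros; apply Rabs_pos | now apply row_abs_summable ]. }
    apply Series_le; [ | apply Hc ]. intros j. split; [ apply Rabs_pos | ].
    rewrite Rabs_mult. apply Rmult_le_compat_l; [ apply Rabs_pos | ].
    now apply pow_abs_le.
Qed.

End Summable.

Lemma expands2_flip (c : nat -> nat -> R) (r : R) (f : R -> R -> R) :
  expands2 c r f -> expands2 (fun i j => c j i) r (fun x y => f y x).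
Proof.
  intros [Hr [H1 H2]]. split; [ auto | split ].
  - now apply abs_summable_flip.
  - intros x y Hx Hy. rewrite H2 by auto. symmetry. now apply sum2_flip with r.
Qed.

Lemma ex_series_CV_radius (a : nat -> R) (r : R) :
  0 < r -> ex_series (fun n => Rabs (a n) * r ^ n) -> Rbar_le r (CV_radius a).
Proof.
  intros Hr H. apply CV_radius_bounded. 
  exists (Series (fun n => Rabs (a n) * r ^ n)). intros n.
  rewrite Rabs_mult, (Rabs_pos_eq (r ^ n)) by (apply pow_le; lra).
  apply (term_le_Series (fun n => Rabs (a n) * r ^ n)); auto.
  intros k. apply Rmult_le_pos; [ apply Rabs_pos | apply pow_le; lra ].
Qed.

Definition dx_coef (c : nat -> nat -> R) (i j : nat) : R := INR (S i) * c (S i) j.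

Lemma dx_coef_row (c : nat -> nat -> R) (i : nat) (y : R) :
  Series (fun j => dx_coef c i j * y ^ j)
  = PS_derive (fun i => Series (fun j => c i j * y ^ j)) i.
Proof.
  unfold PS_derive, dx_coef. rewrite <- Series_scal_l. apply Series_ext. intros j. ring.
Qed.

(** The row sums at height [s] are the coefficients of a power series in x whose radius of
    convergence is at least [r]. Differentiation keeps that radius, so the derived series converges
    absolutely at [s]. *)
Lemma abs_summable_dx (c : nat -> nat -> R) (r s : R) :
  0 < s < r -> abs_summable c r -> abs_summable (dx_coef c) s.
Proof.
  intros Hs Hc.
  assert (Hcs : abs_summable c s) by (apply abs_summable_le with r; auto; lra).
  set (b := row_bound c s).
  assert (E : forall i j, Rabs (dx_coef c i j) * s ^ j = INR (S i) * (Rabs (c (S i) j) * s ^ j)).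
  { intros i j. unfold dx_coef. rewrite Rabs_mult, (Rabs_pos_eq (INR _)) by apply pos_INR.
    ring. }
  assert (Hb : Rbar_le r (CV_radius b)).
  { apply ex_series_CV_radius; [ lra | ]. apply ex_series_le_R with (2 := proj2 Hc).
    intros i. assert (0 <= b i) by (apply row_bound_nonneg; auto; lra).
    rewrite Rabs_pos_eq, Rabs_pos_eq; auto.
    - apply Rmult_le_compat_r; [ apply pow_le; lra | ].
      apply Series_le; [ | apply Hc ]. intros j. split.
      + apply Rmult_le_pos; [ apply Rabs_pos | apply pow_le; lra ].
      + apply Rmult_le_compat_l; [ apply Rabs_pos | apply pow_incr; lra ].
    - apply Rmult_le_pos; [ apply Rabs_pos | apply pow_le; lra ]. }
  split.
  - intros i. apply ex_series_ext_R with (fun j => INR (S i) * (Rabs (c (S i) j) * s ^ j)).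
    + intros j. now rewrite E.
    + apply (ex_series_scal_l (INR (S i)) (fun j => Rabs (c (S i) j) * s ^ j)), Hcs.
  - apply ex_series_ext_R with (fun i => PS_derive b i * s ^ i).
    + intros i. f_equal. rewrite (Series_ext _ _ (E i)), Series_scal_l. reflexivity.
    + apply ex_series_Rabs, CV_disk_inside. rewrite CV_radius_derive.
      apply Rbar_lt_le_trans with r; auto. simpl. rewrite Rabs_pos_eq; lra.
Qed.

Lemma sum2_is_derive_x (c : nat -> nat -> R) (r x y : R) :
  0 < r -> abs_summable c r -> Rabs x < r -> Rabs y <= r ->
  is_derive (fun u => sum2 c u y) x (sum2 (dx_coef c) x y).
Proof.
  intros Hr Hc Hx Hy.
  set (a := fun i => Series (fun j => c i j * y ^ j)).
  replace (sum2 (dx_coef c) x y) with (PSeries (PS_derive a) x).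
  - apply (is_derive_PSeries a).
    apply Rbar_lt_le_trans with r; [ exact Hx | ].
    apply ex_series_CV_radius; auto. apply ex_series_le_R with (2 := proj2 Hc).
    intros i. rewrite Rabs_mult, Rabs_Rabsolu, (Rabs_pos_eq (r ^ i)) by (apply pow_le; lra).
    apply Rmult_le_compat_r; [ apply pow_le; lra | ].
    now apply (row_le_bound c r).
  - apply Series_ext. intros i. now rewrite dx_coef_row.
Qed.

Lemma locally_abs_lt (x r : R) : Rabs x < r -> locally x (fun u => Rabs u < r).
Proof.
  intros H. assert (Hd : 0 < r - Rabs x) by lra. exists (mkposreal _ Hd). intros u Hu.
  rewrite ball_R in Hu. simpl in Hu. generalize (Rabs_triang_inv u x). lra.
Qed.

Lemma expands2_dx (c : nat -> nat -> R) (r s : R) (f : R -> R -> R) :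
  0 < s < r -> expands2 c r f ->
  expands2 (dx_coef c) s (sum2 (dx_coef c)) /\
  forall x y, Rabs x < s -> Rabs y <= s ->
    is_derive (fun u => f u y) x (sum2 (dx_coef c) x y).
Proof.
  intros Hs [Hr [Hc Hf]]. split.
  - split; [ lra | split; [ now apply abs_summable_dx with r | reflexivity ] ].
  - intros x y Hx Hy.
    apply is_derive_ext_loc with (fun u => sum2 c u y).
    + assert (Hx' : Rabs x < r) by lra.
      generalize (locally_abs_lt x r Hx'). apply filter_imp.
      intros u Hu. symmetry. apply Hf; lra.
    + apply sum2_is_derive_x with r; auto; lra.
Qed.

Definition dy_coef (c : nat -> nat -> R) (i j : nat) : R := INR (S j) * c i (S j).

Lemma expands2_dy (c : nat -> nat -> R) (r s : R) (f : R -> R -> R) :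
  0 < s < r -> expands2 c r f ->
  expands2 (dy_coef c) s (fun x y => sum2 (dx_coef (fun i j => c j i)) y x) /\
  forall x y, Rabs x <= s -> Rabs y < s ->
    is_derive (fun v => f x v) y (sum2 (dx_coef (fun i j => c j i)) y x).
Proof.
  intros Hs Hf. apply expands2_flip in Hf.
  destruct (expands2_dx _ _ _ _ Hs Hf) as [H1 H2]. split.
  - now apply expands2_flip in H1.
  - intros x y Hx Hy. now apply H2.
Qed.

Lemma sum2_0 (c : nat -> nat -> R) (r : R) :
  0 < r -> abs_summable c r -> sum2 c 0 0 = c O O.
Proof.
  intros Hr Hc. unfold sum2.
  assert (E : forall a : nat -> R, Series (fun n => a n * 0 ^ n) = a O).
  { intros a. apply (PSeries_0 a). }
  rewrite E. apply E.
Qed.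

Lemma Analytic_bounded (f : R -> R -> R) :
  Analytic f -> exists r B, 0 < r /\
    forall x y, Rabs x <= r -> Rabs y <= r -> Rabs (f x y) <= B.
Proof.
  intros [c [r [Hr [Hc Hf]]]]. exists r, (Series (fun i => row_bound c r i * r ^ i)).
  split; auto. intros x y Hx Hy. rewrite Hf by auto. now apply sum2_bounded.
Qed.

Lemma Analytic_flip (f : R -> R -> R) : Analytic f -> Analytic (fun x y => f y x).
Proof.
  intros [c [r H]]. exists (fun i j => c j i), r. now apply expands2_flip.
Qed.

Lemma Analytic_dx (f : R -> R -> R) : Analytic f ->
  exists fx r, Analytic fx /\ 0 < r /\
    forall x y, Rabs x < r -> Rabs y < r -> is_derive (fun u => f u y) x (fx x y).
Proof.
  intros [c [r Hf]]. assert (Hr : 0 < r) by apply Hf.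
  destruct (expands2_dx c r (r / 2) f) as [H1 H2]; [ lra | auto | ].
  exists (sum2 (dx_coef c)), (r / 2). split; [ now exists (dx_coef c), (r / 2) | ].
  split; [ lra | ]. intros x y Hx Hy. apply H2; lra.
Qed.

Lemma Analytic_dy (f : R -> R -> R) : Analytic f ->
  exists fy r, Analytic fy /\ 0 < r /\
    forall x y, Rabs x < r -> Rabs y < r -> is_derive (fun v => f x v) y (fy x y).
Proof.
  intros Hf. apply Analytic_flip in Hf.
  destruct (Analytic_dx _ Hf) as [g [r [H1 [H2 H3]]]].
  exists (fun x y => g y x), r. split; [ now apply Analytic_flip | split; auto ].
Qed.

(** Dropping the row [i = 0] divides by x; together with the division of that row by y in
    [expands2_row0], this yields Hadamard's decomposition. *)
Lemma expands2_shift (c : nat -> nat -> R) (r : R) (f : R -> R -> R) :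
  expands2 c r f -> exists f1,
  expands2 (fun i j => c (S i) j) r f1 /\
  forall x y, Rabs x <= r -> Rabs y <= r ->
    f x y = Series (fun j => c O j * y ^ j) + x * f1 x y.
Proof.
  intros [Hr [Hc Hf]]. exists (sum2 (fun i j => c (S i) j)).
  assert (Hc' : abs_summable (fun i j => c (S i) j) r).
  { split; [ intros i; apply Hc | ].
    apply ex_series_ext_R with
      (fun i => Series (fun j => Rabs (c (S i) j) * r ^ j) * r ^ (S i) * / r).
    - intros i. simpl pow. field. lra.
    - apply ex_series_scal_r.
      apply (ex_series_incr_1 (fun i => Series (fun j => Rabs (c i j) * r ^ j) * r ^ i)), Hc. }
  split; [ now split | ].
  intros x y Hx Hy. rewrite Hf by auto. unfold sum2.
  rewrite Series_incr_1.
  - rewrite <- Series_scal_l. f_equal; [ simpl; ring | ].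
    apply Series_ext. intros i. simpl. ring.
  - apply ex_series_Rabs. now apply rows_abs_summable with r.
Qed.

Lemma expands2_row0 (c : nat -> nat -> R) (r : R) (f : R -> R -> R) :
  expands2 c r f -> exists f2,
  expands2 (fun i j => match i with O => c O (S j) | S _ => 0 end) r (fun _ y => f2 y) /\
  forall y, Rabs y <= r -> Series (fun j => c O j * y ^ j) = c O O + y * f2 y.
Proof.
  intros [Hr [Hc Hf]]. exists (fun y => Series (fun j => c O (S j) * y ^ j)).
  split; [ split; [ auto | split; [ split | ] ] | ].
  - intros [|i].
    + apply ex_series_ext_R with (fun j => Rabs (c O (S j)) * r ^ (S j) * / r).
      * intros j. simpl pow. field. lra.
      * apply ex_series_scal_r, (ex_series_incr_1 (fun j => Rabs (c O j) * r ^ j)), Hc.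
    + apply ex_series_zero. intros j. rewrite Rabs_R0. ring.
  - eexists. eapply is_series_ext; [ | apply is_series_single ]. intros [|i]; simpl.
    + symmetry. apply Rmult_1_r.
    + rewrite Series_zero; [ now rewrite Rmult_0_l | ]. intros j. rewrite Rabs_R0. ring.
  - intros x y Hx Hy. symmetry. apply is_series_unique.
    eapply is_series_ext; [ | apply is_series_single ]. intros [|i]; simpl.
    + symmetry. apply Rmult_1_r.
    + rewrite Series_zero; [ now rewrite Rmult_0_l | ]. intros j. ring.
  - intros y Hy. rewrite Series_incr_1.
    + rewrite <- Series_scal_l. f_equal; [ simpl; ring | ].
      apply Series_ext. intros i. simpl. ring.
    + apply ex_series_Rabs. apply row_abs_summable with r; auto.
Qed.

(** Hadamard's lemma, the step that drives the expansions in powers of e: at arguments of size e it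
    extracts one factor e and leaves analytic functions again. *)
Lemma Analytic_decomp (f : R -> R -> R) : Analytic f ->
  exists f1 f2 r, Analytic f1 /\ Analytic f2 /\ 0 < r /\
    forall x y, Rabs x < r -> Rabs y < r -> f x y = f 0 0 + (x * f1 x y + y * f2 x y).
Proof.
  intros [c [r H]].
  destruct (expands2_shift _ _ _ H) as [f1 [A1 E1]].
  destruct (expands2_row0 _ _ _ H) as [f2 [A2 E2]].
  assert (Hr : 0 < r) by apply H.
  exists f1, (fun _ y => f2 y), r. split; [ | split; [ | split; auto ] ].
  - eexists; eexists; apply A1.
  - eexists; eexists; apply A2.
  - assert (E : f 0 0 = c O O).
    { rewrite E1, E2 by (rewrite Rabs_R0; lra). ring. }
    intros x y Hx Hy. rewrite E, E1, E2 by lra. ring.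
Qed.

Lemma mvt_bound (g dg : R -> R) (r B x y : R) :
  (forall t, Rabs t < r -> is_derive g t (dg t)) ->
  (forall t, Rabs t < r -> Rabs (dg t) <= B) ->
  Rabs x < r -> Rabs y < r -> Rabs (g y - g x) <= B * Rabs (y - x).
Proof.
  intros Hd HB Hx Hy.
  assert (Ht : forall t, Rmin x y <= t <= Rmax x y -> Rabs t < r).
  { intros t. unfold Rmin, Rmax. destruct (Rle_dec x y); split_Rabs; lra. }
  destruct (MVT_gen g x y dg) as [t [Ht1 ->]].
  - intros t H. apply Hd, Ht. lra.
  - intros t H. apply derivable_continuous_pt. exists (dg t). apply is_derive_Reals.
    now apply Hd, Ht.
  - rewrite Rabs_mult. apply Rmult_le_compat_r; [ apply Rabs_pos | ]. now apply HB, Ht.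
Qed.

Lemma Analytic_lipschitz (f : R -> R -> R) : Analytic f ->
  exists r C, 0 < r /\ 0 <= C /\ forall x1 y1 x2 y2,
    Rabs x1 < r -> Rabs y1 < r -> Rabs x2 < r -> Rabs y2 < r ->
    Rabs (f x2 y2 - f x1 y1) <= C * (Rabs (x2 - x1) + Rabs (y2 - y1)).
Proof.
  intros Hf.
  destruct (Analytic_dx f Hf) as [fx [r1 [Ax [Hr1 Hx]]]].
  destruct (Analytic_dy f Hf) as [fy [r2 [Ay [Hr2 Hy]]]].
  destruct (Analytic_bounded fx Ax) as [r3 [B1 [Hr3 HB1]]].
  destruct (Analytic_bounded fy Ay) as [r4 [B2 [Hr4 HB2]]].
  set (r := Rmin (Rmin r1 r2) (Rmin r3 r4)).
  assert (L : r <= r1 /\ r <= r2 /\ r <= r3 /\ r <= r4).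
  { unfold r. generalize (Rmin_l (Rmin r1 r2) (Rmin r3 r4)) (Rmin_r (Rmin r1 r2) (Rmin r3 r4))
      (Rmin_l r1 r2) (Rmin_r r1 r2) (Rmin_l r3 r4) (Rmin_r r3 r4). lra. }
  assert (Hr : 0 < r) by (unfold r; repeat apply Rmin_glb_lt; auto).
  exists r, (Rmax 0 (Rmax B1 B2)). split; [ auto | split; [ apply Rmax_l | ] ].
  set (C := Rmax 0 (Rmax B1 B2)).
  assert (M : B1 <= C /\ B2 <= C).
  { unfold C. generalize (Rmax_r 0 (Rmax B1 B2)) (Rmax_l B1 B2) (Rmax_r B1 B2). lra. }
  intros x1 y1 x2 y2 H1 H2 H3 H4.
  assert (K1 : Rabs (f x2 y2 - f x1 y2) <= C * Rabs (x2 - x1)).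
  { apply (mvt_bound (fun u => f u y2) (fun u => fx u y2) r); auto.
    - intros t Ht. apply Hx; lra.
    - intros t Ht. apply Rle_trans with B1; [ apply HB1; lra | lra ]. }
  assert (K2 : Rabs (f x1 y2 - f x1 y1) <= C * Rabs (y2 - y1)).
  { apply (mvt_bound (fun v => f x1 v) (fun v => fy x1 v) r); auto.
    - intros t Ht. apply Hy; lra.
    - intros t Ht. apply Rle_trans with B2; [ apply HB2; lra | lra ]. }
  replace (f x2 y2 - f x1 y1) with ((f x2 y2 - f x1 y2) + (f x1 y2 - f x1 y1)) by ring.
  eapply Rle_trans; [ apply Rabs_triang | ]. lra.
Qed.

Lemma Analytic_continuity (f : R -> R -> R) : Analytic f ->
  exists r, 0 < r /\ forall x y, Rabs x < r -> Rabs y < r -> continuity_2d_pt f x y.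
Proof.
  intros Hf. destruct (Analytic_lipschitz f Hf) as [r [C [Hr [HC HL]]]].
  exists r. split; auto. intros x y Hx Hy e.
  set (d := Rmin (Rmin (r - Rabs x) (r - Rabs y)) (e / (2 * C + 1))).
  assert (He : 0 < e) by apply cond_pos.
  assert (Hd : 0 < d).
  { unfold d. repeat apply Rmin_glb_lt; try lra. apply Rdiv_lt_0_compat; lra. }
  exists (mkposreal d Hd). simpl. intros u v Hu Hv.
  assert (L : d <= r - Rabs x /\ d <= r - Rabs y /\ d <= e / (2 * C + 1)).
  { unfold d. generalize (Rmin_l (Rmin (r - Rabs x) (r - Rabs y)) (e / (2 * C + 1)))
      (Rmin_r (Rmin (r - Rabs x) (r - Rabs y)) (e / (2 * C + 1)))
      (Rmin_l (r - Rabs x) (r - Rabs y)) (Rmin_r (r - Rabs x) (r - Rabs y)). lra. }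
  assert (Hu' : Rabs u < r) by (revert Hu L; clear; intros; split_Rabs; lra).
  assert (Hv' : Rabs v < r) by (revert Hv L; clear; intros; split_Rabs; lra).
  eapply Rle_lt_trans; [ now apply HL | ].
  apply Rle_lt_trans with (C * (2 * (e / (2 * C + 1)))).
  - apply Rmult_le_compat_l; lra.
  - replace (C * (2 * (e / (2 * C + 1)))) with (e - e / (2 * C + 1)) by (field; lra).
    assert (0 < e / (2 * C + 1)) by (apply Rdiv_lt_0_compat; lra). lra.
Qed.

(** By the mean value theorem the remainder is [z - y] times an increment of [fy], and [fy] is
    Lipschitz; no second derivative enters. *)
Lemma Analytic_taylor_y (f fy : R -> R -> R) (r1 : R) : Analytic fy -> 0 < r1 ->
  (forall x y, Rabs x < r1 -> Rabs y < r1 -> is_derive (fun v => f x v) y (fy x y)) ->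
  exists r C, 0 < r /\ 0 <= C /\ forall x y z, Rabs x < r -> Rabs y < r -> Rabs z < r ->
    Rabs (f x z - f x y - (z - y) * fy x y) <= C * (z - y) ^ 2.
Proof.
  intros Ay Hr1 Hy.
  destruct (Analytic_lipschitz fy Ay) as [r2 [C [Hr2 [HC HL]]]].
  set (r := Rmin r1 r2).
  assert (L : r <= r1 /\ r <= r2) by (split; [ apply Rmin_l | apply Rmin_r ]).
  exists r, C. split; [ now apply Rmin_glb_lt | split; auto ].
  intros x y z Hx H1 H2.
  assert (Hz : forall v, Rmin y z <= v <= Rmax y z -> Rabs v < r /\ Rabs (v - y) <= Rabs (z - y)).
  { intros v. unfold Rmin, Rmax. destruct (Rle_dec y z); split_Rabs; lra. }
  destruct (MVT_gen (f x) y z (fy x)) as [v [Hv ->]].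
  - intros v Hv. assert (Hv' : Rmin y z <= v <= Rmax y z) by lra.
    apply Hz in Hv'. apply Hy; lra.
  - intros v Hv. apply Hz in Hv. apply derivable_continuous_pt. exists (fy x v).
    apply is_derive_Reals, Hy; lra.
  - apply Hz in Hv.
    replace (fy x v * (z - y) - (z - y) * fy x y) with ((z - y) * (fy x v - fy x y)) by ring.
    rewrite Rabs_mult, <- (pow2_abs (z - y)).
    assert (K : Rabs (fy x v - fy x y) <= C * Rabs (z - y)).
    { eapply Rle_trans; [ apply HL; lra | ].
      replace (x - x) with 0 by ring. rewrite Rabs_R0.
      apply Rmult_le_compat_l; lra. }
    generalize (Rabs_pos (z - y)). intros.
    replace (C * Rabs (z - y) ^ 2) with (Rabs (z - y) * (C * Rabs (z - y))) by ring.
    apply Rmult_le_compat_l; lra.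
Qed.

Lemma CV_radius_expansion1 (u : nat -> R) (f : R -> R) :
  has_expansion1 u f -> exists r, 0 < r /\ Rbar_lt r (CV_radius u) /\
    forall x, Rabs x < r -> f x = PSeries u x.
Proof.
  intros H. apply locally_0_iff in H. destruct H as [r [Hr H]].
  (* Convergence at [r / 2] only bounds the terms there, so the radius of convergence is at least
     [r / 2]; the strict inequality is obtained at [r / 4]. *)
  exists (r / 4). split; [ lra | split ].
  - apply Rbar_lt_le_trans with (r / 2); [ simpl; lra | ].
    apply CV_radius_bounded.
    assert (Hx : Rabs (r / 2) < r) by (rewrite Rabs_pos_eq; lra).
    specialize (H _ Hx). apply is_pseries_R in H.
    destruct (filterlim_bounded (fun n => u n * (r / 2) ^ n)) as [M HM].
    + exists 0. apply ex_series_lim_0. eexists. apply H.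
    + now exists M.
  - intros x Hx. symmetry. apply is_pseries_unique, H. lra.
Qed.

Lemma Analytic_of_expansion1 (u : nat -> R) (F : R -> R) :
  has_expansion1 u F -> Analytic (fun x _ => F x).
Proof.
  intros H. destruct (CV_radius_expansion1 u F H) as [r [Hr [Hr' HF]]].
  assert (Hcv : Rbar_lt (Rabs (r / 2)) (CV_radius u)).
  { apply Rbar_lt_trans with r; auto. simpl. rewrite Rabs_pos_eq; lra. }
  assert (Habs := CV_disk_inside _ _ Hcv).
  assert (Hr2 : 0 < r / 2) by lra.
  (* As a function of the second variable the series fills the single row [i = 0]; the variables are
     exchanged at the end. *)
  assert (A : Analytic (fun _ x => F x)).
  { exists (fun i j => match i with O => u j | S _ => 0 end), (r / 2).
    split; [ lra | split; [ split | ] ].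
    - intros [|i].
      + apply ex_series_ext_R with (2 := Habs). intros j.
        rewrite Rabs_mult, (Rabs_pos_eq (_ ^ _)); auto. apply pow_le; lra.
      + apply ex_series_zero. intros j. rewrite Rabs_R0. ring.
    - eexists. eapply is_series_ext; [ | apply is_series_single ]. intros [|i]; simpl.
      + symmetry. apply Rmult_1_r.
      + rewrite Series_zero; [ now rewrite Rmult_0_l | ]. intros j. rewrite Rabs_R0. ring.
    - intros x y Hx Hy. unfold sum2. symmetry.
      rewrite HF by lra. apply is_series_unique.
      eapply is_series_ext; [ | apply is_series_single ]. intros [|i]; simpl.
      + symmetry. apply Rmult_1_r.
      + rewrite Series_zero; [ now rewrite Rmult_0_l | ]. intros j. ring. }
  now apply Analytic_flip in A.
Qed.

(** * Flat analytic functions *)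

Lemma pow_S_small (y : R) (N : nat) : 0 < y <= 1 ->
  0 < y ^ S N /\ y ^ S N <= y /\ y ^ S N <= y ^ N.
Proof.
  intros Hy. assert (Hp : 0 < y ^ N <= 1).
  { split; [ now apply pow_lt | ]. rewrite <- (pow1 N). apply pow_incr. lra. }
  simpl. nra.
Qed.

Lemma small_const_zero (a K d : R) : 0 < d ->
  (forall y, 0 < y < d -> Rabs a <= K * y) -> a = 0.
Proof.
  intros Hd H. apply NNPP. intros Ha. apply Rabs_pos_lt in Ha.
  assert (HK : 0 < K).
  { assert (0 < d / 2 < d) by lra. specialize (H _ H0). nra. }
  set (y := Rmin (d / 2) (Rabs a / (2 * K))).
  assert (Hy : 0 < y) by (apply Rmin_glb_lt; [ lra | apply Rdiv_lt_0_compat; lra ]).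
  assert (Hy1 : y <= d / 2) by apply Rmin_l.
  assert (Hy2 : y <= Rabs a / (2 * K)) by apply Rmin_r.
  assert (L : Rabs a <= K * y) by (apply H; lra).
  assert (K * y <= K * (Rabs a / (2 * K))) by (apply Rmult_le_compat_l; lra).
  replace (K * (Rabs a / (2 * K))) with (Rabs a / 2) in H0 by (field; lra). lra.
Qed.

(** Flatness along the y-axis first gives [c O O = 0]; dividing by y then shifts the row by one
    place and loses one order of flatness. *)
Lemma flat_row_zero (j : nat) : forall (c : nat -> nat -> R) (r : R) (f : R -> R -> R),
  expands2 c r f ->
  (forall N, exists C d, 0 < d /\ forall y, 0 < y < d -> Rabs (f 0 y) <= C * y ^ N) ->
  c O j = 0.
Proof.
  assert (H0 : forall c r f, expands2 c r f ->
    (forall N, exists C d, 0 < d /\ forall y, 0 < y < d -> Rabs (f 0 y) <= C * y ^ N) ->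
    c O O = 0 /\ exists f2,
    expands2 (fun i j => match i with O => c O (S j) | S _ => 0 end) r (fun _ y => f2 y) /\
    forall y, Rabs y <= r -> f 0 y = y * f2 y).
  { intros c r f Hf Hflat. assert (Hr : 0 < r) by apply Hf.
    destruct (expands2_shift _ _ _ Hf) as [f1 [_ E1]].
    destruct (expands2_row0 _ _ _ Hf) as [f2 [A2 E2]].
    assert (E : forall y, Rabs y <= r -> f 0 y = c O O + y * f2 y).
    { intros y Hy. rewrite E1, E2; auto. ring. rewrite Rabs_R0; lra. }
    assert (Hc : c O O = 0).
    { destruct (Analytic_bounded (fun _ y => f2 y)) as [r' [B [Hr' HB]]].
      { eexists; eexists; apply A2. }
      destruct (Hflat 1%nat) as [C [d [Hd HC]]].
      apply (small_const_zero _ (C + B) (Rmin d (Rmin r r'))).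
      - repeat apply Rmin_glb_lt; auto.
      - intros y [Hy0 Hy].
        generalize (Rmin_l d (Rmin r r')) (Rmin_r d (Rmin r r')) (Rmin_l r r') (Rmin_r r r').
        intros. replace (c O O) with (f 0 y - y * f2 y)
          by (rewrite E; [ ring | rewrite Rabs_pos_eq; lra ]).
        eapply Rle_trans; [ apply Rabs_triang | ]. rewrite Rabs_Ropp, Rabs_mult.
        assert (Rabs (f 0 y) <= C * y ^ 1) by (apply HC; lra).
        assert (Rabs (f2 y) <= B).
        { apply (HB 0 y); [ rewrite Rabs_R0 | rewrite Rabs_pos_eq ]; lra. }
        rewrite (Rabs_pos_eq y) by lra.
        assert (y * Rabs (f2 y) <= y * B) by (apply Rmult_le_compat_l; lra). lra. }
    split; auto. exists f2. split; auto. intros y Hy. rewrite E, Hc by auto. ring. }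
  induction j as [|j IH]; intros c r f Hf Hflat.
  - now apply (H0 c r f).
  - destruct (H0 c r f Hf Hflat) as [Hc [f2 [A2 E2]]]. assert (Hr : 0 < r) by apply Hf.
    apply (IH _ _ _ A2). intros N. destruct (Hflat (S N)) as [C [d [Hd HC]]].
    exists C, (Rmin d r). split; [ now apply Rmin_glb_lt | ]. intros y [Hy0 Hy].
    generalize (Rmin_l d r) (Rmin_r d r). intros.
    assert (L : Rabs (f 0 y) <= C * y ^ S N) by (apply HC; lra).
    rewrite E2, Rabs_mult, (Rabs_pos_eq y) in L by (rewrite ?Rabs_pos_eq; lra).
    simpl pow in L. apply Rmult_le_reg_l with y; lra.
Qed.

(* Flatness is tested along the curves x = y^N only: unlike flatness on a full
   neighborhood, this survives division by x. *)
Lemma flat_coef_zero (i : nat) : forall (c : nat -> nat -> R) (r : R) (f : R -> R -> R),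
  expands2 c r f ->
  (forall N D, exists C d, 0 < d /\
     forall y, 0 < y < d -> Rabs (f (y ^ S N) y) <= C * y ^ D) ->
  forall j, c i j = 0.
Proof.
  assert (H0 : forall c r f, expands2 c r f ->
    (forall N D, exists C d, 0 < d /\
      forall y, 0 < y < d -> Rabs (f (y ^ S N) y) <= C * y ^ D) ->
    forall j, c O j = 0).
  { intros c r f Hf Hflat j. apply (flat_row_zero j c r f Hf). intros N.
    destruct (Hflat N N) as [C [d [Hd HC]]].
    destruct (Analytic_lipschitz f) as [s [L [Hs [HL0 HL]]]]; [ now exists c, r | ].
    exists (C + L), (Rmin (Rmin d s) 1). split; [ repeat apply Rmin_glb_lt; lra | ].
    intros y [Hy0 Hy].
    generalize (Rmin_l (Rmin d s) 1) (Rmin_r (Rmin d s) 1) (Rmin_l d s) (Rmin_r d s). intros.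
    destruct (pow_S_small y N) as [Hq0 [Hq Hq']]; [ lra | ].
    (* The Lipschitz bound carries flatness from the curve x = [y ^ S N] to the y-axis, up to an
       error O([y ^ N]). *)
    replace (f 0 y) with (f (y ^ S N) y + (f 0 y - f (y ^ S N) y)) by ring.
    eapply Rle_trans; [ apply Rabs_triang | ].
    assert (K1 : Rabs (f (y ^ S N) y) <= C * y ^ N) by (apply HC; lra).
    assert (K2 : Rabs (f 0 y - f (y ^ S N) y) <= L * (Rabs (0 - y ^ S N) + Rabs (y - y))).
    { apply HL; try rewrite Rabs_R0; try rewrite Rabs_pos_eq; lra. }
    replace (y - y) with 0 in K2 by ring.
    replace (0 - y ^ S N) with (- y ^ S N) in K2 by ring.
    rewrite Rabs_R0, Rabs_Ropp, (Rabs_pos_eq (y ^ S N)) in K2 by lra.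
    assert (L * (y ^ S N + 0) <= L * y ^ N) by (apply Rmult_le_compat_l; lra). lra. }
  induction i as [|i IH]; intros c r f Hf Hflat j; [ now apply (H0 c r f) | ].
  destruct (expands2_shift _ _ _ Hf) as [f1 [A1 E1]]. assert (Hr : 0 < r) by apply Hf.
  apply (IH _ _ _ A1). intros N D.
  (* The division by x, which equals [y ^ S N] on the curve, costs [S N] orders. *)
  destruct (Hflat N (S N + D)%nat) as [C [d [Hd HC]]].
  exists C, (Rmin (Rmin d r) 1). split; [ repeat apply Rmin_glb_lt; lra | ].
  intros y [Hy0 Hy].
  generalize (Rmin_l (Rmin d r) 1) (Rmin_r (Rmin d r) 1) (Rmin_l d r) (Rmin_r d r). intros.
  destruct (pow_S_small y N) as [Hq0 [Hq _]]; [ lra | ].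
  assert (K : Rabs (f (y ^ S N) y) <= C * y ^ (S N + D)) by (apply HC; lra).
  rewrite E1, Series_zero, Rplus_0_l, Rabs_mult, pow_add in K.
  - rewrite (Rabs_pos_eq (y ^ S N)) in K by lra.
    apply Rmult_le_reg_l with (y ^ S N); [ auto | lra ].
  - intros k. rewrite (H0 c r f Hf Hflat). ring.
  - rewrite Rabs_pos_eq; lra.
  - rewrite Rabs_pos_eq; lra.
Qed.

Lemma Analytic_flat_zero (f : R -> R -> R) : Analytic f ->
  (forall D, exists C d, 0 < d /\ forall x y, Rabs x < d -> Rabs y < d ->
     Rabs (f x y) <= C * (Rabs x + Rabs y) ^ D) ->
  exists r, 0 < r /\ forall x y, Rabs x < r -> Rabs y < r -> f x y = 0.
Proof.
  intros [c [r Hf]] Hflat. exists r. split; [ apply Hf | ].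
  assert (Hc : forall i j, c i j = 0).
  { intros i. apply (flat_coef_zero i c r f Hf). intros N D.
    destruct (Hflat D) as [C [d [Hd HC]]].
    exists (Rabs C * 2 ^ D), (Rmin d 1). split; [ apply Rmin_glb_lt; lra | ].
    intros y [Hy0 Hy]. generalize (Rmin_l d 1) (Rmin_r d 1). intros.
    destruct (pow_S_small y N) as [Hq0 [Hq _]]; [ lra | ].
    eapply Rle_trans; [ apply HC; rewrite Rabs_pos_eq; lra | ].
    rewrite Rmult_assoc, <- Rpow_mult_distr, !Rabs_pos_eq by lra.
    apply Rle_trans with (Rabs C * (y ^ S N + y) ^ D).
    - apply Rmult_le_compat_r; [ apply pow_le; lra | apply Rle_abs ].
    - apply Rmult_le_compat_l; [ apply Rabs_pos | apply pow_incr; lra ]. }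
  intros x y Hx Hy. destruct Hf as [_ [_ Hf]]. rewrite Hf by lra.
  apply Series_zero. intros i. rewrite Series_zero; [ ring | ].
  intros j. rewrite Hc. ring.
Qed.

(** * Expansions in a small parameter *)

(** Both signs of e are included: the final parity argument compares e with -e. *)
Definition small (P : R -> Prop) : Prop :=
  exists d, 0 < d /\ forall e, e <> 0 -> Rabs e < d -> P e.

Lemma small_and (P Q : R -> Prop) : small P -> small Q -> small (fun e => P e /\ Q e).
Proof.
  intros [d1 [H1 K1]] [d2 [H2 K2]]. exists (Rmin d1 d2).
  split; [ now apply Rmin_glb_lt | ]. intros e He Hd.
  generalize (Rmin_l d1 d2) (Rmin_r d1 d2). intros.
  split; [ apply K1 | apply K2 ]; auto; lra.
Qed.

Lemma small_imp (P Q : R -> Prop) :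
  (forall e, e <> 0 -> P e -> Q e) -> small P -> small Q.
Proof. intros H [d [Hd K]]. exists d. split; auto. Qed.

Lemma small_lt (r : R) : 0 < r -> small (fun e => Rabs e < r).
Proof. intros Hr. now exists r. Qed.

Lemma small_true (P : R -> Prop) : (forall e, P e) -> small P.
Proof. intros H. exists 1. split; [ lra | auto ]. Qed.

Lemma small_locally' (P : R -> Prop) : small P -> Rbar_locally' 0 P.
Proof.
  intros [d [Hd H]]. exists (mkposreal d Hd). intros e Hb He. apply H; auto.
  now rewrite ball_R_0 in Hb.
Qed.

Lemma is_lim_0_bound (f : R -> R) (B : R) :
  small (fun e => Rabs (f e) <= B * Rabs e) -> is_lim f 0 0.
Proof.
  intros [d [Hd H]]. apply is_lim_spec. intros eps. simpl.
  set (d' := Rmin d (eps / (Rabs B + 1))).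
  assert (He := cond_pos eps). assert (HB := Rabs_pos B).
  assert (Hd' : 0 < d') by (apply Rmin_glb_lt; auto; apply Rdiv_lt_0_compat; lra).
  apply (small_locally' (fun e => Rabs (f e - 0) < eps)). exists d'. split; auto.
  intros e Hne Hed. rewrite Rminus_0_r.
  assert (L1 : d' <= d) by apply Rmin_l.
  assert (L2 : d' <= eps / (Rabs B + 1)) by apply Rmin_r.
  eapply Rle_lt_trans; [ apply H; auto; lra | ].
  apply Rle_lt_trans with (Rabs B * Rabs e).
  - apply Rmult_le_compat_r; [ apply Rabs_pos | apply Rle_abs ].
  - apply Rle_lt_trans with (Rabs B * (eps / (Rabs B + 1))).
    + apply Rmult_le_compat_l; lra.
    + replace (Rabs B * (eps / (Rabs B + 1))) with (eps - eps / (Rabs B + 1)) by (field; lra).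
      assert (0 < eps / (Rabs B + 1)) by (apply Rdiv_lt_0_compat; lra). lra.
Qed.

Definition ctn_bounded {T : UniformSpace} (K : T -> Prop) (c : T -> R) : Prop :=
  (forall z, K z -> continuous c z) /\ exists B, forall z, K z -> Rabs (c z) <= B.

(* [g e z = c0 z + c1 z * e + ... + c(m-1) z * e^(m-1) + O(e^m)] as [e -> 0],
   uniformly for [z] in [K], with continuous bounded coefficients. *)
Fixpoint expands_upto {T : UniformSpace} (K : T -> Prop) (m : nat) (g : R -> T -> R) : Prop :=
  match m with
  | O => exists B, small (fun e => forall z, K z -> Rabs (g e z) <= B)
  | S m => exists c, ctn_bounded K c /\ expands_upto K m (fun e z => (g e z - c z) / e)
  end.

Definition expandable {T : UniformSpace} (K : T -> Prop) (g : R -> T -> R) : Prop :=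
  forall m, expands_upto K m g.

Section Expansions.
Context {T : UniformSpace} (K : T -> Prop).
Implicit Types (c : T -> R) (g : R -> T -> R).

Lemma ctn_bounded_const (x : R) : ctn_bounded K (fun _ => x).
Proof. split; [ intros; apply continuous_const | exists (Rabs x); intros; lra ]. Qed.

Lemma ctn_bounded_plus c1 c2 : ctn_bounded K c1 -> ctn_bounded K c2 ->
  ctn_bounded K (fun z => c1 z + c2 z).
Proof.
  intros [H1 [B1 K1]] [H2 [B2 K2]]. split.
  - intros z Hz. apply (continuous_plus c1 c2); auto.
  - exists (B1 + B2). intros z Hz. eapply Rle_trans; [ apply Rabs_triang | ].
    specialize (K1 z Hz). specialize (K2 z Hz). lra.
Qed.

Lemma ctn_bounded_mult c1 c2 : ctn_bounded K c1 -> ctn_bounded K c2 ->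
  ctn_bounded K (fun z => c1 z * c2 z).
Proof.
  intros [H1 [B1 K1]] [H2 [B2 K2]]. split.
  - intros z Hz. apply (continuous_mult c1 c2); auto.
  - exists (B1 * B2). intros z Hz. rewrite Rabs_mult.
    apply Rmult_le_compat; auto; apply Rabs_pos.
Qed.

Lemma ctn_bounded_inv c (m : R) : 0 < m -> (forall z, K z -> m <= Rabs (c z)) ->
  ctn_bounded K c -> ctn_bounded K (fun z => / c z).
Proof.
  intros Hm Hc [H1 _]. split.
  - intros z Hz. apply (continuous_comp c Rinv); auto.
    apply continuity_pt_filterlim, continuity_pt_inv; [ apply continuity_pt_id | ].
    unfold id. intros E. specialize (Hc z Hz). rewrite E, Rabs_R0 in Hc. lra.
  - exists (/ m). intros z Hz. specialize (Hc z Hz).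
    rewrite Rabs_inv. now apply Rinv_le_contravar.
Qed.

Lemma expands_upto_ext (m : nat) : forall g1 g2,
  small (fun e => forall z, K z -> g1 e z = g2 e z) ->
  expands_upto K m g1 -> expands_upto K m g2.
Proof.
  induction m as [|m IH]; intros g1 g2 E.
  - intros [B H]. exists B. generalize (small_and _ _ E H). apply small_imp.
    intros e _ [E1 E2] z Hz. rewrite <- E1; auto.
  - intros [c [Hc H]]. exists c. split; auto. revert H. apply IH.
    revert E. apply small_imp. intros e _ E z Hz. now rewrite E.
Qed.

Lemma expands_upto_pred (m : nat) : forall g, expands_upto K (S m) g -> expands_upto K m g.
Proof.
  induction m as [|m IH]; intros g [c [Hc H]].
  - destruct H as [B H]. destruct Hc as [_ [B' HB']]. exists (B' + B).
    generalize (small_and _ _ (small_lt 1 Rlt_0_1) H). apply small_imp.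
    intros e He [H1 H2] z Hz. specialize (H2 z Hz).
    replace (g e z) with (c z + e * ((g e z - c z) / e)) by (field; auto).
    eapply Rle_trans; [ apply Rabs_triang | ]. rewrite Rabs_mult.
    specialize (HB' z Hz).
    assert (Rabs e * Rabs ((g e z - c z) / e) <= 1 * B).
    { apply Rmult_le_compat; try apply Rabs_pos; lra. }
    lra.
  - exists c. split; auto.
Qed.

Lemma expandable_ext g1 g2 :
  small (fun e => forall z, K z -> g1 e z = g2 e z) ->
  expandable K g1 -> expandable K g2.
Proof. intros E H m. now apply expands_upto_ext with g1. Qed.

Lemma expandable_0 : expandable K (fun _ _ => 0).
Proof.
  intros m. induction m as [|m IH].
  - exists 0. apply small_true. intros. rewrite Rabs_R0. lra.
  - exists (fun _ => 0). split; [ apply ctn_bounded_const | ].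
    revert IH. apply expands_upto_ext. apply small_true. intros e z _. unfold Rdiv. ring.
Qed.

Lemma expandable_coef c : ctn_bounded K c -> expandable K (fun _ z => c z).
Proof.
  intros Hc [|m].
  - destruct Hc as [_ [B HB]]. exists B. now apply small_true.
  - exists c. split; auto. generalize (expandable_0 m). apply expands_upto_ext.
    apply small_true. intros e z _. unfold Rdiv. ring.
Qed.

Lemma expands_upto_plus (m : nat) : forall g1 g2,
  expands_upto K m g1 -> expands_upto K m g2 ->
  expands_upto K m (fun e z => g1 e z + g2 e z).
Proof.
  induction m as [|m IH]; intros g1 g2.
  - intros [B1 H1] [B2 H2]. exists (B1 + B2). generalize (small_and _ _ H1 H2).
    apply small_imp. intros e _ [K1 K2] z Hz. eapply Rle_trans; [ apply Rabs_triang | ].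
    specialize (K1 z Hz). specialize (K2 z Hz). lra.
  - intros [c1 [C1 H1]] [c2 [C2 H2]]. exists (fun z => c1 z + c2 z).
    split; [ now apply ctn_bounded_plus | ].
    generalize (IH _ _ H1 H2). apply expands_upto_ext. apply small_true.
    intros e z _. unfold Rdiv. ring.
Qed.

Lemma expands_upto_mult (m : nat) : forall g1 g2,
  expands_upto K m g1 -> expands_upto K m g2 ->
  expands_upto K m (fun e z => g1 e z * g2 e z).
Proof.
  induction m as [|m IH]; intros g1 g2.
  - intros [B1 H1] [B2 H2]. exists (B1 * B2). generalize (small_and _ _ H1 H2).
    apply small_imp. intros e _ [K1 K2] z Hz. rewrite Rabs_mult.
    apply Rmult_le_compat; auto; apply Rabs_pos.
  (* (g1 g2 - c1 c2) / e = ((g1 - c1) / e) g2 + c1 (g2 - c2) / e; here [g2] itself is taken at order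
     [m], hence [H2']. *)
  - intros [c1 [C1 H1]] H2. assert (H2' := expands_upto_pred _ _ H2).
    destruct H2 as [c2 [C2 H2]].
    exists (fun z => c1 z * c2 z). split; [ now apply ctn_bounded_mult | ].
    generalize (expands_upto_plus _ _ _ (IH _ _ H1 H2')
      (IH _ _ (expandable_coef c1 C1 m) H2)).
    apply expands_upto_ext. apply small_true. intros e z _. unfold Rdiv. ring.
Qed.

Lemma expandable_plus g1 g2 : expandable K g1 -> expandable K g2 ->
  expandable K (fun e z => g1 e z + g2 e z).
Proof. intros H1 H2 m. now apply expands_upto_plus. Qed.

Lemma expandable_mult g1 g2 : expandable K g1 -> expandable K g2 ->
  expandable K (fun e z => g1 e z * g2 e z).
Proof. intros H1 H2 m. now apply expands_upto_mult. Qed.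

Lemma expandable_const (x : R) : expandable K (fun _ _ => x).
Proof. apply (expandable_coef (fun _ => x)), ctn_bounded_const. Qed.

Lemma expandable_opp g : expandable K g -> expandable K (fun e z => - g e z).
Proof.
  intros H. generalize (expandable_mult _ _ (expandable_const (-1)) H).
  apply expandable_ext. apply small_true. intros; ring.
Qed.

Lemma expandable_id : expandable K (fun e _ => e).
Proof.
  intros [|m].
  - exists 1. generalize (small_lt 1 Rlt_0_1). apply small_imp. intros e _ He z _. lra.
  - exists (fun _ => 0). split; [ apply ctn_bounded_const | ].
    generalize (expandable_const 1 m). apply expands_upto_ext.
    exists 1. split; [ lra | ]. intros e He _ z _. field. auto.
Qed.

Lemma expandable_pow (n : nat) : expandable K (fun e _ => e ^ n).
Proof.
  induction n as [|n IH]; simpl; [ apply expandable_const | ].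
  apply expandable_mult; auto. apply expandable_id.
Qed.

Lemma expands_upto_bounded (m : nat) g : expands_upto K m g -> expands_upto K 0 g.
Proof. induction m as [|m IH]; auto. intros H. now apply IH, expands_upto_pred. Qed.

(** Here one [c] serves every order: the whole tail is again expandable, whereas [expands_upto] may
    provide different coefficients for different [m]. *)
Definition leads g c : Prop := ctn_bounded K c /\ expandable K (fun e z => (g e z - c z) / e).

Lemma leads_bound g c : leads g c ->
  exists B, small (fun e => forall z, K z -> Rabs (g e z - c z) <= B * Rabs e).
Proof.
  intros [_ H]. destruct (H O) as [B HB]. exists B. revert HB. apply small_imp.
  intros e He HB z Hz. specialize (HB z Hz).
  replace (g e z - c z) with ((g e z - c z) / e * e) by (field; auto).
  rewrite Rabs_mult. apply Rmult_le_compat_r; auto. apply Rabs_pos.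
Qed.

Lemma coef0_unique g c1 c2 z : K z ->
  expands_upto K 0 (fun e z => (g e z - c1 z) / e) ->
  expands_upto K 0 (fun e z => (g e z - c2 z) / e) -> c1 z = c2 z.
Proof.
  intros Hz [B1 H1] [B2 H2]. destruct (small_and _ _ H1 H2) as [d [Hd H]].
  apply Rminus_diag_uniq, (small_const_zero _ (B1 + B2) d); auto.
  intros e [He0 He]. destruct (H e) as [K1 K2]; [ lra | rewrite Rabs_pos_eq; lra | ].
  specialize (K1 z Hz). specialize (K2 z Hz).
  replace (c1 z - c2 z) with (((g e z - c2 z) / e - (g e z - c1 z) / e) * e) by (field; lra).
  rewrite Rabs_mult, (Rabs_pos_eq e) by lra. apply Rmult_le_compat_r; [ lra | ].
  eapply Rle_trans; [ apply Rabs_triang | ]. rewrite Rabs_Ropp. lra.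
Qed.

(** Each order of expansion supplies its own zeroth coefficient; by [coef0_unique] they all agree on
    [K]. *)
Lemma expandable_leads g : expandable K g -> exists c, leads g c.
Proof.
  intros H. destruct (H 1%nat) as [c [Hc H1]]. exists c. split; auto.
  intros m. destruct (H (S m)) as [c' [Hc' H']].
  generalize H'. apply expands_upto_ext. apply small_true. intros e z Hz.
  replace (c' z) with (c z); auto.
  apply (coef0_unique g); auto. now apply expands_upto_bounded with m.
Qed.

Lemma expandable_inv g c (m0 : R) : leads g c -> 0 < m0 ->
  (forall z, K z -> m0 <= Rabs (c z)) -> expandable K (fun e z => / g e z).
Proof.
  intros Hg Hm Hc. destruct (leads_bound _ _ Hg) as [B HB].
  assert (HB' : small (fun e => forall z, K z -> m0 / 2 <= Rabs (g e z))).
  { set (B' := Rabs B + 1). assert (0 < B') by (unfold B'; generalize (Rabs_pos B); lra).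
    assert (Hs : 0 < m0 / 2 / B') by (apply Rdiv_lt_0_compat; lra).
    generalize (small_and _ _ (small_lt _ Hs) HB). apply small_imp.
    intros e _ [H1 H2] z Hz. specialize (H2 z Hz). specialize (Hc z Hz).
    assert (B * Rabs e <= m0 / 2).
    { apply Rle_trans with (B' * (m0 / 2 / B')).
      - apply Rle_trans with (B' * Rabs e).
        + apply Rmult_le_compat_r; [ apply Rabs_pos | ].
          unfold B'. generalize (Rle_abs B). lra.
        + apply Rmult_le_compat_l; lra.
      - right. field. lra. }
    revert Hc H2 H0. split_Rabs; lra. }
  assert (Hci := ctn_bounded_inv c m0 Hm Hc (proj1 Hg)).
  intros m. induction m as [|m IH].
  - exists (/ (m0 / 2)). revert HB'. apply small_imp. intros e _ H z Hz.
    rewrite Rabs_inv. apply Rinv_le_contravar; [ lra | auto ].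
  (* (1/g - 1/c) / e = (1/g) (1/c) (- (g - c) / e), where 1/g is known to order [m] by induction. *)
  - exists (fun z => / c z). split; auto.
    generalize (expands_upto_mult _ _ _ IH (expands_upto_mult _ _ _
      (expandable_coef _ Hci m) (expandable_opp _ (proj2 Hg) m))).
    apply expands_upto_ext. revert HB'. apply small_imp.
    intros e He H z Hz. specialize (H z Hz). specialize (Hc z Hz). field.
    repeat split; auto; intros E; rewrite E, Rabs_R0 in *; lra.
Qed.

Lemma leads_is_lim g c z : K z -> leads g c -> is_lim (fun e => g e z) 0 (c z).
Proof.
  intros Hz Hg. destruct (leads_bound _ _ Hg) as [B HB].
  apply is_lim_ext with (fun e => c z + (g e z - c z)); [ intros; ring | ].
  replace (Finite (c z)) with (Rbar_plus (c z) 0) by (simpl; f_equal; ring).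
  apply (is_lim_plus (fun _ => c z) (fun e => g e z - c z) 0 (c z) 0).
  - apply is_lim_const.
  - apply (is_lim_0_bound _ B). revert HB. apply small_imp. auto.
  - reflexivity.
Qed.

End Expansions.

Lemma expands_upto_comp {T T' : UniformSpace} (K : T -> Prop) (K' : T' -> Prop)
    (phi : T' -> T) (m : nat) :
  (forall z, K' z -> K (phi z) /\ continuous phi z) ->
  forall g, expands_upto K m g -> expands_upto K' m (fun e z => g e (phi z)).
Proof.
  intros Hphi. induction m as [|m IH]; intros g.
  - intros [B H]. exists B. revert H. apply small_imp. intros e _ H z Hz. apply H, Hphi, Hz.
  - intros [c [[Hc [B HB]] H]]. exists (fun z => c (phi z)). split; [ split | ].
    + intros z Hz. apply (continuous_comp phi c); [ | apply Hc ]; apply Hphi, Hz.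
    + exists B. intros z Hz. apply HB, Hphi, Hz.
    + exact (IH _ H).
Qed.

Lemma leads_comp {T T' : UniformSpace} (K : T -> Prop) (K' : T' -> Prop)
    (phi : T' -> T) (g : R -> T -> R) (c : T -> R) :
  (forall z, K' z -> K (phi z) /\ continuous phi z) ->
  leads K g c -> leads K' (fun e z => g e (phi z)) (fun z => c (phi z)).
Proof.
  intros Hphi [[Hc [B HB]] H]. split; [ split | ].
  - intros z Hz. apply (continuous_comp phi c); [ | apply Hc ]; apply Hphi, Hz.
  - exists B. intros z Hz. apply HB, Hphi, Hz.
  - intros m. exact (expands_upto_comp K K' phi m Hphi _ (H m)).
Qed.

(** Integration proceeds coefficient by coefficient, since the remainder is bounded uniformly on the
    segment. The result does not depend on z, so [K'] is arbitrary. *)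
Lemma expandable_RInt {T : UniformSpace} (K' : T -> Prop) (g : R -> R -> R) :
  expandable (fun z => -1 <= z <= 1) g ->
  small (fun e => forall z, -1 <= z <= 1 -> continuous (g e) z) ->
  expandable K' (fun e _ => RInt (g e) (-1) 1).
Proof.
  intros Hg Hc m. specialize (Hg m). revert g Hg Hc.
  assert (Hex : forall f : R -> R, (forall z, -1 <= z <= 1 -> continuous f z) -> ex_RInt f (-1) 1).
  { intros f Hf. apply (ex_RInt_continuous (V := R_CompleteNormedModule)).
    rewrite Rmin_left, Rmax_right by lra. auto. }
  induction m as [|m IH]; intros g Hg Hc.
  - destruct Hg as [B HB]. exists (B * 2). generalize (small_and _ _ HB Hc).
    apply small_imp. intros e _ [H1 H2] _ _.
    eapply Rle_trans.
    + apply (abs_RInt_le_const (g e) (-1) 1 B); [ lra | now apply Hex | auto ].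
    + lra.
  - destruct Hg as [c [Hcc Hg]].
    exists (fun _ => RInt c (-1) 1). split; [ apply ctn_bounded_const | ].
    assert (Hc' : small (fun e => forall z, -1 <= z <= 1 ->
      continuous (fun z => (g e z - c z) / e) z)).
    { revert Hc. apply small_imp. intros e _ H z Hz. unfold Rdiv.
      apply (continuous_mult (fun z => g e z - c z)); [ | apply continuous_const ].
      apply (continuous_minus (g e) c); auto. now apply Hcc. }
    generalize (IH _ Hg Hc'). apply expands_upto_ext.
    revert Hc. apply small_imp. intros e He H _ _.
    unfold Rdiv.
    rewrite (RInt_ext _ (fun z => scal (/ e) (minus (g e z) (c z)))).
    2:{ intros z _. unfold scal, minus, plus, opp; simpl; unfold mult; simpl.
        unfold Rdiv; ring. }
    rewrite (RInt_scal (V := R_CompleteNormedModule)), (RInt_minus (V := R_CompleteNormedModule)).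
    + unfold scal, minus, plus, opp; simpl; unfold mult; simpl. ring.
    + now apply Hex.
    + apply Hex, Hcc.
    + apply (ex_RInt_minus (V := R_CompleteNormedModule)); [ now apply Hex | apply Hex, Hcc ].
Qed.

(** Both [g e] and its derivative [h e] converge uniformly. A mean value estimate with error O(e)
    identifies [c] with [c z] plus the integral of [dc] from [z]. *)
Lemma leads_derive (r : R) (g h : R -> R -> R) (c dc : R -> R) :
  leads (fun z => Rabs z < r) g c -> leads (fun z => Rabs z < r) h dc ->
  small (fun e => forall z, Rabs z < r -> is_derive (g e) z (h e z)) ->
  forall z, Rabs z < r -> is_derive c z (dc z).
Proof.
  intros Hg Hh Hd z Hz.
  destruct (leads_bound _ _ _ Hh) as [B HB].
  assert (Hdc : forall t, Rabs t < r -> continuous dc t) by apply Hh.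
  assert (Hseg : forall t u, Rabs t < r -> Rmin z t <= u <= Rmax z t -> Rabs u < r).
  { intros t u. unfold Rmin, Rmax. destruct (Rle_dec z t); split_Rabs; lra. }
  assert (HI : forall t, Rabs t < r -> is_derive (fun s => RInt dc z s) t (dc t)).
  { intros t Ht. apply (is_derive_RInt (V := R_NormedModule) dc _ z); auto.
    generalize (locally_abs_lt t r Ht). apply filter_imp. intros s Hs.
    apply (RInt_correct (V := R_CompleteNormedModule)).
    apply (ex_RInt_continuous (V := R_CompleteNormedModule)). intros u Hu.
    apply Hdc. now apply (Hseg s). }
  apply is_derive_ext_loc with (fun t => c z + RInt dc z t).
  - generalize (locally_abs_lt z r Hz). apply filter_imp. intros t Ht.
    enough (c t - c z - RInt dc z t = 0) by (simpl in *; lra).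
    destruct (leads_bound _ _ _ Hg) as [A HA].
    destruct (small_and _ _ (small_and _ _ HA HB) Hd) as [d [Hd0 H]].
    apply (small_const_zero _ (B * Rabs (t - z) + 2 * A) d); auto.
    intros e [He0 He]. destruct (H e) as [[K1 K2] K3]; [ lra | rewrite Rabs_pos_eq; lra | ].
    assert (L : Rabs ((g e t - RInt dc z t) - (g e z - RInt dc z z)) <= (B * Rabs e) * Rabs (t - z)).
    { apply (mvt_bound (fun s => g e s - RInt dc z s) (fun s => h e s - dc s) r); auto.
      intros s Hs. apply (is_derive_minus (g e) (RInt dc z)); auto. }
    rewrite RInt_point in L. unfold zero in L; simpl in L.
    assert (M1 := K1 t Ht). assert (M2 := K1 z Hz). rewrite (Rabs_pos_eq e) in * by lra.
    assert (X : forall I, Rabs (c t - c z - I) <=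
      Rabs (g e t - I - (g e z - 0)) + Rabs (g e t - c t) + Rabs (g e z - c z))
      by (intros; split_Rabs; lra).
    specialize (X (RInt dc z t)). lra.
  - replace (dc z) with (plus 0 (dc z)) by apply Rplus_0_l.
    apply (is_derive_plus (fun _ => c z)); [ apply @is_derive_const | now apply HI ].
Qed.

(** By [Analytic_decomp], (f(e X, e eta) - f(0, 0)) / e = X f1 + eta f2 with f1 and f2 taken at the
    same arguments; the induction on the order therefore runs over all analytic f at once. *)
Lemma expandable_analytic {T : UniformSpace} (K : T -> Prop) (X : T -> R) (eta : R -> T -> R) :
  ctn_bounded K X -> expandable K eta ->
  forall f, Analytic f -> expandable K (fun e z => f (e * X z) (e * eta e z)).
Proof.
  intros HX Heta f Hf m. revert f Hf.
  assert (Hs : forall r, 0 < r ->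
    small (fun e => forall z, K z -> Rabs (e * X z) < r /\ Rabs (e * eta e z) < r)).
  { intros r Hr. destruct HX as [_ [B1 H1]]. destruct (Heta O) as [B2 H2].
    set (B := Rabs B1 + Rabs B2 + 1).
    assert (HB : 0 < B /\ B1 <= B /\ B2 <= B) by (unfold B; split_Rabs; lra).
    destruct HB as [HB0 [HB1 HB2]].
    assert (Hd : 0 < r / B) by (apply Rdiv_lt_0_compat; lra).
    generalize (small_and _ _ (small_lt _ Hd) H2). apply small_imp.
    intros e He [K1 K2] z Hz. specialize (H1 z Hz). specialize (K2 z Hz).
    apply Rabs_pos_lt in He.
    assert (KB : Rabs e * B < r).
    { apply Rlt_le_trans with (r / B * B); [ apply Rmult_lt_compat_r; lra | right; field; lra ]. }
    rewrite !Rabs_mult. split; eapply Rle_lt_trans; try exact KB;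
      (apply Rmult_le_compat_l; lra). }
  induction m as [|m IH]; intros f Hf.
  - destruct (Analytic_bounded f Hf) as [r [B [Hr HB]]]. exists B.
    generalize (Hs r Hr). apply small_imp. intros e _ H z Hz. destruct (H z Hz).
    apply HB; lra.
  - destruct (Analytic_decomp f Hf) as [f1 [f2 [r [A1 [A2 [Hr E]]]]]].
    exists (fun _ => f 0 0). split; [ apply ctn_bounded_const | ].
    generalize (expands_upto_plus _ _ _ _
      (expands_upto_mult _ _ _ _ (expandable_coef _ _ HX m) (IH f1 A1))
      (expands_upto_mult _ _ _ _ (Heta m) (IH f2 A2))).
    apply expands_upto_ext. generalize (Hs r Hr). apply small_imp.
    intros e He H z Hz. destruct (H z Hz) as [L1 L2].
    rewrite (E _ _ L1 L2). field. auto.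
Qed.

(** * Leading coefficients of functions of two weighted variables *)

Definition box (r : R) (z : R * R) : Prop := Rabs (fst z) < r /\ Rabs (snd z) < r.

Lemma ctn_bounded_fst (r : R) : ctn_bounded (box r) fst.
Proof.
  split; [ intros z _; apply continuous_fst | exists r; intros z [H _]; exact (Rlt_le _ _ H) ].
Qed.

Lemma ctn_bounded_snd (r : R) : ctn_bounded (box r) snd.
Proof.
  split; [ intros z _; apply continuous_snd | exists r; intros z [_ H]; exact (Rlt_le _ _ H) ].
Qed.

Lemma expandable_sheared (f : R -> R -> R) (F : R -> R) (n : nat) (r : R) :
  (1 <= n)%nat -> Analytic f -> Analytic (fun x _ => F x) -> F 0 = 0 ->
  expandable (box r) (fun e z => f (e * fst z) (F (e * fst z) + e ^ n * snd z)).
Proof.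
  intros Hn Hf HF HF0.
  destruct (Analytic_decomp _ HF) as [f1 [f2 [s [A1 [A2 [Hs E]]]]]].
  assert (HX := ctn_bounded_fst r). assert (HY := ctn_bounded_snd r).
  (* The height F(e X) + e^n Y equals e [eta], since F(0) = 0. The argument [e * 0] has the shape
     required by [expandable_analytic]. *)
  set (eta := fun e (z : R * R) => fst z * f1 (e * fst z) (e * 0) + e ^ (n - 1) * snd z).
  assert (Heta : expandable (box r) eta).
  { apply expandable_plus; apply expandable_mult.
    - now apply expandable_coef.
    - apply (expandable_analytic (box r) fst (fun _ _ => 0)); auto. apply expandable_const.
    - apply expandable_pow.
    - now apply expandable_coef. }
  generalize (expandable_analytic (box r) fst eta HX Heta f Hf).
  apply expandable_ext. set (r' := Rabs r + 1).
  assert (Hr' : 0 < r') by (unfold r'; generalize (Rabs_pos r); lra).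
  assert (Hd : 0 < s / r') by (apply Rdiv_lt_0_compat; lra).
  generalize (small_lt _ Hd). apply small_imp. intros e He H [X Y] [Hz _]. simpl in Hz |- *. f_equal.
  unfold eta. simpl. rewrite (E (e * X) 0), HF0, Rmult_0_r.
  - replace (e ^ n) with (e * e ^ (n - 1)); [ ring | ].
    rewrite tech_pow_Rmult. f_equal. lia.
  - rewrite Rabs_mult. apply Rlt_le_trans with (s / r' * r').
    + apply Rmult_le_0_lt_compat; try apply Rabs_pos; [ exact H | ].
      unfold r'. generalize (Rle_abs r). lra.
    + right. field. lra.
  - rewrite Rabs_R0. lra.
Qed.

Lemma is_derive_zero_fun (c : R -> R) (r z : R) (l : R) :
  (forall t, Rabs t < r -> c t = 0) -> Rabs z < r -> is_derive c z l -> l = 0.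
Proof.
  intros Hc Hz Hd. apply is_derive_unique in Hd. rewrite <- Hd.
  rewrite (Derive_ext_loc c (fun _ => 0)); [ apply Derive_const | ].
  generalize (locally_abs_lt z r Hz). now apply filter_imp.
Qed.

Lemma continuous_pair_l (x y : R) : continuous (fun u : R => (u, y)) x.
Proof.
  apply (continuous_comp_2 (fun u : R => u) (fun _ : R => y) (fun u v => (u, v))).
  - apply continuous_id.
  - apply continuous_const.
  - apply continuous_ext with (fun z : R * R => z); [ now intros [? ?] | apply continuous_id ].
Qed.

Lemma continuous_pair_r (x y : R) : continuous (fun v : R => (x, v)) y.
Proof.
  apply (continuous_comp_2 (fun _ : R => x) (fun v : R => v) (fun u v => (u, v))).
  - apply continuous_const.
  - apply continuous_id.
  - apply continuous_ext with (fun z : R * R => z); [ now intros [? ?] | apply continuous_id ].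
Qed.

Lemma leads_derive2 (r : R) (g gx gy : R -> R * R -> R) (c cx cy : R * R -> R) :
  leads (box r) g c -> leads (box r) gx cx -> leads (box r) gy cy ->
  small (fun e => forall x y, box r (x, y) ->
    is_derive (fun u => g e (u, y)) x (gx e (x, y)) /\
    is_derive (fun v => g e (x, v)) y (gy e (x, y))) ->
  forall x y, box r (x, y) ->
    is_derive (fun u => c (u, y)) x (cx (x, y)) /\
    is_derive (fun v => c (x, v)) y (cy (x, y)).
Proof.
  intros Hg Hx Hy Hd x y [Hbx Hby]; simpl in *. split.
  - apply (leads_derive r (fun e u => g e (u, y)) (fun e u => gx e (u, y))
      (fun u => c (u, y)) (fun u => cx (u, y))); auto.
    + apply (leads_comp (box r) _ (fun u : R => (u, y)) g); auto.
      intros z Hz. split; [ now split | apply continuous_pair_l ].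
    + apply (leads_comp (box r) _ (fun u : R => (u, y)) gx); auto.
      intros z Hz. split; [ now split | apply continuous_pair_l ].
    + revert Hd. apply small_imp. intros e _ H z Hz. now apply H.
  - apply (leads_derive r (fun e u => g e (x, u)) (fun e u => gy e (x, u))
      (fun u => c (x, u)) (fun u => cy (x, u))); auto.
    + apply (leads_comp (box r) _ (fun u : R => (x, u)) g); auto.
      intros z Hz. split; [ now split | apply continuous_pair_r ].
    + apply (leads_comp (box r) _ (fun u : R => (x, u)) gy); auto.
      intros z Hz. split; [ now split | apply continuous_pair_r ].
    + revert Hd. apply small_imp. intros e _ H z Hz. now apply H.
Qed.

(** The first coefficient of [g] that is not identically 0 provides [W]. As long as the coefficients
    of [g] vanish, so do those of [gx] and [gy], which are their derivatives; all three can then be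
    divided by one more power of e. If this never stops, [g] is flat. *)
Lemma leading_order (r : R) (g gx gy : R -> R * R -> R) :
  expandable (box r) g -> expandable (box r) gx -> expandable (box r) gy ->
  small (fun e => forall x y, box r (x, y) ->
    is_derive (fun u => g e (u, y)) x (gx e (x, y)) /\
    is_derive (fun v => g e (x, v)) y (gy e (x, y))) ->
  (forall D, expands_upto (box r) 0 (fun e z => g e z / e ^ D)) \/
  exists k W Wx Wy,
    leads (box r) (fun e z => g e z / e ^ k) W /\
    leads (box r) (fun e z => gx e z / e ^ k) Wx /\
    leads (box r) (fun e z => gy e z / e ^ k) Wy /\
    (exists z, box r z /\ W z <> 0) /\
    forall x y, box r (x, y) ->
      is_derive (fun u => W (u, y)) x (Wx (x, y)) /\
      is_derive (fun v => W (x, v)) y (Wy (x, y)).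
Proof.
  intros Hg Hx Hy Hd.
  destruct (classic (exists k W Wx Wy,
    leads (box r) (fun e z => g e z / e ^ k) W /\
    leads (box r) (fun e z => gx e z / e ^ k) Wx /\
    leads (box r) (fun e z => gy e z / e ^ k) Wy /\
    (exists z, box r z /\ W z <> 0) /\
    forall x y, box r (x, y) ->
      is_derive (fun u => W (u, y)) x (Wx (x, y)) /\
      is_derive (fun v => W (x, v)) y (Wy (x, y)))) as [H|H]; [ now right | left ].
  enough (forall D, expandable (box r) (fun e z => g e z / e ^ D) /\
    expandable (box r) (fun e z => gx e z / e ^ D) /\
    expandable (box r) (fun e z => gy e z / e ^ D)) as HE.
  { intros D. apply (HE D). }
  induction D as [|D [I1 [I2 I3]]].
  - repeat split; [ revert Hg | revert Hx | revert Hy ]; apply expandable_ext;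
      apply small_true; intros; simpl; field.
  - destruct (expandable_leads _ _ I1) as [W L1].
    destruct (expandable_leads _ _ I2) as [Wx L2].
    destruct (expandable_leads _ _ I3) as [Wy L3].
    assert (HD := leads_derive2 r _ _ _ _ _ _ L1 L2 L3).
    assert (HW : forall x y, box r (x, y) ->
      is_derive (fun u => W (u, y)) x (Wx (x, y)) /\
      is_derive (fun v => W (x, v)) y (Wy (x, y))).
    { apply HD. revert Hd. apply small_imp. intros e He Hd x y Hxy.
      destruct (Hd x y Hxy) as [D1 D2]. unfold Rdiv. split.
      - apply is_derive_ext with (fun u => / e ^ D * g e (u, y)); [ intros; apply Rmult_comm | ].
        rewrite Rmult_comm. now apply (is_derive_scal (fun u => g e (u, y))).
      - apply is_derive_ext with (fun v => / e ^ D * g e (x, v)); [ intros; apply Rmult_comm | ].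
        rewrite Rmult_comm. now apply (is_derive_scal (fun v => g e (x, v))). }
    assert (Z : forall z, box r z -> W z = 0).
    { intros z Hz. apply NNPP. intros HWz. apply H. exists D, W, Wx, Wy.
      repeat (split; auto). now exists z. }
    assert (Zx : forall z, box r z -> Wx z = 0).
    { intros [x y] Hz. destruct (HW x y Hz) as [D1 _]. destruct Hz as [B1 B2].
      apply (is_derive_zero_fun (fun u => W (u, y)) r x); auto. intros t Ht. now apply Z. }
    assert (Zy : forall z, box r z -> Wy z = 0).
    { intros [x y] Hz. destruct (HW x y Hz) as [_ D2]. destruct Hz as [B1 B2].
      apply (is_derive_zero_fun (fun v => W (x, v)) r y); auto. intros t Ht. now apply Z. }
    assert (Step : forall (f : R -> R * R -> R) c, leads (box r) (fun e z => f e z / e ^ D) c ->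
      (forall z, box r z -> c z = 0) -> expandable (box r) (fun e z => f e z / e ^ S D)).
    { intros f c [_ Hf] Hc. revert Hf. apply expandable_ext. exists 1. split; [ lra | ].
      intros e He _ z Hz. rewrite Hc by auto. simpl. field. split; auto. now apply pow_nonzero. }
    repeat split; eapply Step; eassumption.
Qed.

(** Multiplied by the exponential of minus the integral of [gamma], [g] becomes constant, with value
    0 at [t0]. *)
Lemma linear_ode_zero (g gamma : R -> R) (r t0 : R) :
  Rabs t0 < r -> g t0 = 0 ->
  (forall t, Rabs t < r -> continuous gamma t) ->
  (forall t, Rabs t < r -> is_derive g t (gamma t * g t)) ->
  forall t, Rabs t < r -> g t = 0.
Proof.
  intros Ht0 Hg0 Hc Hd t Ht.
  assert (Hseg : forall s u, Rabs s < r -> Rmin t0 s <= u <= Rmax t0 s -> Rabs u < r).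
  { intros s u. unfold Rmin, Rmax. destruct (Rle_dec t0 s); split_Rabs; lra. }
  assert (HI : forall s, Rabs s < r -> is_derive (fun s => RInt gamma t0 s) s (gamma s)).
  { intros s Hs. apply (is_derive_RInt (V := R_NormedModule) gamma _ t0); auto.
    generalize (locally_abs_lt s r Hs). apply filter_imp. intros v Hv.
    apply (RInt_correct (V := R_CompleteNormedModule)).
    apply (ex_RInt_continuous (V := R_CompleteNormedModule)). intros u Hu.
    apply Hc. now apply (Hseg v). }
  assert (L : Rabs (g t * exp (- RInt gamma t0 t) - g t0 * exp (- RInt gamma t0 t0))
    <= 0 * Rabs (t - t0)).
  { apply (mvt_bound (fun s => g s * exp (- RInt gamma t0 s)) (fun _ => 0) r); auto.
    - intros s Hs.
      assert (D := is_derive_mult g (fun s => exp (- RInt gamma t0 s)) s (gamma s * g s)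
        (exp (- RInt gamma t0 s) * (- gamma s)) (Hd s Hs)).
      replace 0 with (gamma s * g s * exp (- RInt gamma t0 s)
        + g s * (exp (- RInt gamma t0 s) * - gamma s)) by ring.
      apply D; [ | intros; apply Rmult_comm ].
      rewrite Rmult_comm.
      apply (is_derive_comp exp (fun s => - RInt gamma t0 s)); [ apply is_derive_exp | ].
      apply (is_derive_opp (fun s => RInt gamma t0 s)), HI, Hs.
    - intros s _. rewrite Rabs_R0. lra. }
  rewrite Hg0, !Rmult_0_l, Rminus_0_r in L.
  assert (E := Rabs_pos (g t * exp (- RInt gamma t0 t))).
  assert (E2 : g t * exp (- RInt gamma t0 t) = 0).
  { destruct (Req_dec (g t * exp (- RInt gamma t0 t)) 0) as [?|N]; auto.
    apply Rabs_pos_lt in N. lra. }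
  apply Rmult_integral in E2. destruct E2 as [E2|E2]; auto.
  generalize (exp_pos (- RInt gamma t0 t)). lra.
Qed.

Lemma is_derive_comp2 (f fx : R -> R -> R) (fy : R) (u v : R -> R) (t du dv : R) :
  locally (u t, v t) (fun z : R * R =>
    is_derive (fun x => f x (snd z)) (fst z) (fx (fst z) (snd z))) ->
  is_derive (fun y => f (u t) y) (v t) fy ->
  continuity_2d_pt fx (u t) (v t) ->
  is_derive u t du -> is_derive v t dv ->
  is_derive (fun s => f (u s) (v s)) t (fx (u t) (v t) * du + fy * dv).
Proof.
  intros H1 H2 H3 Hu Hv.
  apply continuity_2d_pt_filterlim in H3.
  apply is_derive_Reals, derivable_pt_lim_comp_2d; [ | now apply is_derive_Reals .. ].
  apply filterdiff_differentiable_pt_lim.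
  exact (is_derive_filterdiff f (u t) (v t) fx fy H1 H2 H3).
Qed.

(** * The leading form of the inverse integrating factor *)

(** The determinant of the leading field (y, a x^(2n-1) + b x^(n-1) y) and the Euler field (x, n y).
    In t = x^n it is the quadratic form n y^2 - b t y - a t^2, of discriminant b^2 + 4 a n. *)
Lemma weighted_form_pos (n : nat) (a b x y : R) : (1 <= n)%nat ->
  b ^ 2 + 4 * a * INR n < 0 -> x <> 0 \/ y <> 0 ->
  0 < INR n * y ^ 2 - (a * x ^ (2 * n - 1) + b * x ^ (n - 1) * y) * x.
Proof.
  intros Hn Hdisc Hxy.
  assert (HN : 0 < INR n) by (apply lt_0_INR; lia).
  assert (Ht : x ^ (n - 1) * x = x ^ n).
  { rewrite Rmult_comm, tech_pow_Rmult. f_equal. lia. }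
  assert (Ht2 : x ^ (2 * n - 1) * x = (x ^ n) ^ 2).
  { rewrite <- pow_mult, Rmult_comm, tech_pow_Rmult. f_equal. lia. }
  set (t := x ^ n) in *.
  replace (INR n * y ^ 2 - (a * x ^ (2 * n - 1) + b * x ^ (n - 1) * y) * x)
    with (INR n * y ^ 2 - a * (x ^ (2 * n - 1) * x) - b * (x ^ (n - 1) * x) * y) by ring.
  rewrite Ht, Ht2.
  assert (Hty : t <> 0 \/ y <> 0).
  { destruct Hxy; [ left; now apply pow_nonzero | now right ]. }
  apply Rmult_lt_reg_l with (4 * INR n); [ lra | ]. rewrite Rmult_0_r.
  replace (4 * INR n * (INR n * y ^ 2 - a * t ^ 2 - b * t * y))
    with ((2 * INR n * y - b * t) ^ 2 + - (b ^ 2 + 4 * a * INR n) * t ^ 2) by ring.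
  assert (S1 := pow2_ge_0 (2 * INR n * y - b * t)).
  destruct (Req_dec t 0) as [E|E].
  - destruct Hty as [?|Hy]; [ contradiction | ]. rewrite E.
    replace ((2 * INR n * y - b * 0) ^ 2 + - (b ^ 2 + 4 * a * INR n) * 0 ^ 2)
      with (4 * (INR n * y) ^ 2) by ring.
    assert (INR n * y <> 0) by (apply Rmult_integral_contrapositive_currified; lra).
    generalize (pow2_gt_0 _ H). lra.
  - assert (S2 := pow2_gt_0 t E). nra.
Qed.

(* The two equations determine the gradient of W as a multiple of W away from the origin,
   so W vanishes on every segment avoiding the origin on which it has a zero. *)
Lemma leading_form_nonzero (n : nat) (k a b r : R) (W Wx Wy : R * R -> R) :
  (1 <= n)%nat -> b ^ 2 + 4 * a * INR n < 0 -> 0 < r ->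
  (forall x y, box r (x, y) ->
     is_derive (fun u => W (u, y)) x (Wx (x, y)) /\
     is_derive (fun v => W (x, v)) y (Wy (x, y))) ->
  (forall x y, box r (x, y) ->
     y * Wx (x, y) + (a * x ^ (2 * n - 1) + b * x ^ (n - 1) * y) * Wy (x, y)
     = b * x ^ (n - 1) * W (x, y)) ->
  (forall x y, box r (x, y) -> x * Wx (x, y) + INR n * y * Wy (x, y) = k * W (x, y)) ->
  (exists z, box r z /\ W z <> 0) ->
  forall x y, box r (x, y) -> x <> 0 \/ y <> 0 -> W (x, y) <> 0.
Proof.
  intros Hn Hdisc Hr HD HP HE HW x0 y0 [Hx0 Hy0] Hxy0 Z0. simpl in Hx0, Hy0.
  (* [al] and [be] come from Cramer's rule for the two equations satisfied by the gradient; [D] is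
     the determinant. *)
  set (D := fun x y => INR n * y ^ 2 - (a * x ^ (2 * n - 1) + b * x ^ (n - 1) * y) * x).
  set (al := fun x y => (INR n * y * (b * x ^ (n - 1))
     - k * (a * x ^ (2 * n - 1) + b * x ^ (n - 1) * y)) / D x y).
  set (be := fun x y => (k * y - b * x ^ (n - 1) * x) / D x y).
  assert (HDp : forall x y, x <> 0 \/ y <> 0 -> 0 < D x y).
  { intros. now apply weighted_form_pos. }
  assert (Gx : forall x y, box r (x, y) -> x <> 0 \/ y <> 0 -> Wx (x, y) = al x y * W (x, y)).
  { intros x y Hb H. specialize (HDp x y H). specialize (HP x y Hb). specialize (HE x y Hb).
    apply Rmult_eq_reg_l with (D x y); [ | lra ].
    replace (D x y * (al x y * W (x, y))) with
      (INR n * y * (b * x ^ (n - 1) * W (x, y))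
       - (a * x ^ (2 * n - 1) + b * x ^ (n - 1) * y) * (k * W (x, y)))
      by (unfold al; field; lra).
    rewrite <- HP, <- HE. unfold D. ring. }
  assert (Gy : forall x y, box r (x, y) -> x <> 0 \/ y <> 0 -> Wy (x, y) = be x y * W (x, y)).
  { intros x y Hb H. specialize (HDp x y H). specialize (HP x y Hb). specialize (HE x y Hb).
    apply Rmult_eq_reg_l with (D x y); [ | lra ].
    replace (D x y * (be x y * W (x, y))) with
      (y * (k * W (x, y)) - x * (b * x ^ (n - 1) * W (x, y)))
      by (unfold be; field; lra).
    rewrite <- HP, <- HE. unfold D. ring. }
  assert (Vert : forall x, Rabs x < r -> x <> 0 -> (exists y, Rabs y < r /\ W (x, y) = 0) ->
    forall y, Rabs y < r -> W (x, y) = 0).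
  { intros x Hx Hx0' [y1 [Hy1 Z]].
    apply (linear_ode_zero (fun y => W (x, y)) (be x) r y1); auto.
    - intros y Hy. apply (ex_derive_continuous (V := R_NormedModule)).
      specialize (HDp x y (or_introl Hx0')). unfold D in HDp. unfold be, D. auto_derive.
      change (n + (n + 0) - 1)%nat with (2 * n - 1)%nat. apply Rgt_not_eq. lra.
    - intros y Hy. rewrite <- Gy; auto; [ apply HD | ]; now split. }
  assert (Hor : forall y, Rabs y < r -> y <> 0 -> (exists x, Rabs x < r /\ W (x, y) = 0) ->
    forall x, Rabs x < r -> W (x, y) = 0).
  { intros y Hy Hy0' [x1 [Hx1 Z]].
    apply (linear_ode_zero (fun x => W (x, y)) (fun x => al x y) r x1); auto.
    - intros x Hx. apply (ex_derive_continuous (V := R_NormedModule)).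
      specialize (HDp x y (or_intror Hy0')). unfold D in HDp. unfold al, D. auto_derive.
      change (n + (n + 0) - 1)%nat with (2 * n - 1)%nat. apply Rgt_not_eq. lra.
    - intros x Hx. rewrite <- Gx; auto; [ apply HD | ]; now split. }
  assert (Hh : Rabs (r / 2) < r) by (rewrite Rabs_pos_eq; lra).
  (* A zero is propagated to the top side along segments that avoid the origin; a zero on the y-axis
     is first moved sideways. *)
  assert (Top : forall x, Rabs x < r -> W (x, r / 2) = 0).
  { destruct (Req_dec x0 0) as [E|E].
    - destruct Hxy0 as [?|Hy0']; [ contradiction | ].
      assert (Z1 : W (r / 2, y0) = 0) by (apply Hor; eauto).
      apply Hor; try lra. exists (r / 2). split; auto. apply Vert; eauto. lra.
    - apply Hor; try lra. exists x0. split; auto. apply Vert; eauto. }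
  assert (Off : forall x y, Rabs x < r -> Rabs y < r -> x <> 0 -> W (x, y) = 0).
  { intros x y Hx Hy Hne. apply Vert; eauto. }
  destruct HW as [[x y] [[Hx Hy] HW]]. simpl in Hx, Hy. apply HW.
  destruct (Req_dec x 0) as [E|E]; [ | now apply Off ]. subst x.
  destruct (Req_dec y 0) as [E|E].
  - subst y.
    (* At the origin the determinant vanishes and the equations do not give the gradient; continuity
       along the x-axis gives W(0, 0) = 0. *)
    assert (C : continuous (fun u => W (u, 0)) 0).
    { apply (ex_derive_continuous (V := R_NormedModule)). exists (Wx (0, 0)). now apply HD. }
    apply NNPP. intros N. apply Rabs_pos_lt in N.
    destruct (proj1 (filterlim_locally _ _) C (mkposreal _ N)) as [d Hd].
    set (u := Rmin (d / 2) (r / 2)). assert (Hd0 := cond_pos d).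
    assert (Hu : 0 < u) by (apply Rmin_glb_lt; lra).
    assert (Hu1 : u <= d / 2) by apply Rmin_l. assert (Hu2 : u <= r / 2) by apply Rmin_r.
    assert (Hbu : ball (0 : R) d u) by (rewrite ball_R_0, Rabs_pos_eq; lra).
    apply Hd in Hbu. rewrite ball_R in Hbu. simpl in Hbu.
    rewrite (Off u 0), Rminus_0_l, Rabs_Ropp in Hbu;
      try (rewrite ?Rabs_R0, ?Rabs_pos_eq; lra).
  - apply Hor; auto. exists (r / 2). split; auto. apply Off; auto. lra.
Qed.

(** The scales e and l e reach the same point: e (l x) = (l e) x and e^n (l^n y) = (l e)^n y.
    Comparing the two approximations of V there gives the factor l^k. *)
Lemma leading_form_homogeneous (n k : nat) (r : R) (V : R -> R -> R) (W : R * R -> R)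
    (x y l : R) :
  leads (box r) (fun e z => V (e * fst z) (e ^ n * snd z) / e ^ k) W ->
  box r (x, y) -> box r (l * x, l ^ n * y) -> 0 < l ->
  W (l * x, l ^ n * y) = l ^ k * W (x, y).
Proof.
  intros HL H1 H2 Hl. destruct (leads_bound _ _ _ HL) as [B [d [Hd HB]]].
  assert (Hlk : 0 < l ^ k) by now apply pow_lt.
  apply Rminus_diag_uniq, (small_const_zero _ (B + l ^ k * (B * l)) (Rmin d (d / l))).
  { apply Rmin_glb_lt; auto. now apply Rdiv_lt_0_compat. }
  intros e [He0 He].
  assert (Hed : e < d) by (eapply Rlt_le_trans; [ apply He | apply Rmin_l ]).
  assert (Hed2 : l * e < d).
  { apply Rlt_le_trans with (l * (d / l)); [ | right; field; lra ].
    apply Rmult_lt_compat_l; auto. eapply Rlt_le_trans; [ apply He | apply Rmin_r ]. }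
  assert (Hle : 0 < l * e) by now apply Rmult_lt_0_compat.
  assert (K1 := HB e (Rgt_not_eq _ _ He0)).
  rewrite Rabs_pos_eq in K1 by lra. specialize (K1 Hed _ H2). simpl in K1.
  assert (K2 := HB (l * e) (Rgt_not_eq _ _ Hle)).
  rewrite Rabs_pos_eq in K2 by lra. specialize (K2 Hed2 _ H1). simpl in K2.
  rewrite !Rpow_mult_distr in K2.
  replace (e * (l * x)) with (l * e * x) in K1 by ring.
  replace (e ^ n * (l ^ n * y)) with (l ^ n * e ^ n * y) in K1 by ring.
  set (v := V (l * e * x) (l ^ n * e ^ n * y)) in *.
  assert (Hek : e ^ k <> 0) by (apply pow_nonzero; lra).
  replace (W (l * x, l ^ n * y) - l ^ k * W (x, y))
    with (l ^ k * (v / (l ^ k * e ^ k) - W (x, y)) - (v / e ^ k - W (l * x, l ^ n * y)))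
    by (field; lra).
  eapply Rle_trans; [ apply Rabs_triang | ].
  rewrite Rabs_Ropp, Rabs_mult, (Rabs_pos_eq (l ^ k)) by lra.
  assert (l ^ k * Rabs (v / (l ^ k * e ^ k) - W (x, y)) <= l ^ k * (B * (l * e)))
    by (apply Rmult_le_compat_l; lra).
  lra.
Qed.

Lemma continuity_2d_of_continuous (f : R * R -> R) (x y : R) :
  continuous f (x, y) -> continuity_2d_pt (fun u v => f (u, v)) x y.
Proof.
  intros H. apply continuity_2d_pt_filterlim.
  apply (filterlim_ext f); [ now intros [? ?] | exact H ].
Qed.

Lemma locally_in_box (r x y : R) : box r (x, y) -> locally (x, y) (box r).
Proof.
  intros [Hx Hy]; simpl in *.
  apply filter_and.
  - exact (continuous_fst x y _ (locally_abs_lt x r Hx)).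
  - exact (continuous_snd x y _ (locally_abs_lt y r Hy)).
Qed.

(** Derivative of the homogeneity relation at l = 1; for l near 1 the rescaled point stays in the
    box. *)
Lemma leading_form_euler (n k : nat) (r : R) (V : R -> R -> R) (W Wx Wy : R * R -> R) :
  leads (box r) (fun e z => V (e * fst z) (e ^ n * snd z) / e ^ k) W ->
  (forall x y, box r (x, y) ->
     is_derive (fun u => W (u, y)) x (Wx (x, y)) /\
     is_derive (fun v => W (x, v)) y (Wy (x, y))) ->
  (forall z, box r z -> continuous Wx z) ->
  forall x y, box r (x, y) -> x * Wx (x, y) + INR n * y * Wy (x, y) = INR k * W (x, y).
Proof.
  intros HL HD HC x y Hb.
  assert (D1 : is_derive (fun l => W (l * x, l ^ n * y)) 1
    (Wx (1 * x, 1 ^ n * y) * x + Wy (x, y) * (INR n * y))).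
  { apply (is_derive_comp2 (fun u v => W (u, v)) (fun u v => Wx (u, v)) (Wy (x, y))
      (fun l => l * x) (fun l => l ^ n * y)).
    - rewrite pow1, !Rmult_1_l. generalize (locally_in_box r x y Hb).
      apply filter_imp. intros [u v] H. now apply HD.
    - rewrite pow1, !Rmult_1_l. now apply HD.
    - rewrite pow1, !Rmult_1_l. apply continuity_2d_of_continuous. now apply HC.
    - auto_derive; auto. ring.
    - auto_derive; auto. rewrite pow1. ring. }
  assert (D2 : is_derive (fun l => W (l * x, l ^ n * y)) 1 (INR k * W (x, y))).
  { apply is_derive_ext_loc with (fun l => l ^ k * W (x, y)).
    - assert (Hl : locally (1 : R) (fun l => 0 < l /\ box r (l * x, l ^ n * y))).
      { apply filter_and; [ apply (open_gt 0 1); lra | ].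
        apply filter_and; simpl.
        - assert (C : continuous (fun l => l * x) 1).
          { apply (ex_derive_continuous (V := R_NormedModule)). auto_derive. auto. }
          refine (C (fun u => Rabs u < r) _). rewrite Rmult_1_l. apply locally_abs_lt, Hb.
        - assert (C : continuous (fun l => l ^ n * y) 1).
          { apply (ex_derive_continuous (V := R_NormedModule)). auto_derive. auto. }
          refine (C (fun u => Rabs u < r) _). rewrite pow1, Rmult_1_l. apply locally_abs_lt, Hb. }
      revert Hl. apply filter_imp. intros l [H1 H2]. symmetry.
      now apply (leading_form_homogeneous n k r V).
    - auto_derive; auto. rewrite pow1. ring. }
  apply is_derive_unique in D1. apply is_derive_unique in D2.
  rewrite D1, pow1, !Rmult_1_l in D2. lra.
Qed.

(** * Weighted polar coordinates *)

Lemma nth_root (n : nat) (c : R) : (1 <= n)%nat -> 0 <= c -> exists s, 0 <= s /\ s ^ n = c.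
Proof.
  intros Hn Hc. destruct (Req_dec c 0) as [E|E].
  - exists 0. split; [ lra | ]. rewrite E. apply pow_i. lia.
  - assert (HN : 0 < INR n) by (apply lt_0_INR; lia).
    exists (Rpower c (/ INR n)). assert (Hp : 0 < Rpower c (/ INR n)) by apply exp_pos.
    split; [ lra | ]. rewrite <- Rpower_pow by auto.
    rewrite Rpower_mult, Rinv_l, Rpower_1; lra.
Qed.

(** The unit sphere of the gauge max(|x|, |y|^(1/n)), the same set for every n. *)
Definition on_square (z : R * R) : Prop :=
  Rabs (fst z) <= 1 /\ Rabs (snd z) <= 1 /\ (Rabs (fst z) = 1 \/ Rabs (snd z) = 1).

(** The radius is e = max(|x|, |y|^(1/n)); the last alternative records which term realizes it, so
    that a point close to the origin has a small radius. *)
Lemma weighted_polar (n : nat) (x y : R) : (1 <= n)%nat -> x <> 0 \/ y <> 0 ->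
  exists e X Y, 0 < e /\ x = e * X /\ y = e ^ n * Y /\ on_square (X, Y) /\
    (e = Rabs x \/ e ^ n = Rabs y).
Proof.
  intros Hn Hxy. destruct (nth_root n (Rabs y) Hn (Rabs_pos y)) as [s [Hs Es]].
  assert (Hq : forall a e, 0 < e -> Rabs a <= e -> Rabs (a / e) <= 1).
  { intros a e He Ha. unfold Rdiv. rewrite Rabs_mult, Rabs_inv, (Rabs_pos_eq e) by lra.
    apply Rmult_le_reg_r with e; auto. rewrite Rmult_assoc, Rinv_l; lra. }
  assert (H1 : forall a e, 0 < e -> Rabs a = e -> Rabs (a / e) = 1).
  { intros a e He Ha. unfold Rdiv. rewrite Rabs_mult, Rabs_inv, (Rabs_pos_eq e), Ha by lra.
    apply Rinv_r. lra. }
  destruct (Rle_lt_dec s (Rabs x)) as [L|L].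
  - assert (He : 0 < Rabs x).
    { apply Rabs_pos_lt. intros E. rewrite E, Rabs_R0 in L.
      assert (s = 0) by lra. subst s. rewrite pow_i in Es by lia.
      symmetry in Es. apply Rabs_eq_0 in Es. destruct Hxy; contradiction. }
    assert (Hen : 0 < Rabs x ^ n) by now apply pow_lt.
    exists (Rabs x), (x / Rabs x), (y / Rabs x ^ n).
    split; [ auto | split; [ field; lra | split; [ field; lra | split; auto ] ] ].
    split; [ | split ]; simpl.
    + apply Hq; lra.
    + apply Hq; auto. rewrite <- Es. apply pow_incr. lra.
    + left. now apply H1.
  - assert (He : 0 < s) by (generalize (Rabs_pos x); lra).
    assert (Hen : 0 < s ^ n) by now apply pow_lt.
    exists s, (x / s), (y / s ^ n).
    split; [ auto | split; [ field; lra | split; [ field; lra | split; auto ] ] ].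
    split; [ | split ]; simpl.
    + apply Hq; lra.
    + apply Hq; lra.
    + right. now apply H1.
Qed.

Lemma continuous_nonzero_lower_bound (f : R -> R) :
  (forall z, -1 <= z <= 1 -> continuous f z /\ f z <> 0) ->
  exists m, 0 < m /\ forall z, -1 <= z <= 1 -> m <= Rabs (f z).
Proof.
  intros H. destruct (continuity_ab_min (fun z => Rabs (f z)) (-1) 1) as [z0 [H1 H2]].
  - lra.
  - intros z Hz. apply continuity_pt_filterlim.
    apply (continuous_comp f Rabs); [ now apply H | apply continuous_Rabs ].
  - exists (Rabs (f z0)). split; auto. now apply Rabs_pos_lt, H.
Qed.

(** Compactness is used one side at a time, as the minimum of a continuous function on [-1, 1]. *)
Lemma square_lower_bound (W : R * R -> R) :
  (forall z, box 2 z -> continuous W z) ->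
  (forall x y, box 2 (x, y) -> x <> 0 \/ y <> 0 -> W (x, y) <> 0) ->
  exists m, 0 < m /\ forall z, on_square z -> m <= Rabs (W z).
Proof.
  intros HC HW.
  assert (B : forall x y, Rabs x <= 1 -> Rabs y <= 1 -> box 2 (x, y)).
  { intros x y Hx Hy. split; simpl; lra. }
  assert (Hb : forall z, -1 <= z <= 1 -> Rabs z <= 1) by (intros z Hz; split_Rabs; lra).
  assert (Hv : forall x, Rabs x = 1 -> exists m, 0 < m /\
    forall z, -1 <= z <= 1 -> m <= Rabs (W (x, z))).
  { intros x Hx. apply (continuous_nonzero_lower_bound (fun z => W (x, z))).
    intros z Hz. assert (Hxz : box 2 (x, z)) by (apply B; [ lra | now apply Hb ]). split.
    - apply (continuous_comp (fun z => (x, z)) W); [ apply continuous_pair_r | now apply HC ].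
    - apply HW; auto. left. intros E. rewrite E, Rabs_R0 in Hx. lra. }
  assert (Hh : forall y, Rabs y = 1 -> exists m, 0 < m /\
    forall z, -1 <= z <= 1 -> m <= Rabs (W (z, y))).
  { intros y Hy. apply (continuous_nonzero_lower_bound (fun z => W (z, y))).
    intros z Hz. assert (Hxz : box 2 (z, y)) by (apply B; [ now apply Hb | lra ]). split.
    - apply (continuous_comp (fun z => (z, y)) W); [ apply continuous_pair_l | now apply HC ].
    - apply HW; auto. right. intros E. rewrite E, Rabs_R0 in Hy. lra. }
  destruct (Hv 1) as [m1 [P1 L1]]; [ apply Rabs_R1 | ].
  destruct (Hv (-1)) as [m2 [P2 L2]]; [ rewrite Rabs_left; lra | ].
  destruct (Hh 1) as [m3 [P3 L3]]; [ apply Rabs_R1 | ].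
  destruct (Hh (-1)) as [m4 [P4 L4]]; [ rewrite Rabs_left; lra | ].
  exists (Rmin (Rmin m1 m2) (Rmin m3 m4)). split; [ repeat apply Rmin_glb_lt; auto | ].
  generalize (Rmin_l (Rmin m1 m2) (Rmin m3 m4)) (Rmin_r (Rmin m1 m2) (Rmin m3 m4))
    (Rmin_l m1 m2) (Rmin_r m1 m2) (Rmin_l m3 m4) (Rmin_r m3 m4). intros.
  assert (Hpm : forall t, Rabs t = 1 -> t = 1 \/ t = -1) by (intros t; split_Rabs; lra).
  destruct z as [x y]. destruct H5 as [Hx [Hy [E|E]]]; simpl in *; apply Hpm in E;
    destruct E; subst.
  - specialize (L1 y). assert (-1 <= y <= 1) by (revert Hy; split_Rabs; lra).
    specialize (L1 H5). lra.
  - specialize (L2 y). assert (-1 <= y <= 1) by (revert Hy; split_Rabs; lra).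
    specialize (L2 H5). lra.
  - specialize (L3 x). assert (-1 <= x <= 1) by (revert Hx; split_Rabs; lra).
    specialize (L3 H5). lra.
  - specialize (L4 x). assert (-1 <= x <= 1) by (revert Hx; split_Rabs; lra).
    specialize (L4 H5). lra.
Qed.

Lemma on_square_box (z : R * R) : on_square z -> box 2 z.
Proof. intros [H1 [H2 _]]. split; lra. Qed.

(** V / e^k differs from W by at most B e, while |W| is at least [m] on the square; hence V is
    nonzero once B e < [m]. *)
Lemma nonzero_near_origin (n k : nat) (m : R) (V : R -> R -> R) (W : R * R -> R) :
  (1 <= n)%nat ->
  leads (box 2) (fun e z => V (e * fst z) (e ^ n * snd z) / e ^ k) W ->
  0 < m -> (forall z, on_square z -> m <= Rabs (W z)) ->
  exists r, 0 < r /\ forall x y, Rabs x < r -> Rabs y < r -> x <> 0 \/ y <> 0 -> V x y <> 0.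
Proof.
  intros Hn HL Hm HW. destruct (leads_bound _ _ _ HL) as [B [d [Hd HB]]].
  set (d' := Rmin d (m / (Rabs B + 1))).
  assert (HB0 := Rabs_pos B).
  assert (Hd' : 0 < d') by (apply Rmin_glb_lt; auto; apply Rdiv_lt_0_compat; lra).
  (* The weighted radius e is |x| or satisfies e^n = |y|; the two terms of the minimum give e < [d']
     in either case. *)
  exists (Rmin d' (d' ^ n)). split; [ apply Rmin_glb_lt; auto; now apply pow_lt | ].
  intros x y Hx Hy Hxy.
  destruct (weighted_polar n x y Hn Hxy) as [e [X [Y [He [Ex [Ey [HS Hor]]]]]]].
  assert (Hed : e < d').
  { destruct Hor as [->|E].
    - eapply Rlt_le_trans; [ apply Hx | apply Rmin_l ].
    - apply Rnot_le_lt. intros L.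
      assert (d' ^ n <= e ^ n) by (apply pow_incr; lra).
      assert (Rmin d' (d' ^ n) <= d' ^ n) by apply Rmin_r. lra. }
  assert (L1 : d' <= d) by apply Rmin_l.
  assert (L2 : d' <= m / (Rabs B + 1)) by apply Rmin_r.
  assert (Hlt : Rabs B * e < m).
  { apply Rle_lt_trans with (Rabs B * (m / (Rabs B + 1))).
    - apply Rmult_le_compat_l; lra.
    - replace (Rabs B * (m / (Rabs B + 1))) with (m - m / (Rabs B + 1)) by (field; lra).
      assert (0 < m / (Rabs B + 1)) by (apply Rdiv_lt_0_compat; lra). lra. }
  specialize (HB e (Rgt_not_eq _ _ He)). rewrite Rabs_pos_eq in HB by lra.
  specialize (HB ltac:(lra) _ (on_square_box _ HS)). simpl in HB.
  rewrite <- Ex, <- Ey in HB. intros E. rewrite E in HB.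
  unfold Rdiv in HB. rewrite Rmult_0_l, Rminus_0_l, Rabs_Ropp in HB.
  specialize (HW _ HS).
  assert (B * e <= Rabs B * e) by (apply Rmult_le_compat_r; [ lra | apply Rle_abs ]). lra.
Qed.

(** * Closed forms on a punctured box *)

Definition punctured (r x y : R) : Prop := Rabs x < r /\ Rabs y < r /\ (x <> 0 \/ y <> 0).

Lemma continuity_2d_pt_x (f : R -> R -> R) (x y : R) :
  continuity_2d_pt f x y -> continuous (fun u => f u y) x.
Proof.
  intros H. apply continuity_2d_pt_filterlim in H.
  exact (continuous_comp (fun u : R => (u, y)) (fun z => f (fst z) (snd z)) x
    (continuous_pair_l x y) H).
Qed.

Lemma continuity_2d_pt_y (f : R -> R -> R) (x y : R) :
  continuity_2d_pt f x y -> continuous (fun v => f x v) y.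
Proof.
  intros H. apply continuity_2d_pt_filterlim in H.
  exact (continuous_comp (fun v : R => (x, v)) (fun z => f (fst z) (snd z)) y
    (continuous_pair_r x y) H).
Qed.

Lemma locally_neq (x c : R) : x <> c -> locally x (fun u => u <> c).
Proof. apply (open_neq c x). Qed.

(** The form [M] dx + [N] dy; [k] is the common value of the mixed derivatives, and its continuity
    permits differentiation under the integral sign. *)
Definition closed_form (r : R) (M N k : R -> R -> R) : Prop :=
  forall x y, punctured r x y ->
    is_derive (fun v => M x v) y (k x y) /\ is_derive (fun u => N u y) x (k x y) /\
    continuity_2d_pt M x y /\ continuity_2d_pt N x y /\ continuity_2d_pt k x y.

Lemma punctured_open (r x y : R) : punctured r x y ->
  locally (x, y) (fun z : R * R => punctured r (fst z) (snd z)).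
Proof.
  intros [Hx [Hy H]]. apply filter_and; [ | apply filter_and ].
  - exact (continuous_fst x y _ (locally_abs_lt x r Hx)).
  - exact (continuous_snd x y _ (locally_abs_lt y r Hy)).
  - destruct H as [H|H].
    + generalize (continuous_fst x y _ (locally_neq x 0 H)). unfold filtermap.
      apply filter_imp. now left.
    + generalize (continuous_snd x y _ (locally_neq y 0 H)). unfold filtermap.
      apply filter_imp. now right.
Qed.

(* d <> 0 is the height at which the path from the y-axis to the vertical line through x
   runs; the vertical half-axis on the side opposite to d is excluded. *)
Lemma slit_potential (r d : R) (M N k : R -> R -> R) :
  d <> 0 -> Rabs d < r -> closed_form r M N k ->
  exists h, forall x y, Rabs x < r -> Rabs y < r -> x <> 0 \/ 0 < y * d ->
    is_derive (fun u => h u y) x (M x y) /\ is_derive (fun v => h x v) y (N x y).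
Proof.
  intros Hd Hdr H.
  exists (fun x y => RInt (fun t => M t d) 0 x + RInt (fun t => N x t) d y).
  intros x y Hx Hy Hxy.
  assert (Hr : 0 < r) by (generalize (Rabs_pos d); lra).
  assert (HMd : forall t, Rabs t < r -> continuous (fun t => M t d) t).
  { intros t Ht. apply continuity_2d_pt_x, H. repeat split; auto. }
  assert (Seg : forall y', Rabs y' < r -> x <> 0 \/ 0 < y' * d ->
    forall t, Rmin d y' <= t <= Rmax d y' -> Rabs t < r /\ (x <> 0 \/ t <> 0)).
  { intros y' Hy' Hxy' t Ht. split.
    - revert Ht. unfold Rmin, Rmax. destruct (Rle_dec d y'); split_Rabs; lra.
    - destruct Hxy' as [?|Hyd]; [ now left | right ]. intros E. subst t.
      revert Ht. unfold Rmin, Rmax. destruct (Rle_dec d y'); nra. }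
  assert (HN : forall y', Rabs y' < r -> x <> 0 \/ 0 < y' * d -> ex_RInt (fun t => N x t) d y').
  { intros y' Hy' Hxy'. apply (ex_RInt_continuous (V := R_CompleteNormedModule)).
    intros t Ht. destruct (Seg y' Hy' Hxy' t Ht). apply continuity_2d_pt_y, H. now repeat split. }
  split.
  - replace (M x y) with (plus (M x d) (M x y - M x d)) by (unfold plus; simpl; ring).
    apply (is_derive_plus (fun u => RInt (fun t => M t d) 0 u) (fun u => RInt (fun t => N u t) d y)).
    + apply (is_derive_RInt (V := R_NormedModule) (fun t => M t d) _ 0); auto.
      generalize (locally_abs_lt x r Hx). apply filter_imp. intros s Hs.
      apply (RInt_correct (V := R_CompleteNormedModule)).
      apply (ex_RInt_continuous (V := R_CompleteNormedModule)). intros u Hu.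
      apply HMd. revert Hu. unfold Rmin, Rmax. destruct (Rle_dec 0 s); split_Rabs; lra.
    + assert (Hloc : locally x (fun u => Rabs u < r /\ forall t, Rmin d y <= t <= Rmax d y ->
        punctured r u t)).
      { destruct Hxy as [Hx0|Hyd'].
        - generalize (filter_and _ _ (locally_abs_lt x r Hx) (locally_neq x 0 Hx0)).
          apply filter_imp. intros u [H1 H2]. split; auto. intros t Ht.
          destruct (Seg y Hy (or_introl Hx0) t Ht). repeat split; auto.
        - generalize (locally_abs_lt x r Hx). apply filter_imp. intros u Hu. split; auto.
          intros t Ht. split; [ auto | split ].
          + now destruct (Seg y Hy (or_intror Hyd') t Ht).
          + right. intros E. subst t. revert Ht. unfold Rmin, Rmax.
            destruct (Rle_dec d y); nra. }
      assert (Hpx := locally_singleton _ _ Hloc). destruct Hpx as [_ Hpx].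
      (* Differentiation under the integral sign, then closedness: the integrand becomes [k x],
         which is the derivative of [M x]. *)
      replace (M x y - M x d) with (RInt (fun t => Derive (fun u => N u t) x) d y).
      * apply is_derive_RInt_param.
        -- revert Hloc. apply filter_imp. intros u [_ Hu] t Ht. exists (k u t). now apply H, Hu.
        -- intros t Ht. apply continuity_2d_pt_ext_loc with k.
           ++ generalize (punctured_open r x t (Hpx t Ht)). intros Hl.
              apply locally_2d_locally in Hl. revert Hl. apply locally_2d_impl, locally_2d_forall.
              intros u v Huv. symmetry. now apply is_derive_unique, H.
           ++ now apply H, Hpx.
        -- revert Hloc. apply filter_imp. intros u [_ Hu].
           apply (ex_RInt_continuous (V := R_CompleteNormedModule)). intros t Ht.
           now apply continuity_2d_pt_y, H, Hu.
      * rewrite (RInt_ext _ (k x)).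
        -- apply is_RInt_unique. apply (is_RInt_derive (V := R_CompleteNormedModule) (M x) (k x)).
           ++ intros t Ht. now apply H, Hpx.
           ++ intros t Ht. now apply continuity_2d_pt_y, H, Hpx.
        -- intros t Ht. apply is_derive_unique, H, Hpx. lra.
  - apply is_derive_ext with (fun v => plus (RInt (fun t => M t d) 0 x) (RInt (fun t => N x t) d v));
      [ reflexivity | ].
    replace (N x y) with (plus 0 (N x y)) by apply Rplus_0_l.
    apply (is_derive_plus (fun _ => RInt (fun t => M t d) 0 x) (fun v => RInt (fun t => N x t) d v)).
    + apply @is_derive_const.
    + apply (is_derive_RInt (V := R_NormedModule) (fun t => N x t) _ d).
      * assert (Hl : locally y (fun v => Rabs v < r /\ (x <> 0 \/ 0 < v * d))).
        { destruct Hxy as [Hx0|Hyd'].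
          - generalize (locally_abs_lt y r Hy). apply filter_imp. auto.
          - apply filter_and; [ now apply locally_abs_lt | ].
            assert (C : continuous (fun v => v * d) y).
            { apply (ex_derive_continuous (V := R_NormedModule)). auto_derive. auto. }
            generalize (C (fun w => 0 < w) (open_gt 0 _ Hyd')). unfold filtermap.
            apply filter_imp. auto. }
        revert Hl. apply filter_imp. intros v [H1 H2].
        apply (RInt_correct (V := R_CompleteNormedModule)). now apply HN.
      * apply continuity_2d_pt_y, H. split; [ auto | split; auto ].
        destruct Hxy as [?|Hyd']; [ now left | right ]. intros E. subst y. lra.
Qed.

Lemma constant_on_halfbox (r s : R) (D : R -> R -> R) :
  (forall x y, Rabs x < r -> Rabs y < r -> 0 < s * x ->
     is_derive (fun u => D u y) x 0 /\ is_derive (fun v => D x v) y 0) ->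
  forall x y x' y', Rabs x < r -> Rabs y < r -> 0 < s * x ->
    Rabs x' < r -> Rabs y' < r -> 0 < s * x' -> D x y = D x' y'.
Proof.
  intros H.
  assert (C : forall (f : R -> R) a b, (forall t, Rmin a b <= t <= Rmax a b -> is_derive f t 0) ->
    f a = f b).
  { intros f a b Hf. destruct (total_order_T a b) as [[L|E]|L].
    - apply (eq_is_derive (V := R_NormedModule)); auto. intros t Ht. apply Hf.
      rewrite Rmin_left, Rmax_right; lra.
    - now subst.
    - symmetry. apply (eq_is_derive (V := R_NormedModule)); auto. intros t Ht. apply Hf.
      rewrite Rmin_right, Rmax_left; lra. }
  intros x y x' y' Hx Hy Hs Hx' Hy' Hs'. transitivity (D x' y).
  - apply (C (fun u => D u y)). intros t Ht. refine (proj1 (H t y _ Hy _)).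
    + revert Ht. unfold Rmin, Rmax. destruct (Rle_dec x x'); split_Rabs; lra.
    + revert Ht. unfold Rmin, Rmax. destruct (Rle_dec x x'), (Rle_dec 0 s); nra.
  - apply (C (fun v => D x' v)). intros t Ht. refine (proj2 (H x' t Hx' _ Hs')).
    revert Ht. unfold Rmin, Rmax. destruct (Rle_dec y y'); split_Rabs; lra.
Qed.

Definition has_gradient (h : R -> R -> R) (x y l m : R) : Prop :=
  is_derive (fun u => h u y) x l /\ is_derive (fun v => h x v) y m.

(** [h1] lives on the box slit along the lower half of the y-axis, [h2] on the box slit along the
    upper half. On each side of the axis they differ by a constant, and [cm - cp] is the period of
    the form. *)
Definition slit_potentials (r : R) (M N : R -> R -> R) (h1 h2 : R -> R -> R) (cp cm : R) : Prop :=
  (forall x y, Rabs x < r -> Rabs y < r -> x <> 0 \/ 0 < y ->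
     has_gradient h1 x y (M x y) (N x y)) /\
  (forall x y, Rabs x < r -> Rabs y < r -> x <> 0 \/ y < 0 ->
     has_gradient h2 x y (M x y) (N x y)) /\
  (forall x y, Rabs x < r -> Rabs y < r -> 0 < x -> h1 x y - h2 x y = cp) /\
  (forall x y, Rabs x < r -> Rabs y < r -> x < 0 -> h1 x y - h2 x y = cm).

Lemma slit_potentials_exist (r : R) (M N k : R -> R -> R) : 0 < r -> closed_form r M N k ->
  exists h1 h2 cp cm, slit_potentials r M N h1 h2 cp cm.
Proof.
  intros Hr H.
  destruct (slit_potential r (r / 2) M N k) as [h1 H1]; auto; [ lra | rewrite Rabs_pos_eq; lra | ].
  destruct (slit_potential r (- (r / 2)) M N k) as [h2 H2]; auto;
    [ lra | rewrite Rabs_Ropp, Rabs_pos_eq; lra | ].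
  set (D := fun x y => h1 x y - h2 x y).
  assert (HD : forall s x y, Rabs x < r -> Rabs y < r -> 0 < s * x ->
    is_derive (fun u => D u y) x 0 /\ is_derive (fun v => D x v) y 0).
  { intros s x y Hx Hy Hs. assert (Hx0 : x <> 0) by (intros E; subst; lra).
    destruct (H1 x y Hx Hy (or_introl Hx0)) as [A1 A2].
    destruct (H2 x y Hx Hy (or_introl Hx0)) as [B1 B2]. unfold D. split.
    - replace 0 with (minus (M x y) (M x y)) by apply (minus_eq_zero (M x y)).
      now apply (is_derive_minus (fun u => h1 u y) (fun u => h2 u y)).
    - replace 0 with (minus (N x y) (N x y)) by apply (minus_eq_zero (N x y)).
      now apply (is_derive_minus (fun v => h1 x v) (fun v => h2 x v)). }
  assert (Hh : Rabs (r / 2) < r) by (rewrite Rabs_pos_eq; lra).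
  assert (Hh' : Rabs (- (r / 2)) < r) by (rewrite Rabs_Ropp; lra).
  assert (H0 : Rabs 0 < r) by (rewrite Rabs_R0; lra).
  exists h1, h2, (D (r / 2) 0), (D (- (r / 2)) 0).
  split; [ | split; [ | split ] ]; intros x y Hx Hy Hs.
  - apply H1; auto. destruct Hs; [ now left | right; nra ].
  - apply H2; auto. destruct Hs; [ now left | right; nra ].
  - apply (constant_on_halfbox r 1 D (HD 1)); auto; lra.
  - apply (constant_on_halfbox r (-1) D (HD (-1))); auto; lra.
Qed.

(** With equal constants, [h1] and [h2 + c] agree off the y-axis, so [h2 + c] continues [h1] across
    the lower half-axis. *)
Lemma slit_potentials_glue (r : R) (M N h1 h2 : R -> R -> R) (c : R) :
  slit_potentials r M N h1 h2 c c ->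
  exists h, forall x y, punctured r x y -> has_gradient h x y (M x y) (N x y).
Proof.
  intros [H1 [H2 [Hp Hm]]].
  exists (fun x y => if Req_EM_T x 0 then if Rlt_dec 0 y then h1 x y else h2 x y + c else h1 x y).
  intros x y [Hx [Hy Hxy]]. destruct (Req_dec x 0) as [E|E].
  - subst x. destruct Hxy as [?|Hy0]; [ lra | ].
    destruct (Rlt_le_dec 0 y) as [L|L].
    + destruct (H1 0 y) as [D1 D2]; auto. split.
      * apply is_derive_ext with (2 := D1). intros u.
        destruct (Req_EM_T u 0); auto. destruct (Rlt_dec 0 y); auto. lra.
      * apply is_derive_ext_loc with (2 := D2).
        generalize (open_gt 0 y L). apply filter_imp. intros v Hv.
        destruct (Req_EM_T 0 0); auto. destruct (Rlt_dec 0 v); auto. lra.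
    + assert (L' : y < 0) by lra. destruct (H2 0 y) as [D1 D2]; auto. split.
      * apply is_derive_ext_loc with (fun u => h2 u y + c).
        -- generalize (locally_abs_lt 0 r Hx). apply filter_imp. intros u Hu.
           destruct (Req_EM_T u 0); [ destruct (Rlt_dec 0 y); lra | ].
           destruct (Rtotal_order u 0) as [?|[?|?]]; [ | lra | ].
           ++ generalize (Hm u y Hu Hy ltac:(lra)). simpl. lra.
           ++ generalize (Hp u y Hu Hy ltac:(lra)). simpl. lra.
        -- replace (M 0 y) with (plus (M 0 y) 0) by apply Rplus_0_r.
           apply (is_derive_plus (fun u => h2 u y) (fun _ => c)); auto. apply @is_derive_const.
      * apply is_derive_ext_loc with (fun v => h2 0 v + c).
        -- generalize (open_lt 0 y L'). apply filter_imp. intros v Hv.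
           destruct (Req_EM_T 0 0); [ | lra ]. destruct (Rlt_dec 0 v); lra.
        -- replace (N 0 y) with (plus (N 0 y) 0) by apply Rplus_0_r.
           apply (is_derive_plus (fun v => h2 0 v) (fun _ => c)); auto. apply @is_derive_const.
  - destruct (H1 x y) as [D1 D2]; auto. split.
    + apply is_derive_ext_loc with (2 := D1).
      generalize (locally_neq x 0 E). apply filter_imp. intros u Hu.
      now destruct (Req_EM_T u 0).
    + apply is_derive_ext with (2 := D2). intros v. now destruct (Req_EM_T x 0).
Qed.

(** * The period over a weighted rectangle *)

Lemma RInt_scaled_derive (f df : R -> R) (d : R) :
  (forall u, -1 <= u <= 1 -> is_derive f (d * u) (df (d * u)) /\ continuous df (d * u)) ->
  RInt (fun u => df (d * u) * d) (-1) 1 = f d - f (- d).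
Proof.
  intros H. replace (f d) with (f (d * 1)) by (f_equal; ring).
  replace (f (- d)) with (f (d * -1)) by (f_equal; ring).
  apply is_RInt_unique.
  apply (is_RInt_derive (V := R_CompleteNormedModule) (fun u => f (d * u))
    (fun u => df (d * u) * d)); rewrite Rmin_left, Rmax_right by lra; intros u Hu.
  - rewrite Rmult_comm. apply (is_derive_comp f (fun u => d * u)); [ now apply H | ].
    auto_derive; auto. ring.
  - apply (continuous_mult (fun u => df (d * u)) (fun _ => d)); [ | apply continuous_const ].
    apply (continuous_comp (fun u => d * u) df); [ | now apply H ].
    apply (ex_derive_continuous (V := R_NormedModule)). auto_derive. auto.
Qed.

(** For positive [e] and [d], the counterclockwise integral of [M] dx + [N] dy along the boundary of
    [-e, e] x [-d, d]. Every side is parametrized by [-1, 1], so the formula persists for [e < 0],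
    where it runs clockwise. *)
Definition rectangle_integral (M N : R -> R -> R) (e d : R) : R :=
  RInt (fun u => N e (d * u) * d) (-1) 1 - RInt (fun u => N (- e) (d * u) * d) (-1) 1
  - RInt (fun u => M (e * u) d * e) (-1) 1 + RInt (fun u => M (e * u) (- d) * e) (-1) 1.

(** [h1] serves on the right, left and top sides, [h2] on the bottom side; the sum telescopes to the
    values of [h1 - h2] at the two bottom corners. *)
Lemma rectangle_integral_eq (r : R) (M N k h1 h2 : R -> R -> R) (cp cm e d : R) :
  closed_form r M N k -> slit_potentials r M N h1 h2 cp cm ->
  e <> 0 -> Rabs e < r -> 0 < d < r ->
  (0 < e -> rectangle_integral M N e d = cm - cp) /\
  (e < 0 -> rectangle_integral M N e d = - (cm - cp)).
Proof.
  intros HC [H1 [H2 [Hp Hm]]] He Her Hd. unfold rectangle_integral.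
  assert (He' : Rabs (- e) < r) by now rewrite Rabs_Ropp.
  assert (Hsd : forall u, -1 <= u <= 1 -> Rabs (d * u) < r).
  { intros u Hu. rewrite Rabs_mult, (Rabs_pos_eq d) by lra.
    assert (Rabs u <= 1) by (split_Rabs; lra). nra. }
  assert (Hse : forall u, -1 <= u <= 1 -> Rabs (e * u) < r).
  { intros u Hu. rewrite Rabs_mult.
    assert (Rabs u <= 1) by (split_Rabs; lra). generalize (Rabs_pos e). nra. }
  assert (Hdr : Rabs d < r) by (rewrite Rabs_pos_eq; lra).
  assert (Hdr' : Rabs (- d) < r) by (rewrite Rabs_Ropp; auto).
  rewrite (RInt_scaled_derive (h1 e) (N e)).
  2:{ intros u Hu. split; [ apply H1; auto | ]. apply continuity_2d_pt_y, HC.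
      repeat split; auto. }
  rewrite (RInt_scaled_derive (h1 (- e)) (N (- e))).
  2:{ intros u Hu. assert (- e <> 0) by lra. split; [ apply H1; auto | ].
      apply continuity_2d_pt_y, HC. repeat split; auto. }
  rewrite (RInt_scaled_derive (fun u => h1 u d) (fun u => M u d)).
  2:{ intros u Hu. split; [ apply H1; auto; right; lra | ].
      apply (continuity_2d_pt_x M), HC. repeat split; auto. right. lra. }
  rewrite (RInt_scaled_derive (fun u => h2 u (- d)) (fun u => M u (- d))).
  2:{ intros u Hu. split; [ apply H2; auto; right; lra | ].
      apply (continuity_2d_pt_x M), HC. repeat split; auto. right. lra. }
  split; intros Hs.
  - assert (K1 := Hp e (- d) Her Hdr' Hs).
    assert (K2 := Hm (- e) (- d) He' Hdr' ltac:(lra)). lra.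
  - assert (K1 := Hm e (- d) Her Hdr' Hs).
    assert (K2 := Hp (- e) (- d) He' Hdr' ltac:(lra)). lra.
Qed.

(** While k > 0 the zeroth coefficient is 0 and one factor e can be divided out; at k = 0 the
    one-sided limits c and -c must both equal that coefficient. *)
Lemma odd_constant_zero (k : nat) : forall (E : R -> R -> R) (c : R),
  expandable (fun _ => True) E ->
  small (fun e => (0 < e -> E e 0 = c * e ^ k) /\ (e < 0 -> E e 0 = - c * e ^ k)) ->
  c = 0.
Proof.
  induction k as [|k IH]; intros E c HE Hc;
    destruct (expandable_leads _ _ HE) as [c0 HL];
    destruct (leads_bound _ _ _ HL) as [B HB];
    destruct (small_and _ _ HB Hc) as [d [Hd H]].
  - assert (E1 : c - c0 0 = 0).
    { apply (small_const_zero _ B d); auto. intros e [He0 He].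
      destruct (H e) as [K1 [K2 _]]; [ lra | rewrite Rabs_pos_eq; lra | ].
      specialize (K1 0 I). rewrite K2, (Rabs_pos_eq e) in K1 by lra.
      simpl in K1. rewrite Rmult_1_r in K1. exact K1. }
    assert (E2 : - c - c0 0 = 0).
    { apply (small_const_zero _ B d); auto. intros e [He0 He].
      destruct (H (- e)) as [K1 [_ K2]]; [ lra | rewrite Rabs_Ropp, Rabs_pos_eq; lra | ].
      specialize (K1 0 I). rewrite K2, (Rabs_Ropp e), (Rabs_pos_eq e) in K1 by lra.
      simpl in K1. rewrite Rmult_1_r in K1. exact K1. }
    lra.
  - assert (E1 : c0 0 = 0).
    { apply (small_const_zero _ (B + Rabs c) (Rmin d 1)); [ apply Rmin_glb_lt; lra | ].
      intros e [He0 He]. generalize (Rmin_l d 1) (Rmin_r d 1). intros.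
      destruct (H e) as [K1 [K2 _]]; [ lra | rewrite Rabs_pos_eq; lra | ].
      specialize (K1 0 I). rewrite K2, (Rabs_pos_eq e) in K1 by lra.
      destruct (pow_S_small e k) as [P1 [P2 _]]; [ lra | ].
      replace (c0 0) with (c * e ^ S k - (c * e ^ S k - c0 0)) by ring.
      eapply Rle_trans; [ apply Rabs_triang | ]. rewrite Rabs_Ropp, Rabs_mult.
      rewrite (Rabs_pos_eq (e ^ S k)) by lra.
      assert (Rabs c * e ^ S k <= Rabs c * e) by (apply Rmult_le_compat_l; [ apply Rabs_pos | lra ]).
      lra. }
    apply (IH (fun e z => (E e z - c0 z) / e)); [ apply HL | ].
    revert Hc. apply small_imp. intros e He [K1 K2]. rewrite E1, Rminus_0_r.
    split; intros Hs; [ rewrite (K1 Hs) | rewrite (K2 Hs) ]; simpl; field; auto.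
Qed.

(** On a side of the square the denominator has exact order e^k, because [W] stays away from 0
    there; the factor e^k turns the quotient into an expandable function, which is then
    integrated. *)
Lemma side_expandable (k : nat) (m : R) (num den : R -> R * R -> R) (W : R * R -> R)
    (phi : R -> R * R) (f : R -> R -> R) :
  leads (box 2) (fun e z => den e z / e ^ k) W ->
  expandable (box 2) num ->
  0 < m -> (forall z, on_square z -> m <= Rabs (W z)) ->
  (forall u, -1 <= u <= 1 -> on_square (phi u) /\ continuous phi u) ->
  small (fun e => forall u, -1 <= u <= 1 ->
    f e u = num e (phi u) / den e (phi u) /\ continuous (f e) u) ->
  expandable (fun _ : R => True) (fun e _ => e ^ k * RInt (f e) (-1) 1).
Proof.
  intros HL Hnum Hm HW Hphi Hf.
  set (K1 := fun u : R => -1 <= u <= 1).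
  assert (Hphi' : forall u, K1 u -> box 2 (phi u) /\ continuous phi u).
  { intros u Hu. split; [ apply on_square_box | ]; now apply Hphi. }
  assert (Hg : expandable K1 (fun e u => e ^ k * f e u)).
  { generalize (expandable_mult K1 _ _
      (fun j => expands_upto_comp (box 2) K1 phi j Hphi' num (Hnum j))
      (expandable_inv K1 _ _ m (leads_comp _ _ phi _ _ Hphi' HL) Hm
        (fun u Hu => HW _ (proj1 (Hphi u Hu))))).
    apply expandable_ext. revert Hf. apply small_imp. intros e He H u Hu.
    destruct (H u Hu) as [-> _]. unfold Rdiv. rewrite Rinv_mult, Rinv_inv. ring. }
  assert (Hc : small (fun e => forall u, K1 u -> continuous (fun u => e ^ k * f e u) u)).
  { revert Hf. apply small_imp. intros e _ H u Hu.
    apply (continuous_mult (fun _ => e ^ k) (f e)); [ apply continuous_const | now apply H ]. }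
  generalize (expandable_RInt (fun _ : R => True) _ Hg Hc). apply expandable_ext.
  revert Hf. apply small_imp. intros e _ H _ _.
  apply (RInt_scal (V := R_CompleteNormedModule) (f e) (-1) 1 (e ^ k)).
  apply (ex_RInt_continuous (V := R_CompleteNormedModule)).
  rewrite Rmin_left, Rmax_right by lra. intros u Hu. now apply H.
Qed.

Lemma small_pow_lt (n : nat) (r : R) : (1 <= n)%nat -> 0 < r -> small (fun e => Rabs (e ^ n) < r).
Proof.
  intros Hn Hr. exists (Rmin r 1). split; [ apply Rmin_glb_lt; lra | ].
  intros e He Hd. generalize (Rmin_l r 1) (Rmin_r r 1). intros.
  apply Rabs_pos_lt in He. rewrite <- RPow_abs.
  destruct n as [|n]; [ lia | ]. destruct (pow_S_small (Rabs e) n); lra.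
Qed.

Lemma even_pow_pos (n : nat) (e : R) : Nat.Even n -> e <> 0 -> 0 < e ^ n.
Proof.
  intros [j ->] He. rewrite pow_mult. apply pow_lt. now apply pow2_gt_0.
Qed.

(* The integral over the weighted rectangle, times e^k, has an expansion in powers of e valid
   for both signs of e; for even n it changes sign with e, since the reflection x -> -x
   reverses the orientation of the rectangle. *)
Lemma zero_period (n k : nat) (r m : R) (p S V k1 h1 h2 : R -> R -> R) (W : R * R -> R)
    (cp cm : R) :
  (1 <= n)%nat -> Nat.Even n -> 0 < r ->
  closed_form r (fun x y => - S x y / V x y) (fun x y => p x y / V x y) k1 ->
  slit_potentials r (fun x y => - S x y / V x y) (fun x y => p x y / V x y) h1 h2 cp cm ->
  leads (box 2) (fun e z => V (e * fst z) (e ^ n * snd z) / e ^ k) W ->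
  0 < m -> (forall z, on_square z -> m <= Rabs (W z)) ->
  expandable (box 2) (fun e z => p (e * fst z) (e ^ n * snd z)) ->
  expandable (box 2) (fun e z => S (e * fst z) (e ^ n * snd z)) ->
  cp = cm.
Proof.
  intros Hn Hev Hr HC HS HL Hm HW Hp HSe.
  set (M := fun x y => - S x y / V x y) in *. set (N := fun x y => p x y / V x y) in *.
  (* The evenness of n enters here: the half-height e^n of the rectangle is positive for both signs
     of e. *)
  assert (Hsm : small (fun e => (Rabs e < r /\ Rabs (e ^ n) < r) /\ e <> 0 /\ 0 < e ^ n)).
  { generalize (small_and _ _ (small_lt r Hr) (small_pow_lt n r Hn Hr)).
    apply small_imp. intros e He H. split; auto. split; auto. now apply even_pow_pos. }
  assert (Hbox : forall s t u, Rabs s < r -> Rabs t < r -> -1 <= u <= 1 ->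
    Rabs (s * u) < r /\ Rabs (t * u) < r).
  { intros s t u Hs Ht Hu. rewrite !Rabs_mult.
    assert (Rabs u <= 1) by (split_Rabs; lra).
    generalize (Rabs_pos s) (Rabs_pos t) (Rabs_pos u). nra. }
  assert (Clin : forall (c x : R), continuous (fun u : R => c * u) x).
  { intros c x. apply (ex_derive_continuous (V := R_NormedModule)). auto_derive. auto. }
  assert (Hsq : forall u, -1 <= u <= 1 -> Rabs u <= 1) by (intros u Hu; split_Rabs; lra).
  assert (R1 : Rabs 1 = 1) by apply Rabs_R1.
  assert (R2 : Rabs (-1) = 1) by (rewrite Rabs_left; lra).
  (* The factors [e ^ n] here and [e] in [Hnum2] are those of dy and dx in the parametrization of
     the sides. *)
  assert (Hnum1 : expandable (box 2) (fun e z => p (e * fst z) (e ^ n * snd z) * e ^ n)).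
  { apply expandable_mult; auto. apply expandable_pow. }
  assert (Hnum2 : expandable (box 2) (fun e z => - S (e * fst z) (e ^ n * snd z) * e)).
  { apply expandable_mult; [ now apply expandable_opp | apply expandable_id ]. }
  assert (S1 : expandable (fun _ : R => True)
    (fun e _ => e ^ k * RInt (fun u => N e (e ^ n * u) * e ^ n) (-1) 1)).
  { apply (side_expandable k m _ _ W (fun u => (1, u)) _ HL Hnum1 Hm HW).
    - intros u Hu. split; [ repeat split; simpl; auto; lra | apply continuous_pair_r ].
    - revert Hsm. apply small_imp. intros e _ [[H1 H2] [H3 H4]] u Hu. split.
      + unfold N. simpl. rewrite Rmult_1_r. unfold Rdiv. ring.
      + apply (continuous_mult (fun u => N e (e ^ n * u)) (fun _ => e ^ n));
          [ | apply continuous_const ].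
        apply (continuous_comp (fun u => e ^ n * u) (N e)); [ apply Clin | ].
        destruct (Hbox e (e ^ n) u H1 H2 Hu). apply continuity_2d_pt_y, HC.
        repeat split; auto. }
  assert (S2 : expandable (fun _ : R => True)
    (fun e _ => e ^ k * RInt (fun u => N (- e) (e ^ n * u) * e ^ n) (-1) 1)).
  { apply (side_expandable k m _ _ W (fun u => (-1, u)) _ HL Hnum1 Hm HW).
    - intros u Hu. split; [ repeat split; simpl; auto; lra | apply continuous_pair_r ].
    - revert Hsm. apply small_imp. intros e _ [[H1 H2] [H3 H4]] u Hu. split.
      + unfold N. simpl. replace (e * -1) with (- e) by ring. unfold Rdiv. ring.
      + apply (continuous_mult (fun u => N (- e) (e ^ n * u)) (fun _ => e ^ n));
          [ | apply continuous_const ].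
        apply (continuous_comp (fun u => e ^ n * u) (N (- e))); [ apply Clin | ].
        destruct (Hbox e (e ^ n) u H1 H2 Hu). apply continuity_2d_pt_y, HC.
        split; [ now rewrite Rabs_Ropp | split; auto; left; lra ]. }
  assert (S3 : expandable (fun _ : R => True)
    (fun e _ => e ^ k * RInt (fun u => M (e * u) (e ^ n) * e) (-1) 1)).
  { apply (side_expandable k m _ _ W (fun u => (u, 1)) _ HL Hnum2 Hm HW).
    - intros u Hu. split; [ repeat split; simpl; auto; lra | apply continuous_pair_l ].
    - revert Hsm. apply small_imp. intros e _ [[H1 H2] [H3 H4]] u Hu. split.
      + unfold M. simpl. rewrite Rmult_1_r. unfold Rdiv. ring.
      + apply (continuous_mult (fun u => M (e * u) (e ^ n)) (fun _ => e));
          [ | apply continuous_const ].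
        apply (continuous_comp (fun u => e * u) (fun x => M x (e ^ n))); [ apply Clin | ].
        destruct (Hbox e (e ^ n) u H1 H2 Hu). apply (continuity_2d_pt_x M), HC.
        split; [ auto | split; auto; right; lra ]. }
  assert (S4 : expandable (fun _ : R => True)
    (fun e _ => e ^ k * RInt (fun u => M (e * u) (- e ^ n) * e) (-1) 1)).
  { apply (side_expandable k m _ _ W (fun u => (u, -1)) _ HL Hnum2 Hm HW).
    - intros u Hu. split; [ repeat split; simpl; auto; lra | apply continuous_pair_l ].
    - revert Hsm. apply small_imp. intros e _ [[H1 H2] [H3 H4]] u Hu. split.
      + unfold M. simpl. replace (e ^ n * -1) with (- e ^ n) by ring. unfold Rdiv. ring.
      + apply (continuous_mult (fun u => M (e * u) (- e ^ n)) (fun _ => e));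
          [ | apply continuous_const ].
        apply (continuous_comp (fun u => e * u) (fun x => M x (- e ^ n))); [ apply Clin | ].
        destruct (Hbox e (e ^ n) u H1 H2 Hu). apply (continuity_2d_pt_x M), HC.
        split; [ auto | split; [ now rewrite Rabs_Ropp | right; lra ] ]. }
  symmetry. apply Rminus_diag_uniq.
  apply (odd_constant_zero k (fun e _ => e ^ k * rectangle_integral M N e (e ^ n))).
  - generalize (expandable_plus _ _ _ (expandable_plus _ _ _ S1 (expandable_opp _ _ S2))
      (expandable_plus _ _ _ (expandable_opp _ _ S3) S4)).
    apply expandable_ext. apply small_true. intros e z _. unfold rectangle_integral. ring.
  - revert Hsm. apply small_imp. intros e _ [[H1 H2] [H3 H4]].
    rewrite Rabs_pos_eq in H2 by lra.
    destruct (rectangle_integral_eq r M N k1 h1 h2 cp cm e (e ^ n)) as [K1 K2]; auto.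
    split; intros Hs; [ rewrite (K1 Hs) | rewrite (K2 Hs) ]; ring.
Qed.

(** * Systems with a weighted leading part *)

Lemma is_lim_mult_R (f g : R -> R) (x lf lg : R) :
  is_lim f x lf -> is_lim g x lg -> is_lim (fun e => f e * g e) x (lf * lg).
Proof. intros Hf Hg. exact (is_lim_mult f g x lf lg Hf Hg I). Qed.

Lemma is_lim_plus_R (f g : R -> R) (x lf lg : R) :
  is_lim f x lf -> is_lim g x lg -> is_lim (fun e => f e + g e) x (lf + lg).
Proof. intros Hf Hg. now apply (is_lim_plus f g x lf lg). Qed.

(** The system after straightening. For the weights 1 and n, the three limits say that the field has
    the leading part (y, a x^(2n-1) + b x^(n-1) y), of weighted degree n - 1, and that its
    divergence has the leading part b x^(n-1). *)
Record weighted_system (n : nat) (a b r : R) (p S V px Sy Vx Vy : R -> R -> R) : Prop := {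
  ws_derive : forall x y, Rabs x < r -> Rabs y < r ->
    is_derive (fun u => p u y) x (px x y) /\ is_derive (fun v => S x v) y (Sy x y) /\
    is_derive (fun u => V u y) x (Vx x y) /\ is_derive (fun v => V x v) y (Vy x y);
  ws_continuity : forall x y, Rabs x < r -> Rabs y < r ->
    continuity_2d_pt p x y /\ continuity_2d_pt S x y /\ continuity_2d_pt V x y /\
    continuity_2d_pt px x y /\ continuity_2d_pt Vx x y;
  ws_pde : forall x y, Rabs x < r -> Rabs y < r ->
    p x y * Vx x y + S x y * Vy x y = (px x y + Sy x y) * V x y;
  ws_expandable : forall f, List.In f (p :: S :: V :: Vx :: Vy :: nil)%list ->
    expandable (box 2) (fun e z => f (e * fst z) (e ^ n * snd z));
  ws_lim_p : forall x y, box 2 (x, y) ->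
    is_lim (fun e => p (e * x) (e ^ n * y) / e ^ n) 0 y;
  ws_lim_S : forall x y, box 2 (x, y) ->
    is_lim (fun e => S (e * x) (e ^ n * y) / e ^ (2 * n - 1)) 0
      (a * x ^ (2 * n - 1) + b * x ^ (n - 1) * y);
  ws_lim_div : forall x y, box 2 (x, y) ->
    is_lim (fun e => (px (e * x) (e ^ n * y) + Sy (e * x) (e ^ n * y)) / e ^ (n - 1)) 0
      (b * x ^ (n - 1)) }.

Lemma weighted_leading_form (n : nat) (a b r : R) (p S V px Sy Vx Vy : R -> R -> R) :
  (1 <= n)%nat -> b ^ 2 + 4 * a * INR n < 0 -> 0 < r ->
  weighted_system n a b r p S V px Sy Vx Vy ->
  ~ (forall D, expands_upto (box 2) 0 (fun e z => V (e * fst z) (e ^ n * snd z) / e ^ D)) ->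
  exists k W, leads (box 2) (fun e z => V (e * fst z) (e ^ n * snd z) / e ^ k) W /\
    forall x y, box 2 (x, y) -> x <> 0 \/ y <> 0 -> W (x, y) <> 0.
Proof.
  intros Hn Hdisc Hr [Hd _ Hpde Hexp Lp LS Ld] Hflat.
  (* The factors e and e^n come from the chain rule: these are the partial derivatives in the
     rescaled variables. *)
  set (gx := fun e (z : R * R) => e * Vx (e * fst z) (e ^ n * snd z)).
  set (gy := fun e (z : R * R) => e ^ n * Vy (e * fst z) (e ^ n * snd z)).
  assert (Hs : small (fun e => forall x y, box 2 (x, y) ->
    Rabs (e * x) < r /\ Rabs (e ^ n * y) < r)).
  { assert (Hr2 : 0 < r / 2) by lra.
    generalize (small_and _ _ (small_lt _ Hr2) (small_pow_lt n _ Hn Hr2)).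
    apply small_imp. intros e _ [H1 H2] x y [Hx Hy]. simpl in Hx, Hy. rewrite !Rabs_mult.
    generalize (Rabs_pos e) (Rabs_pos (e ^ n)) (Rabs_pos x) (Rabs_pos y). nra. }
  destruct (leading_order 2 (fun e z => V (e * fst z) (e ^ n * snd z)) gx gy)
    as [HF|[k [W [Wx [Wy [L [Lx [Ly [HW HD]]]]]]]]].
  - apply Hexp. simpl. tauto.
  - apply expandable_mult; [ apply expandable_id | apply Hexp; simpl; tauto ].
  - apply expandable_mult; [ apply expandable_pow | apply Hexp; simpl; tauto ].
  - revert Hs. apply small_imp. intros e _ H x y Hb. destruct (H x y Hb) as [H1 H2].
    destruct (Hd _ _ H1 H2) as [_ [_ [D1 D2]]]. unfold gx, gy. simpl. split.
    + apply (is_derive_comp (fun u => V u (e ^ n * y)) (fun u => e * u)); auto.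
      auto_derive; auto. ring.
    + apply (is_derive_comp (fun v => V (e * x) v) (fun v => e ^ n * v)); auto.
      auto_derive; auto. ring.
  - contradiction.
  - exists k, W. split; auto.
    apply (leading_form_nonzero n (INR k) a b 2 W Wx Wy); auto; [ lra | | ].
    (* The equation of V is divided by e^(n - 1 + k): as e^(2n-1) = e^n e^(n-1), each term becomes a
       product of quotients with known limits. *)
    + intros x y Hb.
      assert (A1 := leads_is_lim _ _ _ _ Hb L). assert (A2 := leads_is_lim _ _ _ _ Hb Lx).
      assert (A3 := leads_is_lim _ _ _ _ Hb Ly).
      assert (E1 := is_lim_plus_R _ _ _ _ _ (is_lim_mult_R _ _ _ _ _ (Lp x y Hb) A2)
        (is_lim_mult_R _ _ _ _ _ (LS x y Hb) A3)).
      assert (E2 := is_lim_mult_R _ _ _ _ _ (Ld x y Hb) A1).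
      apply is_lim_unique in E1. apply is_lim_unique in E2.
      rewrite <- (Lim_ext_loc _ (fun e => (px (e * x) (e ^ n * y) + Sy (e * x) (e ^ n * y))
        / e ^ (n - 1) * (V (e * x) (e ^ n * y) / e ^ k))) in E1.
      * simpl in E2. rewrite E2 in E1. injection E1. auto.
      * apply small_locally'. revert Hs. apply small_imp. intros e He H.
        destruct (H x y Hb) as [H1 H2]. specialize (Hpde _ _ H1 H2).
        unfold gx, gy. simpl fst. simpl snd. unfold Rdiv at 5 6. rewrite <- !Rmult_assoc.
        set (u := e * x) in *. set (v := e ^ n * y) in *.
        replace ((px u v + Sy u v) * / e ^ (n - 1) * V u v)
          with ((px u v + Sy u v) * V u v * / e ^ (n - 1)) by ring.
        rewrite <- Hpde.
        assert (P1 : e ^ n = e * e ^ (n - 1)).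
        { rewrite tech_pow_Rmult. f_equal. lia. }
        assert (P2 : e ^ (2 * n - 1) = e * e ^ (n - 1) * e ^ (n - 1)).
        { rewrite tech_pow_Rmult, <- pow_add. f_equal. lia. }
        rewrite P1, P2. field. repeat split; auto; now apply pow_nonzero.
    + apply (leading_form_euler n k 2 V); auto. apply Lx.
Qed.

Lemma weighted_first_integral (n : nat) (a b r : R) (p S V px Sy Vx Vy : R -> R -> R) :
  (1 <= n)%nat -> Nat.Even n -> b ^ 2 + 4 * a * INR n < 0 -> 0 < r ->
  weighted_system n a b r p S V px Sy Vx Vy ->
  ~ (forall D, expands_upto (box 2) 0 (fun e z => V (e * fst z) (e ^ n * snd z) / e ^ D)) ->
  exists q h, 0 < q <= r /\ forall x y, punctured q x y ->
    V x y <> 0 /\ has_gradient h x y (- S x y / V x y) (p x y / V x y).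
Proof.
  intros Hn Hev Hdisc Hr HWS Hflat.
  destruct (weighted_leading_form n a b r p S V px Sy Vx Vy) as [k [W [HL HW]]]; auto.
  destruct HWS as [Hd Hc Hpde Hexp _ _ _].
  destruct (square_lower_bound W) as [m [Hm HWm]]; [ apply HL | exact HW | ].
  destruct (nonzero_near_origin n k m V W) as [r1 [Hr1 HV]]; auto.
  set (q := Rmin r r1). assert (Hq : 0 < q) by now apply Rmin_glb_lt.
  assert (Q1 : q <= r) by apply Rmin_l. assert (Q2 : q <= r1) by apply Rmin_r.
  set (M := fun x y => - S x y / V x y). set (N := fun x y => p x y / V x y).
  (* The derivative of p / V in x. That it is also the derivative of -S / V in y is precisely the
     equation of an inverse integrating factor. *)
  set (k1 := fun x y => (px x y * V x y - p x y * Vx x y) / V x y ^ 2).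
  assert (HV' : forall x y, punctured q x y -> V x y <> 0).
  { intros x y [Hx [Hy Hxy]]. apply HV; auto; lra. }
  assert (HC : closed_form q M N k1).
  { intros x y Hp. assert (HVxy := HV' x y Hp). destruct Hp as [Hx [Hy _]].
    destruct (Hd x y) as [D1 [D2 [D3 D4]]]; try lra.
    destruct (Hc x y) as [C1 [C2 [C3 [C4 C5]]]]; try lra.
    specialize (Hpde x y). specialize (Hpde ltac:(lra) ltac:(lra)).
    assert (CI := continuity_2d_pt_inv _ _ _ C3 HVxy).
    split; [ | split; [ | split; [ | split ] ] ].
    - replace (k1 x y) with ((- Sy x y * V x y - - S x y * Vy x y) / V x y ^ 2).
      + apply (is_derive_div (fun v => - S x v) (fun v => V x v)); auto.
        now apply (is_derive_opp (fun v => S x v)).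
      + unfold k1. f_equal. lra.
    - now apply (is_derive_div (fun u => p u y) (fun u => V u y)).
    - apply continuity_2d_pt_mult; auto. now apply continuity_2d_pt_opp.
    - now apply continuity_2d_pt_mult.
    - unfold k1. apply continuity_2d_pt_mult.
      + apply continuity_2d_pt_minus; now apply continuity_2d_pt_mult.
      + apply continuity_2d_pt_ext with (fun x y => / V x y * / V x y).
        * intros u v. simpl. now rewrite Rmult_1_r, Rinv_mult.
        * now apply continuity_2d_pt_mult. }
  destruct (slit_potentials_exist q M N k1 Hq HC) as [h1 [h2 [cp [cm HS]]]].
  assert (E : cp = cm).
  { apply (zero_period n k q m p S V k1 h1 h2 W); auto; apply Hexp; simpl; tauto. }
  subst cm. destruct (slit_potentials_glue q M N h1 h2 cp HS) as [h Hh].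
  exists q, h. split; auto.
Qed.

(** * Spirals *)

Lemma first_integral_constant (h : R -> R -> R) (q : R) (M N : R -> R -> R)
    (x y dx dy : R -> R) (T : R) :
  (forall u v, punctured q u v -> has_gradient h u v (M u v) (N u v)) ->
  (forall u v, punctured q u v -> continuity_2d_pt M u v) ->
  (forall t, T <= t -> punctured q (x t) (y t) /\
     is_derive x t (dx t) /\ is_derive y t (dy t) /\
     M (x t) (y t) * dx t + N (x t) (y t) * dy t = 0) ->
  forall t1 t2, T <= t1 -> T <= t2 -> h (x t1) (y t1) = h (x t2) (y t2).
Proof.
  intros Hh HM Ht.
  assert (C : forall t1 t2, T <= t1 -> t1 < t2 -> h (x t1) (y t1) = h (x t2) (y t2)).
  { intros t1 t2 H1 H2. apply (eq_is_derive (V := R_NormedModule) (fun t => h (x t) (y t))); auto.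
    intros t Htt. destruct (Ht t ltac:(lra)) as [Hp [Dx [Dy E]]].
    change (@zero R_NormedModule) with 0. rewrite <- E.
    apply (is_derive_comp2 h M (N (x t) (y t))); auto.
    - generalize (punctured_open q _ _ Hp). apply filter_imp. intros [u v] H. now apply Hh.
    - now apply Hh. }
  intros t1 t2 H1 H2. destruct (Rtotal_order t1 t2) as [L|[L|L]].
  - now apply C.
  - now subst.
  - symmetry. now apply C.
Qed.

Lemma IVT_continuous (f : R -> R) (s t c : R) : s < t ->
  (forall u, s <= u <= t -> continuous f u) -> f s < c < f t \/ f t < c < f s ->
  exists u, s <= u <= t /\ f u = c.
Proof.
  intros Hst Hf [Hc|Hc].
  - destruct (IVT_interv (fun u => f u - c) s t) as [u [Hu E]]; try lra.
    + intros u Hu. apply continuity_pt_filterlim.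
      apply (continuous_minus f (fun _ => c)); [ now apply Hf | apply continuous_const ].
    + exists u. split; auto. lra.
  - destruct (IVT_interv (fun u => c - f u) s t) as [u [Hu E]]; try lra.
    + intros u Hu. apply continuity_pt_filterlim.
      apply (continuous_minus (fun _ => c) f); [ apply continuous_const | now apply Hf ].
    + exists u. split; auto. lra.
Qed.

Lemma is_lim_p_infty_gt (f : R -> R) (m : R) :
  is_lim f p_infty p_infty -> exists T, forall t, T < t -> m < f t.
Proof. intros H. apply is_lim_spec in H. exact (H m). Qed.

Lemma is_lim_m_infty_lt (f : R -> R) (m : R) :
  is_lim f p_infty m_infty -> exists T, forall t, T < t -> f t < m.
Proof. intros H. apply is_lim_spec in H. exact (H m). Qed.

Lemma angle_above (c : R) : exists j : nat, c < PI / 2 + 2 * INR j * PI.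
Proof.
  assert (HP := PI_RGT_0).
  destruct (nfloor_ex (Rabs c)) as [j [_ Hj]]; [ apply Rabs_pos | ].
  exists (S j). rewrite S_INR.
  assert (INR j + 1 <= 2 * (INR j + 1) * PI).
  { assert (1 < PI) by (generalize PI2_1; lra). generalize (pos_INR j). nra. }
  generalize (Rle_abs c). lra.
Qed.

Lemma unbounded_angle_hits (theta : R -> R) (T : R) :
  (forall t, T <= t -> continuous theta t) ->
  is_lim theta p_infty p_infty \/ is_lim theta p_infty m_infty ->
  exists t, T <= t /\ cos (theta t) = 0 /\ sin (theta t) = 1.
Proof.
  intros Hc Hlim. assert (HP := PI_RGT_0).
  destruct Hlim as [Hlim|Hlim].
  - destruct (angle_above (theta T)) as [j Hj].
    set (c := PI / 2 + 2 * INR j * PI) in *.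
    destruct (is_lim_p_infty_gt _ c Hlim) as [T1 HT1].
    assert (L1 := Rmax_l T T1). assert (L2 := Rmax_r T T1).
    destruct (IVT_continuous theta T (Rmax T T1 + 1) c) as [t [Ht E]].
    + lra.
    + intros u Hu. apply Hc. lra.
    + left. split; auto. apply HT1. lra.
    + exists t. split; [ lra | ]. rewrite E. unfold c. rewrite cos_period, sin_period.
      split; [ apply cos_PI2 | apply sin_PI2 ].
  (* The extra 2 pi ensures that the target [c], which is pi/2 minus full turns, lies below
     [theta T]. *)
  - destruct (angle_above (- theta T + 2 * PI)) as [j Hj].
    set (c := PI / 2 - 2 * INR j * PI).
    assert (Hc' : c < theta T) by (unfold c; lra).
    destruct (is_lim_m_infty_lt _ c Hlim) as [T1 HT1].
    assert (L1 := Rmax_l T T1). assert (L2 := Rmax_r T T1).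
    destruct (IVT_continuous theta T (Rmax T T1 + 1) c) as [t [Ht E]].
    + lra.
    + intros u Hu. apply Hc. lra.
    + right. split; auto. apply HT1. lra.
    + exists t. split; [ lra | ]. rewrite E.
      rewrite <- (cos_period c j), <- (sin_period c j).
      replace (c + 2 * INR j * PI) with (PI / 2) by (unfold c; ring).
      split; [ apply cos_PI2 | apply sin_PI2 ].
Qed.

(* A spiral meets the positive y-axis at points arbitrarily close to the origin, where a first
   integral would take one and the same value. *)
Lemma no_spiral_with_first_integral (P Q : R -> R -> R) (U : R * R -> Prop) (x0 y0 q : R)
    (F dF : R -> R) (h M N : R -> R -> R) :
  0 < q -> F 0 = 0 ->
  (forall x, Rabs x < q -> is_derive F x (dF x)) ->
  (forall u v, punctured q u v -> has_gradient h u v (M u v) (N u v)) ->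
  (forall u v, punctured q u v -> continuity_2d_pt M u v) ->
  (forall u v, punctured q u v ->
     M u v * P u (F u + v) + N u v * (Q u (F u + v) - dF u * P u (F u + v)) = 0) ->
  (forall v, 0 < v < q -> N 0 v <> 0) ->
  ~ spirals_forward P Q U x0 y0.
Proof.
  intros Hq HF0 HF Hh HM Hint HN [x [y [rho [theta [_ [_ [Hxy [Hrho Htheta]]]]]]]].
  assert (HFc : continuous F 0).
  { apply (ex_derive_continuous (V := R_NormedModule)). exists (dF 0). apply HF.
    rewrite Rabs_R0. lra. }
  assert (Hx : forall t, 0 <= t -> Rabs (x t) <= rho t /\ Rabs (y t) <= rho t).
  { intros t Ht. destruct (Hxy t Ht) as [_ [_ [_ [Hr [_ [-> ->]]]]]].
    assert (B1 := COS_bound (theta t)). assert (B2 := SIN_bound (theta t)).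
    rewrite !Rabs_mult, (Rabs_pos_eq (rho t)) by lra.
    assert (Rabs (cos (theta t)) <= 1) by (split_Rabs; lra).
    assert (Rabs (sin (theta t)) <= 1) by (split_Rabs; lra). nra. }
  assert (Hsm : forall e, 0 < e -> exists T, 0 <= T /\ forall t, T <= t -> rho t < e).
  { intros e He. apply is_lim_spec in Hrho. destruct (Hrho (mkposreal e He)) as [T HT].
    exists (Rmax 0 (T + 1)). split; [ apply Rmax_l | ]. intros t Ht.
    assert (L := Rmax_r 0 (T + 1)). specialize (HT t ltac:(lra)). simpl in HT.
    rewrite Rminus_0_r in HT. generalize (Rle_abs (rho t)). lra. }
  assert (HFs : exists d, 0 < d /\ forall u, Rabs u < d -> Rabs (F u) < q / 2).
  { assert (Hq2 : 0 < q / 2) by lra.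
    destruct (proj1 (filterlim_locally _ _) HFc (mkposreal _ Hq2)) as [d Hd].
    exists d. split; [ apply cond_pos | ]. intros u Hu.
    rewrite <- ball_R_0 in Hu. apply Hd in Hu. now rewrite HF0, ball_R_0 in Hu. }
  destruct HFs as [d [Hd HFs]].
  (* From time [T] on, the orbit is so close to the origin that (x, y - F(x)) stays in the box of
     the first integral. *)
  destruct (Hsm (Rmin d (q / 2))) as [T [HT0 HT]]; [ apply Rmin_glb_lt; lra | ].
  assert (Hmin : Rmin d (q / 2) <= d /\ Rmin d (q / 2) <= q / 2).
  { split; [ apply Rmin_l | apply Rmin_r ]. }
  destruct Hmin as [Hmin1 Hmin2].
  assert (Hpunct : forall t, T <= t -> punctured q (x t) (y t - F (x t))).
  { intros t Ht. destruct (Hx t) as [B1 B2]; [ lra | ]. specialize (HT t Ht).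
    assert (B3 := HFs (x t) ltac:(lra)).
    split; [ lra | split ].
    - eapply Rle_lt_trans; [ apply Rabs_triang | ]. rewrite Rabs_Ropp. lra.
    - destruct (Req_dec (x t) 0) as [E|E]; [ right | now left ].
      rewrite E, HF0. intros E2. assert (y t = 0) by lra.
      destruct (Hxy t) as [_ [_ [_ [Hr [_ [E3 E4]]]]]]; [ lra | ].
      rewrite E in E3. rewrite H in E4. symmetry in E3, E4.
      apply Rmult_integral in E3. apply Rmult_integral in E4.
      assert (cos (theta t) = 0) by lra. assert (sin (theta t) = 0) by lra.
      generalize (sin2_cos2 (theta t)). rewrite H0, H1. unfold Rsqr. lra. }
  assert (Hconst : forall t1 t2, T <= t1 -> T <= t2 ->
    h (x t1) (y t1 - F (x t1)) = h (x t2) (y t2 - F (x t2))).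
  { apply (first_integral_constant h q M N x (fun t => y t - F (x t))
      (fun t => P (x t) (y t)) (fun t => Q (x t) (y t) - dF (x t) * P (x t) (y t)) T); auto.
    intros t Ht. assert (Hp := Hpunct t Ht).
    destruct (Hxy t) as [_ [Dx [Dy _]]]; [ lra | ].
    split; [ auto | split; [ auto | split ] ].
    - apply (is_derive_minus y (fun s => F (x s))); auto.
      rewrite Rmult_comm. apply (is_derive_comp F x); auto. apply HF, Hp.
    - generalize (Hint _ _ Hp). now replace (F (x t) + (y t - F (x t))) with (y t) by ring. }
  assert (Hhit : forall T', 0 <= T' -> exists t, T' <= t /\ x t = 0 /\ y t = rho t).
  { intros T' HT'. destruct (unbounded_angle_hits theta T') as [t [Ht [Hc Hs]]]; auto.
    - intros t Ht. apply Hxy. lra.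
    - exists t. split; auto. destruct (Hxy t) as [_ [_ [_ [_ [_ [-> ->]]]]]]; [ lra | ].
      rewrite Hc, Hs. split; ring. }
  destruct (Hhit T HT0) as [t1 [Ht1 [Ex1 Ey1]]].
  assert (R1 : 0 < rho t1) by (apply Hxy; lra).
  (* Since [rho] tends to 0, a later crossing of the half-axis is strictly lower than the one at
     [t1]. *)
  destruct (Hsm (rho t1) R1) as [T2 [HT2 HT2']].
  destruct (Hhit (Rmax T T2)) as [t2 [Ht2 [Ex2 Ey2]]].
  { apply Rle_trans with T; [ auto | apply Rmax_l ]. }
  assert (L1 := Rmax_l T T2). assert (L2 := Rmax_r T T2).
  assert (R2 : 0 < rho t2) by (apply Hxy; lra).
  assert (R12 : rho t2 < rho t1) by (apply HT2'; lra).
  assert (Rq : rho t1 < q) by (generalize (HT t1 Ht1); lra).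
  assert (E := Hconst t1 t2 Ht1 ltac:(lra)).
  rewrite Ex1, Ex2, HF0, Ey1, Ey2, !Rminus_0_r in E.
  assert (Hpv : forall v, rho t2 <= v <= rho t1 -> punctured q 0 v).
  { intros v Hv. split; [ rewrite Rabs_R0; lra | split ].
    - rewrite Rabs_pos_eq; lra.
    - right. lra. }
  (* On the y-axis the shear is trivial because F(0) = 0, so [h 0] takes equal values at two
     heights; by Rolle's theorem [N 0] would vanish in between. *)
  destruct (MVT_gen (h 0) (rho t2) (rho t1) (N 0)) as [v [Hv Ev]].
  - intros v Hv. rewrite Rmin_left, Rmax_right in Hv by lra. apply Hh, Hpv. lra.
  - intros v Hv. rewrite Rmin_left, Rmax_right in Hv by lra.
    apply derivable_continuous_pt. exists (N 0 v). apply is_derive_Reals, Hh, Hpv. lra.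
  - rewrite Rmin_left, Rmax_right in Hv by lra.
    assert (Z : N 0 v * (rho t1 - rho t2) = 0) by lra.
    apply Rmult_integral in Z. destruct Z as [Z|Z]; [ | lra ].
    apply (HN v); [ lra | auto ].
Qed.

(** * Straightening the curve y = F(x) *)

Definition near (P : R -> R -> Prop) : Prop :=
  exists r, 0 < r /\ forall x y, Rabs x < r -> Rabs y < r -> P x y.

Lemma near_and (P Q : R -> R -> Prop) : near P -> near Q -> near (fun x y => P x y /\ Q x y).
Proof.
  intros [r1 [H1 K1]] [r2 [H2 K2]]. exists (Rmin r1 r2).
  split; [ now apply Rmin_glb_lt | ]. intros x y Hx Hy.
  generalize (Rmin_l r1 r2) (Rmin_r r1 r2). intros.
  split; [ apply K1 | apply K2 ]; lra.
Qed.

Lemma near_imp (P Q : R -> R -> Prop) : (forall x y, P x y -> Q x y) -> near P -> near Q.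
Proof. intros H [r [Hr K]]. exists r. auto. Qed.

Lemma near_locally (P : R * R -> Prop) : locally ((0, 0) : R * R) P -> near (fun x y => P (x, y)).
Proof. apply locally_box. Qed.

Lemma near_locally_x (P : R -> Prop) : locally (0 : R) P -> near (fun x _ => P x).
Proof. intros H. apply locally_0_iff in H. destruct H as [r [Hr K]]. exists r. auto. Qed.

Lemma Analytic_ext (f g : R -> R -> R) :
  near (fun x y => f x y = g x y) -> Analytic f -> Analytic g.
Proof.
  intros [r1 [Hr1 E]] [c [r Hf]]. assert (Hr : 0 < r) by apply Hf.
  exists c, (Rmin r (r1 / 2)).
  assert (L1 : Rmin r (r1 / 2) <= r) by apply Rmin_l.
  assert (L2 : Rmin r (r1 / 2) <= r1 / 2) by apply Rmin_r.
  assert (L0 : 0 < Rmin r (r1 / 2)) by (apply Rmin_glb_lt; lra).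
  apply (expands2_le _ _ (Rmin r (r1 / 2))) in Hf; [ | lra ].
  destruct Hf as [_ [Hc Hf]]. split; [ auto | split; auto ].
  intros x y Hx Hy. rewrite <- E by lra. now apply Hf.
Qed.

Lemma Analytic_of_analytic1 (F : R -> R) : analytic1 F ->
  Analytic (fun x _ => F x) /\ Analytic (fun x _ => Derive F x) /\
  near (fun x _ => is_derive F x (Derive F x)).
Proof.
  intros [u Hu]. assert (HA := Analytic_of_expansion1 u F Hu). split; auto.
  destruct (Analytic_dx _ HA) as [fx [r [Ax [Hr Hd]]]]. split.
  - apply Analytic_ext with (2 := Ax). exists r. split; auto. intros x y Hx Hy.
    symmetry. now apply is_derive_unique, (Hd x y).
  - exists r. split; auto. intros x y Hx Hy. apply Derive_correct.
    exists (fx x y). now apply (Hd x y).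
Qed.

Lemma Analytic_near_continuity (f : R -> R -> R) : Analytic f -> near (continuity_2d_pt f).
Proof. apply Analytic_continuity. Qed.

Lemma continuity_2d_pt_shear (g : R -> R -> R) (F : R -> R) (x v : R) :
  continuity_2d_pt g x (F x + v) -> continuous F x ->
  continuity_2d_pt (fun x v => g x (F x + v)) x v.
Proof.
  intros Hg HF. apply continuity_2d_pt_filterlim. apply continuity_2d_pt_filterlim in Hg.
  apply (continuous_comp_2 (fun z : R * R => fst z) (fun z : R * R => F (fst z) + snd z) g).
  - apply continuous_fst.
  - apply (continuous_plus (fun z : R * R => F (fst z)) (fun z : R * R => snd z)).
    + apply (continuous_comp fst F); [ apply continuous_fst | exact HF ].
    + apply continuous_snd.
  - exact Hg.
Qed.

Lemma near_shear (P : R -> R -> Prop) (F : R -> R) :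
  continuous F 0 -> F 0 = 0 -> near P -> near (fun x v => P x (F x + v)).
Proof.
  intros HF HF0 [r [Hr H]].
  assert (Hr2 : 0 < r / 2) by lra.
  destruct (proj1 (filterlim_locally _ _) HF (mkposreal _ Hr2)) as [d Hd].
  assert (Hd0 := cond_pos d).
  exists (Rmin d (r / 2)). split; [ now apply Rmin_glb_lt | ].
  intros x v Hx Hv. generalize (Rmin_l d (r / 2)) (Rmin_r d (r / 2)). intros.
  assert (HFx : ball (0 : R) d x) by (rewrite ball_R_0; lra).
  apply Hd in HFx. rewrite HF0, ball_R_0 in HFx. simpl in HFx.
  apply H; [ lra | ]. eapply Rle_lt_trans; [ apply Rabs_triang | ]. lra.
Qed.

Lemma near_small (P : R -> R -> Prop) (n : nat) (x y : R) : (1 <= n)%nat -> near P ->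
  small (fun e => P (e * x) (e ^ n * y)).
Proof.
  intros Hn [r [Hr H]]. set (B := Rabs x + Rabs y + 1).
  assert (HB : 0 < B) by (unfold B; generalize (Rabs_pos x) (Rabs_pos y); lra).
  assert (Hd : 0 < r / B) by now apply Rdiv_lt_0_compat.
  generalize (small_and _ _ (small_lt _ Hd) (small_pow_lt n _ Hn Hd)).
  apply small_imp. intros e _ [H1 H2].
  assert (K : forall t w, Rabs t < r / B -> Rabs w <= B -> Rabs (t * w) < r).
  { intros t w Ht Hw. rewrite Rabs_mult. apply Rle_lt_trans with (Rabs t * B).
    - apply Rmult_le_compat_l; [ apply Rabs_pos | auto ].
    - apply Rlt_le_trans with (r / B * B); [ | right; field; lra ].
      now apply Rmult_lt_compat_r. }
  apply H; apply K; auto; unfold B; generalize (Rabs_pos x) (Rabs_pos y); lra.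
Qed.

Lemma CV_radius_decr_n (u : nat -> R) (k : nat) : CV_radius (PS_decr_n u k) = CV_radius u.
Proof.
  induction k as [|k IH].
  - now apply CV_radius_ext.
  - rewrite <- IH, <- (CV_radius_decr_1 (PS_decr_n u k)). apply CV_radius_ext.
    intros i. unfold PS_decr_n, PS_decr_1. f_equal. lia.
Qed.

(** Dividing the power series by x^k leaves a series that is continuous at 0, with value [c]
    there. *)
Lemma leading_term_lim (f : R -> R) (c : R) (k : nat) (x : R) : leading_term f c k ->
  is_lim (fun e => f (e * x) / e ^ k) 0 (c * x ^ k).
Proof.
  intros [_ [u [Hu [Hz Hk]]]].
  destruct (CV_radius_expansion1 u f Hu) as [r [Hr [Hcv E]]].
  set (g := PSeries (PS_decr_n u k)).
  apply is_lim_ext_loc with (fun e => x ^ k * g (e * x)).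
  - apply small_locally'.
    generalize (near_small (fun x _ => Rabs x < r) 1 x 0 ltac:(lia)
      (ex_intro _ r (conj Hr (fun _ _ H _ => H)))).
    apply small_imp. intros e He H. rewrite E by auto.
    rewrite PSeries_decr_n_aux with (n := k) by auto.
    rewrite Rpow_mult_distr. fold (g (e * x)). field. now apply pow_nonzero.
  - assert (Hg : g (0 * x) = c).
    { unfold g. rewrite Rmult_0_l, PSeries_0. unfold PS_decr_n. now rewrite Nat.add_0_r. }
    rewrite <- Hg, (Rmult_comm _ (x ^ k)).
    apply (is_lim_continuity (fun e => x ^ k * g (e * x)) 0).
    apply continuity_pt_filterlim.
    apply (continuous_mult (fun _ => x ^ k) (fun e => g (e * x))); [ apply continuous_const | ].
    apply (continuous_comp (fun e => e * x) g).
    + apply (ex_derive_continuous (V := R_NormedModule)). auto_derive. auto.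
    + apply continuity_pt_filterlim, PSeries_continuity.
      rewrite CV_radius_decr_n, Rmult_0_l, Rabs_R0.
      apply Rbar_lt_trans with r; auto.
Qed.

(** Flatness in the weighted scale implies flatness in |x| + |y|, because e^n is at most (1 + L)(|x|
    + |y|), where L is a Lipschitz constant of F. An analytic function flat in that sense vanishes
    near the origin. *)
Lemma not_flat (V0 : R -> R -> R) (F : R -> R) (n : nat) :
  (1 <= n)%nat -> Analytic V0 -> Analytic (fun x _ => F x) -> F 0 = 0 ->
  ~ near (fun x y => V0 x y = 0) ->
  ~ (forall D, expands_upto (box 2) 0
       (fun e z => V0 (e * fst z) (F (e * fst z) + e ^ n * snd z) / e ^ D)).
Proof.
  intros Hn HV HF HF0 Hnz Hflat. apply Hnz, Analytic_flat_zero; auto.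
  (* [n * S D] weighted orders become [S D] ordinary ones. The successor keeps the exponent
     positive, which yields V0(0, 0) = 0. *)
  intros D. destruct (Hflat (n * S D)%nat) as [B [d [Hd H]]].
  destruct (Analytic_lipschitz _ HF) as [s [L [Hs [HL HFL]]]].
  assert (HFx : forall x, Rabs x < s -> Rabs (F x) <= L * Rabs x).
  { intros x Hx. assert (K := HFL 0 0 x 0). rewrite HF0, !Rminus_0_r, Rabs_R0, Rplus_0_r in K.
    apply K; auto. }
  assert (Hdn : 0 < d ^ n) by now apply pow_lt.
  (* The factor 2 bounds the surplus factor |x| + |y|; the radius d^n / (2 + L) makes |y - F(x)| <
     d^n, hence e < d. *)
  exists (Rabs B * (1 + L) ^ S D * 2), (Rmin (Rmin d (d ^ n / (2 + L))) (Rmin s 1)).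
  assert (Hdn' : 0 < d ^ n / (2 + L)) by (apply Rdiv_lt_0_compat; lra).
  split; [ repeat apply Rmin_glb_lt; lra | ]. intros x y Hx Hy.
  generalize (Rmin_l (Rmin d (d ^ n / (2 + L))) (Rmin s 1))
    (Rmin_r (Rmin d (d ^ n / (2 + L))) (Rmin s 1)) (Rmin_l d (d ^ n / (2 + L)))
    (Rmin_r d (d ^ n / (2 + L))) (Rmin_l s 1) (Rmin_r s 1). intros.
  set (R0 := Rmin (Rmin d (d ^ n / (2 + L))) (Rmin s 1)) in *.
  set (w := Rabs x + Rabs y).
  assert (Hw : 0 <= w <= 2) by (unfold w; generalize (Rabs_pos x) (Rabs_pos y); lra).
  assert (Key : Rabs (V0 x y) <= Rabs B * ((1 + L) * w) ^ S D).
  { assert (HwS : 0 <= ((1 + L) * w) ^ S D) by (apply pow_le, Rmult_le_pos; lra).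
    set (v := y - F x).
    destruct (classic (x <> 0 \/ v <> 0)) as [Hxv|Hxv].
    - destruct (weighted_polar n x v Hn Hxv) as [e [X [Y [He [Ex [Ev [HS Hor]]]]]]].
      assert (Hv : Rabs v <= Rabs y + L * Rabs x).
      { unfold v, Rminus. eapply Rle_trans; [ apply Rabs_triang | ].
        rewrite Rabs_Ropp. specialize (HFx x ltac:(lra)). lra. }
      assert (Hxn : Rabs x ^ n <= Rabs x).
      { destruct n as [|n']; [ lia | ]. destruct (Req_dec x 0) as [E|E].
        - rewrite E, Rabs_R0, pow_i by lia. lra.
        - apply Rabs_pos_lt in E. destruct (pow_S_small (Rabs x) n'); lra. }
      assert (Hen : e ^ n <= (1 + L) * w).
      { assert (P1 := Rmult_le_pos L (Rabs x) HL (Rabs_pos x)).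
        assert (P2 := Rmult_le_pos L (Rabs y) HL (Rabs_pos y)).
        generalize (Rabs_pos x) (Rabs_pos y). unfold w.
        destruct Hor as [-> | ->]; lra. }
      assert (Hed : e < d).
      { destruct Hor as [->|E]; [ lra | ].
        apply Rnot_le_lt. intros Hle.
        assert (d ^ n <= e ^ n) by (apply pow_incr; lra).
        assert (Rabs v < d ^ n); [ | lra ].
        apply Rle_lt_trans with ((1 + L) * R0).
        - assert (L * Rabs x <= L * R0) by (apply Rmult_le_compat_l; lra). lra.
        - apply Rle_lt_trans with ((1 + L) * (d ^ n / (2 + L))).
          + apply Rmult_le_compat_l; lra.
          + replace ((1 + L) * (d ^ n / (2 + L))) with (d ^ n - d ^ n / (2 + L))
              by (field; lra). lra. }
      specialize (H e (Rgt_not_eq _ _ He)). rewrite Rabs_pos_eq in H by lra.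
      specialize (H Hed (X, Y) (on_square_box _ HS)). simpl fst in H. simpl snd in H.
      rewrite <- Ex, <- Ev in H. unfold v in H.
      replace (F x + (y - F x)) with y in H by ring.
      assert (HenD : 0 < e ^ (n * S D)) by now apply pow_lt.
      unfold Rdiv in H. rewrite Rabs_mult, Rabs_inv, (Rabs_pos_eq (e ^ _)) in H by lra.
      apply Rle_trans with (Rabs B * e ^ (n * S D)).
      + apply Rle_trans with (B * e ^ (n * S D)).
        * apply Rmult_le_reg_r with (/ e ^ (n * S D)); [ now apply Rinv_0_lt_compat | ].
          rewrite (Rmult_assoc B), Rinv_r by lra. lra.
        * apply Rmult_le_compat_r; [ lra | apply Rle_abs ].
      + apply Rmult_le_compat_l; [ apply Rabs_pos | ]. rewrite pow_mult.
        apply pow_incr. split; auto. left. now apply pow_lt.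
    (* The origin has no weighted polar coordinates; the flatness bound is used at the point (0, 0)
       of the box, for every small e. *)
    - assert (Ex : x = 0) by (apply NNPP; tauto). assert (Ev : v = 0) by (apply NNPP; tauto).
      assert (Ey : y = 0) by (unfold v in Ev; rewrite Ex, HF0 in Ev; lra).
      replace (V0 x y) with 0; [ rewrite Rabs_R0; apply Rmult_le_pos; auto; apply Rabs_pos | ].
      symmetry. apply (small_const_zero _ (Rabs B) (Rmin d 1)); [ apply Rmin_glb_lt; lra | ].
      intros e [He0 He]. generalize (Rmin_l d 1) (Rmin_r d 1). intros.
      specialize (H e (Rgt_not_eq _ _ He0)). rewrite (Rabs_pos_eq e) in H by lra.
      specialize (H ltac:(lra) (0, 0)). simpl fst in H. simpl snd in H.
      rewrite !Rmult_0_r, HF0, Rplus_0_r in H.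
      assert (Hb : box 2 (0, 0)) by (split; simpl; rewrite Rabs_R0; lra).
      specialize (H Hb). rewrite Ex, Ey.
      assert (HenD : 0 < e ^ (n * S D) <= e).
      { replace (n * S D)%nat with (S (n * S D - 1)) by (destruct n; simpl; lia).
        destruct (pow_S_small e (n * S D - 1)); lra. }
      unfold Rdiv in H. rewrite Rabs_mult, Rabs_inv, (Rabs_pos_eq (e ^ _)) in H by lra.
      apply Rle_trans with (Rabs B * e ^ (n * S D)).
      + apply Rle_trans with (B * e ^ (n * S D)).
        * apply Rmult_le_reg_r with (/ e ^ (n * S D)); [ now apply Rinv_0_lt_compat | ].
          rewrite (Rmult_assoc B), Rinv_r by lra. lra.
        * apply Rmult_le_compat_r; [ lra | apply Rle_abs ].
      + apply Rmult_le_compat_l; [ apply Rabs_pos | lra ]. }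
  eapply Rle_trans; [ apply Key | ]. rewrite Rpow_mult_distr.
  fold w. simpl (w ^ S D).
  assert (K0 : 0 <= Rabs B * (1 + L) ^ S D) by
    (apply Rmult_le_pos; [ apply Rabs_pos | apply pow_le; lra ]).
  assert (K1 : 0 <= w ^ D) by (apply pow_le; lra).
  replace (Rabs B * ((1 + L) ^ S D * (w * w ^ D)))
    with ((Rabs B * (1 + L) ^ S D) * (w * w ^ D)) by ring.
  rewrite (Rmult_assoc _ 2). apply Rmult_le_compat_l; auto.
  apply Rmult_le_compat_r; lra.
Qed.

Definition C1_box (r : R) (f fx fy : R -> R -> R) : Prop :=
  forall x y, Rabs x < r -> Rabs y < r ->
    has_gradient f x y (fx x y) (fy x y) /\
    continuity_2d_pt f x y /\ continuity_2d_pt fx x y /\ continuity_2d_pt fy x y.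

Lemma Analytic_C1 (f : R -> R -> R) : Analytic f ->
  exists fx fy r, Analytic fx /\ Analytic fy /\ 0 < r /\ C1_box r f fx fy.
Proof.
  intros Hf.
  destruct (Analytic_dx f Hf) as [fx [r1 [Ax [Hr1 Hx]]]].
  destruct (Analytic_dy f Hf) as [fy [r2 [Ay [Hr2 Hy]]]].
  assert (Nx : near (fun x y => is_derive (fun u => f u y) x (fx x y))) by (exists r1; auto).
  assert (Ny : near (fun x y => is_derive (fun v => f x v) y (fy x y))) by (exists r2; auto).
  destruct (near_and _ _ (near_and _ _ Nx Ny) (near_and _ _ (Analytic_near_continuity f Hf)
    (near_and _ _ (Analytic_near_continuity fx Ax) (Analytic_near_continuity fy Ay))))
    as [r [Hr HN]].
  exists fx, fy, r. repeat (split; auto); now apply HN.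
Qed.

Lemma C1_box_le (r s : R) (f fx fy : R -> R -> R) : s <= r -> C1_box r f fx fy ->
  C1_box s f fx fy.
Proof. intros Hs H x y Hx Hy. apply H; lra. Qed.

Lemma C1_box_shear (r dF : R) (f fx fy : R -> R -> R) (F : R -> R) (x v : R) :
  C1_box r f fx fy -> Rabs x < r -> Rabs (F x + v) < r -> is_derive F x dF ->
  has_gradient (fun x v => f x (F x + v)) x v
    (fx x (F x + v) + fy x (F x + v) * dF) (fy x (F x + v)).
Proof.
  intros H Hx Hv HF. split.
  - replace (fx x (F x + v) + fy x (F x + v) * dF)
      with (fx x (F x + v) * 1 + fy x (F x + v) * dF) by ring.
    apply (is_derive_comp2 f fx (fy x (F x + v)) (fun u => u) (fun u => F u + v)).
    + generalize (locally_in_box r x (F x + v) (conj Hx Hv)). apply filter_imp.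
      intros [u w] [Hu Hw]. now apply H.
    + now apply H.
    + now apply H.
    + apply @is_derive_id.
    + replace dF with (plus dF 0) by apply Rplus_0_r.
      apply (is_derive_plus F (fun _ => v)); [ exact HF | apply @is_derive_const ].
  - replace (fy x (F x + v)) with (1 * fy x (F x + v)) by ring.
    apply (is_derive_comp (fun w => f x w) (fun w => F x + w)).
    + now apply H.
    + auto_derive; auto.
Qed.

(** Only the term of order n - 1 of [phi] survives in the limit. If [phi] vanishes or has higher
    order, b = 0 is taken and the inequality follows from a < 0. *)
Lemma divergence_limit (phi : R -> R) (n : nat) (a : R) : a < 0 -> (1 <= n)%nat ->
  (locally (0 : R) (fun x => phi x = 0) \/
   exists (b : R) (beta : nat),
     (1 <= beta)%nat /\ leading_term phi b beta /\
     ((n - 1 < beta)%nat \/ (beta = (n - 1)%nat /\ b ^ 2 + 4 * a * INR n < 0))) ->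
  exists b, b ^ 2 + 4 * a * INR n < 0 /\
    forall x, is_lim (fun e => phi (e * x) / e ^ (n - 1)) 0 (b * x ^ (n - 1)).
Proof.
  intros Ha Hn H. assert (HN : 0 < INR n) by (apply lt_0_INR; lia).
  assert (H0 : 0 ^ 2 + 4 * a * INR n < 0) by nra.
  destruct H as [Hz|[b [beta [_ [HL Hb]]]]].
  - exists 0. split; auto. intros x. rewrite Rmult_0_l.
    apply near_locally_x, (near_small _ 1 x 0) in Hz; auto.
    apply is_lim_ext_loc with (fun _ => 0); [ | apply is_lim_const ].
    apply small_locally'. revert Hz. apply small_imp. intros e _ ->. unfold Rdiv. ring.
  - destruct Hb as [Hb|[-> Hb]].
    + exists 0. split; auto. intros x. rewrite Rmult_0_l.
      apply is_lim_ext_loc with (fun e => e ^ (beta - (n - 1)) * (phi (e * x) / e ^ beta)).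
      * apply small_locally'. exists 1. split; [ lra | ]. intros e He _.
        replace (e ^ beta) with (e ^ (beta - (n - 1)) * e ^ (n - 1))
          by (rewrite <- pow_add; f_equal; lia).
        field. split; now apply pow_nonzero.
      * replace 0 with (0 ^ (beta - (n - 1)) * (b * x ^ beta)) at 2
          by (rewrite pow_i by lia; ring).
        apply is_lim_mult_R; [ | now apply leading_term_lim ].
        apply (is_lim_continuity (fun e => e ^ (beta - (n - 1))) 0).
        apply derivable_continuous_pt, derivable_pt_pow.
    + exists b. split; auto. intros x. now apply leading_term_lim.
Qed.

(** In the coordinates x and v = y - F(x) the field is ([p], [S]). Taylor expansion in v gives p = v
    (1 + Py(x, F)) + O(v^2), because F + P2(x, F) = 0, and S = f(x) + v phi(x) + O(v^2); replacing x
    by e x and v by e^n v then gives the limits. *)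
Lemma sheared_weighted_system (P2 Q2 V0 : R -> R -> R) (F : R -> R) (n : nat) (a : R) :
  let P := fun x y => y + P2 x y in
  let p := fun x v => P x (F x + v) in
  let S := fun x v => Q2 x (F x + v) - Derive F x * p x v in
  let V := fun x v => V0 x (F x + v) in
  Analytic P2 -> Analytic Q2 -> Analytic V0 -> is_derive (fun y => P2 0 y) 0 0 ->
  analytic1 F -> F 0 = 0 -> (2 <= n)%nat ->
  locally (0 : R) (fun x => F x + P2 x (F x) = 0) ->
  leading_term (fun x => Q2 x (F x)) a (2 * n - 1) -> a < 0 ->
  (let phi := fun x => dx P2 x (F x) + dy Q2 x (F x) in
   locally (0 : R) (fun x => phi x = 0) \/
   exists (b : R) (beta : nat),
     (1 <= beta)%nat /\ leading_term phi b beta /\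
     ((n - 1 < beta)%nat \/ (beta = (n - 1)%nat /\ b ^ 2 + 4 * a * INR n < 0))) ->
  near (fun x y => P x y * dx V0 x y + Q2 x y * dy V0 x y = (dx P x y + dy Q2 x y) * V0 x y) ->
  exists b r C px Sy Vx Vy, b ^ 2 + 4 * a * INR n < 0 /\ 0 < r /\
    weighted_system n a b r p S V px Sy Vx Vy /\
    (forall x, Rabs x < r -> is_derive F x (Derive F x)) /\
    forall v, Rabs v < r -> Rabs (p 0 v - v) <= C * v ^ 2.
Proof.
  intros P p S V AP AQ AV HP0 AF HF0 Hn HPF Hlead Ha Hphi HPDE.
  destruct (Analytic_of_analytic1 F AF) as [AF1 [AdF HdF]].
  destruct (Analytic_C1 P2 AP) as [Px [Py [rP [APx [APy [HrP CP]]]]]].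
  destruct (Analytic_C1 Q2 AQ) as [Qx [Qy [rQ [AQx [AQy [HrQ CQ]]]]]].
  destruct (Analytic_C1 V0 AV) as [Ux [Uy [rV [AUx [AUy [HrV CV]]]]]].
  destruct (Analytic_taylor_y P2 Py rP APy HrP) as [sP [CP2 [HsP [HCP TP]]]].
  { intros x y Hx Hy. now apply CP. }
  destruct (Analytic_taylor_y Q2 Qy rQ AQy HrQ) as [sQ [CQ2 [HsQ [HCQ TQ]]]].
  { intros x y Hx Hy. now apply CQ. }
  destruct (Analytic_lipschitz Px APx) as [lP [LP [HlP [HLP LipP]]]].
  destruct (Analytic_lipschitz Qy AQy) as [lQ [LQ [HlQ [HLQ LipQ]]]].
  destruct (Analytic_lipschitz Py APy) as [mP [KP [HmP [HKP LipPy]]]].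
  assert (HPy0 : Py 0 0 = 0).
  { transitivity (Derive (fun y => P2 0 y) 0); [ symmetry | ]; apply is_derive_unique; auto.
    apply CP; rewrite Rabs_R0; lra. }
  assert (HFc : continuous F 0).
  { destruct HdF as [s [Hs HdF]]. apply (ex_derive_continuous (V := R_NormedModule)).
    exists (Derive F 0). apply (HdF 0 0); rewrite Rabs_R0; lra. }
  destruct (Analytic_bounded _ AdF) as [rd [D0 [Hrd HD0]]].
  destruct (Analytic_lipschitz _ AF1) as [rl [LF [Hrl [HLF LipF]]]].
  destruct HPDE as [rE [HrE HPDE]].
  set (dF := Derive F) in *.
  assert (Hr1 : exists r1, 0 < r1 /\ (r1 <= rP /\ r1 <= rQ /\ r1 <= rV /\ r1 <= sP) /\
    (r1 <= sQ /\ r1 <= lP /\ r1 <= lQ /\ r1 <= mP) /\ r1 <= rE).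
  { exists (Rmin rE (Rmin (Rmin (Rmin rP rQ) (Rmin rV sP)) (Rmin (Rmin sQ lP) (Rmin lQ mP)))).
    split; [ repeat apply Rmin_glb_lt; auto | ].
    set (m1 := Rmin rP rQ). set (m2 := Rmin rV sP). set (m3 := Rmin sQ lP).
    set (m4 := Rmin lQ mP).
    generalize (Rmin_l rE (Rmin (Rmin m1 m2) (Rmin m3 m4)))
      (Rmin_r rE (Rmin (Rmin m1 m2) (Rmin m3 m4)))
      (Rmin_l (Rmin m1 m2) (Rmin m3 m4)) (Rmin_r (Rmin m1 m2) (Rmin m3 m4))
      (Rmin_l m1 m2) (Rmin_r m1 m2) (Rmin_l m3 m4) (Rmin_r m3 m4)
      (Rmin_l rP rQ) (Rmin_r rP rQ) (Rmin_l rV sP) (Rmin_r rV sP)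
      (Rmin_l sQ lP) (Rmin_r sQ lP) (Rmin_l lQ mP) (Rmin_r lQ mP).
    fold m1 m2 m3 m4. intros. repeat split; lra. }
  destruct Hr1 as [r1 [Hr1 [[LrP [LrQ [LrV LsP]]] [[LsQ [LlP [LlQ LmP]]] LrE]]]].
  apply (C1_box_le rP r1) in CP; auto. apply (C1_box_le rQ r1) in CQ; auto.
  apply (C1_box_le rV r1) in CV; auto.
  assert (N1 : near (fun x y => Rabs x < r1 /\ Rabs y < r1)) by (exists r1; auto).
  assert (N2 : near (fun x _ => Rabs x <= rd /\ Rabs x < rl)).
  { exists (Rmin rd rl). split; [ now apply Rmin_glb_lt | ]. intros x _ Hx _.
    generalize (Rmin_l rd rl) (Rmin_r rd rl). lra. }
  destruct (near_and _ _ (near_and _ _ (near_shear _ F HFc HF0 N1) N2)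
    (near_and _ _ HdF (near_and _ _ (near_locally_x _ HPF) (Analytic_near_continuity _ AdF))))
    as [r [Hr HN]].
  assert (Hx1 : forall x, Rabs x < r -> Rabs x < r1 /\ Rabs (F x) < r1).
  { intros x Hx. destruct (HN x 0 Hx) as [[H _] _]; [ rewrite Rabs_R0; lra | ].
    now rewrite Rplus_0_r in H. }
  assert (Hxv1 : forall x v, Rabs x < r -> Rabs v < r -> Rabs (F x + v) < r1).
  { intros x v Hx Hv. now destruct (HN x v Hx Hv) as [[H _] _]. }
  assert (HdF1 : forall x, Rabs x < r -> is_derive F x (dF x)).
  { intros x Hx. destruct (HN x 0 Hx) as [_ [H _]]; [ rewrite Rabs_R0; lra | auto ]. }
  assert (HPF1 : forall x, Rabs x < r -> F x + P2 x (F x) = 0).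
  { intros x Hx. destruct (HN x 0 Hx) as [_ [_ [H _]]]; [ rewrite Rabs_R0; lra | auto ]. }
  assert (HdFc : forall x v, Rabs x < r -> Rabs v < r -> continuity_2d_pt (fun x _ => dF x) x v).
  { intros x v Hx Hv. now destruct (HN x v Hx Hv) as [_ [_ [_ H]]]. }
  assert (HdFb : forall x, Rabs x < r -> Rabs (dF x) <= D0).
  { intros x Hx. destruct (HN x 0 Hx) as [[_ [H _]] _]; [ rewrite Rabs_R0; lra | ].
    apply (HD0 x 0); [ lra | rewrite Rabs_R0; lra ]. }
  assert (HFl : forall x, Rabs x < r -> Rabs (F x) <= LF * Rabs x).
  { intros x Hx. destruct (HN x 0 Hx) as [[_ [_ H]] _]; [ rewrite Rabs_R0; lra | ].
    assert (K := LipF 0 0 x 0). rewrite HF0, !Rminus_0_r, Rabs_R0, Rplus_0_r in K.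
    apply K; auto. }
  assert (HFcx : forall x, Rabs x < r -> continuous F x).
  { intros x Hx. apply (ex_derive_continuous (V := R_NormedModule)). exists (dF x). auto. }
  clear HN N1 N2.
  assert (Hsh : forall x v, Rabs x < r -> Rabs v < r -> continuity_2d_pt (fun x v => F x + v) x v).
  { intros x v Hx Hv. apply (continuity_2d_pt_shear (fun _ y => y) F); auto.
    apply continuity_2d_pt_id2. }
  (* Differentiation of F + P2(x, F) = 0; it turns the linear coefficient Qy - F' (1 + Py) of [S] in
     v into [phi]. *)
  assert (HdFeq : forall x, Rabs x < r -> dF x * (1 + Py x (F x)) = - Px x (F x)).
  { intros x Hx. destruct (Hx1 x Hx) as [B1 B2].
    destruct (C1_box_shear r1 (dF x) P2 Px Py F x 0 CP) as [D _]; auto;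
      [ now rewrite Rplus_0_r | ].
    assert (Z : dF x + (Px x (F x + 0) + Py x (F x + 0) * dF x) = 0).
    { apply (is_derive_zero_fun (fun u => F u + P2 u (F u + 0)) r x); auto.
      - intros t Ht. rewrite Rplus_0_r. auto.
      - apply (is_derive_plus F (fun u => P2 u (F u + 0))); auto. }
    rewrite Rplus_0_r in Z. lra. }
  set (phi := fun x => Px x (F x) + Qy x (F x)).
  assert (Ephi : forall x, Rabs x < r -> dx P2 x (F x) + dy Q2 x (F x) = phi x).
  { intros x Hx. destruct (Hx1 x Hx) as [B1 B2]. unfold phi, dx, dy. f_equal;
      apply is_derive_unique; [ now apply CP | now apply CQ ]. }
  (* Py vanishes at the origin, hence Py(x, F(x)) = O(x), and p - v is O(v^2) + O(|x v|). *)
  assert (Bp : forall x v, Rabs x < r -> Rabs v < r ->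
    Rabs (p x v - v) <= CP2 * v ^ 2 + Rabs v * (KP * ((1 + LF) * Rabs x))).
  { intros x v Hx Hv. destruct (Hx1 x Hx) as [B1 B2]. assert (B3 := Hxv1 x v Hx Hv).
    assert (T1 := TP x (F x) (F x + v) ltac:(lra) ltac:(lra) ltac:(lra)).
    replace (F x + v - F x) with v in T1 by ring.
    assert (T2 : Rabs (Py x (F x)) <= KP * ((1 + LF) * Rabs x)).
    { assert (K := LipPy 0 0 x (F x)).
      rewrite HPy0, !Rminus_0_r, Rabs_R0 in K.
      eapply Rle_trans; [ apply K; lra | ]. apply Rmult_le_compat_l; auto.
      generalize (HFl x Hx). lra. }
    replace (p x v - v) with (P2 x (F x + v) - P2 x (F x) - v * Py x (F x) + v * Py x (F x))
      by (unfold p, P; generalize (HPF1 x Hx); lra).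
    eapply Rle_trans; [ apply Rabs_triang | ]. apply Rplus_le_compat; auto.
    rewrite Rabs_mult. apply Rmult_le_compat_l; auto. apply Rabs_pos. }
  assert (BS : forall x v, Rabs x < r -> Rabs v < r ->
    Rabs (S x v - Q2 x (F x) - v * phi x) <= (CQ2 + D0 * CP2) * v ^ 2).
  { intros x v Hx Hv. destruct (Hx1 x Hx) as [B1 B2]. assert (B3 := Hxv1 x v Hx Hv).
    assert (T1 := TP x (F x) (F x + v) ltac:(lra) ltac:(lra) ltac:(lra)).
    assert (T2 := TQ x (F x) (F x + v) ltac:(lra) ltac:(lra) ltac:(lra)).
    replace (F x + v - F x) with v in T1, T2 by ring.
    replace (S x v - Q2 x (F x) - v * phi x)
      with ((Q2 x (F x + v) - Q2 x (F x) - v * Qy x (F x))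
        - dF x * (P2 x (F x + v) - P2 x (F x) - v * Py x (F x))).
    - eapply Rle_trans; [ apply Rabs_triang | ]. rewrite Rabs_Ropp, Rabs_mult.
      assert (Rabs (dF x) * Rabs (P2 x (F x + v) - P2 x (F x) - v * Py x (F x))
        <= D0 * (CP2 * v ^ 2)).
      { apply Rmult_le_compat; auto; apply Rabs_pos. }
      lra.
    - unfold S, p, P, phi. assert (E1 := HPF1 x Hx). assert (E2 := HdFeq x Hx).
      replace (Px x (F x)) with (- (dF x * (1 + Py x (F x)))) by lra.
      replace (P2 x (F x)) with (- F x) by lra. ring. }
  set (px := fun x v => dF x + (Px x (F x + v) + Py x (F x + v) * dF x)).
  set (Sy := fun x v => Qy x (F x + v) - dF x * (1 + Py x (F x + v))).
  (* The terms in F' cancel: the shear preserves the divergence. *)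
  assert (Ediv : forall x v, px x v + Sy x v = Px x (F x + v) + Qy x (F x + v)).
  { intros x v. unfold px, Sy. ring. }
  assert (Bd : forall x v, Rabs x < r -> Rabs v < r ->
    Rabs (px x v + Sy x v - phi x) <= (LP + LQ) * Rabs v).
  { intros x v Hx Hv. destruct (Hx1 x Hx) as [B1 B2]. assert (B3 := Hxv1 x v Hx Hv).
    assert (T1 := LipP x (F x) x (F x + v) ltac:(lra) ltac:(lra) ltac:(lra) ltac:(lra)).
    assert (T2 := LipQ x (F x) x (F x + v) ltac:(lra) ltac:(lra) ltac:(lra) ltac:(lra)).
    replace (F x + v - F x) with v in T1, T2 by ring.
    replace (x - x) with 0 in T1, T2 by ring. rewrite Rabs_R0, Rplus_0_l in T1, T2.
    rewrite Ediv. unfold phi.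
    replace (Px x (F x + v) + Qy x (F x + v) - (Px x (F x) + Qy x (F x)))
      with (Px x (F x + v) - Px x (F x) + (Qy x (F x + v) - Qy x (F x))) by ring.
    eapply Rle_trans; [ apply Rabs_triang | ]. lra. }
  destruct (divergence_limit _ n a Ha ltac:(lia) Hphi) as [b [Hb Hlim]].
  exists b, r, CP2, px, Sy, (fun x v => Ux x (F x + v) + Uy x (F x + v) * dF x),
    (fun x v => Uy x (F x + v)).
  split; [ exact Hb | split; [ exact Hr | split; [ | split; [ exact HdF1 | ] ] ] ].
  (* At x = 0 the bound reduces to O(v^2), which later shows that [p] does not vanish on the
     positive y-axis near the origin. *)
  2:{ intros v Hv. assert (K := Bp 0 v). rewrite Rabs_R0 in K.
      specialize (K ltac:(lra) Hv). lra. }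
  assert (Near : forall x v, box 2 (x, v) -> small (fun e => Rabs (e * x) < r /\
    Rabs (e ^ n * v) < r /\ Rabs e < 1 /\ Rabs (e ^ n) <= Rabs e)).
  { intros x v _.
    generalize (small_and _ _ (near_small (fun x y => Rabs x < r /\ Rabs y < r) n x v
      ltac:(lia) (ex_intro _ r (conj Hr (fun x y Hx Hy => conj Hx Hy)))) (small_lt 1 Rlt_0_1)).
    apply small_imp. intros e He [[H1 H2] H3]. repeat split; auto.
    rewrite <- RPow_abs. apply Rabs_pos_lt in He. destruct n as [|n']; [ lia | ].
    destruct (pow_S_small (Rabs e) n'); lra. }
  assert (Gp : forall x v, Rabs x < r -> Rabs v < r -> has_gradient p x v
    (px x v) (1 + Py x (F x + v))).
  { intros x v Hx Hv. destruct (Hx1 x Hx) as [B1 _]. assert (B3 := Hxv1 x v Hx Hv).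
    destruct (C1_box_shear r1 (dF x) P2 Px Py F x v CP) as [D1 D2]; auto. split.
    - apply (is_derive_plus (fun u => F u + v) (fun u => P2 u (F u + v))); auto.
      replace (dF x) with (plus (dF x) 0) by apply Rplus_0_r.
      apply (is_derive_plus F (fun _ => v)); [ auto | apply @is_derive_const ].
    - apply (is_derive_plus (fun w => F x + w) (fun w => P2 x (F x + w))); auto.
      auto_derive; auto. }
  assert (Cs : forall g gx gy, C1_box r1 g gx gy -> forall x v, Rabs x < r -> Rabs v < r ->
    continuity_2d_pt (fun x v => g x (F x + v)) x v /\
    continuity_2d_pt (fun x v => gx x (F x + v)) x v /\
    continuity_2d_pt (fun x v => gy x (F x + v)) x v).
  { intros g gx gy HC x v Hx Hv. destruct (Hx1 x Hx) as [B1 _].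
    destruct (HC x (F x + v) B1 (Hxv1 x v Hx Hv)) as [_ [C1 [C2 C3]]].
    repeat split; apply continuity_2d_pt_shear; auto. }
  assert (Cp : forall x v, Rabs x < r -> Rabs v < r -> continuity_2d_pt p x v).
  { intros x v Hx Hv. apply continuity_2d_pt_plus; auto. now apply (Cs P2 Px Py). }
  assert (Ex : forall f, Analytic f -> expandable (box 2)
    (fun e z => f (e * fst z) (F (e * fst z) + e ^ n * snd z))).
  { intros f Hf. apply expandable_sheared; auto. lia. }
  assert (Ep : expandable (box 2) (fun e z => p (e * fst z) (e ^ n * snd z))).
  { apply (expandable_plus (box 2) (fun e z => F (e * fst z) + e ^ n * snd z)); [ | now apply Ex ].
    apply (expandable_plus (box 2) (fun e z => F (e * fst z))).
    - now apply (Ex (fun x _ => F x)).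
    - apply expandable_mult; [ apply expandable_pow | ].
      apply expandable_coef, ctn_bounded_snd. }
  assert (EdF := Ex _ AdF).
  assert (Pow : forall e, e ^ n = e * e ^ (n - 1)).
  { intros e. rewrite tech_pow_Rmult. f_equal. lia. }
  assert (Pow2 : forall e, e ^ (2 * n - 1) = e ^ n * e ^ (n - 1)).
  { intros e. rewrite <- pow_add. f_equal. lia. }
  split.
  - intros x v Hx Hv. destruct (Hx1 x Hx) as [B1 _]. assert (B3 := Hxv1 x v Hx Hv).
    destruct (C1_box_shear r1 (dF x) Q2 Qx Qy F x v CQ) as [_ D2]; auto.
    destruct (C1_box_shear r1 (dF x) V0 Ux Uy F x v CV) as [D3 D4]; auto.
    destruct (Gp x v Hx Hv) as [D5 D6].
    split; [ auto | split; [ | split; auto ] ].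
    apply (is_derive_minus (fun w => Q2 x (F x + w)) (fun w => dF x * p x w)); auto.
    now apply (is_derive_scal (p x)).
  - intros x v Hx Hv.
    destruct (Cs _ _ _ CP x v Hx Hv) as [_ [K1 K2]].
    destruct (Cs _ _ _ CQ x v Hx Hv) as [K3 _].
    destruct (Cs _ _ _ CV x v Hx Hv) as [K4 [K5 K6]].
    assert (K7 := HdFc x v Hx Hv). assert (K8 := Cp x v Hx Hv).
    split; [ auto | split; [ | split; [ auto | split ] ] ].
    + apply continuity_2d_pt_minus; auto. now apply continuity_2d_pt_mult.
    + apply continuity_2d_pt_plus; auto. apply continuity_2d_pt_plus; auto.
      now apply continuity_2d_pt_mult.
    + apply continuity_2d_pt_plus; auto. now apply continuity_2d_pt_mult.
  - intros x v Hx Hv. destruct (Hx1 x Hx) as [B1 _]. assert (B3 := Hxv1 x v Hx Hv).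
    assert (E := HPDE x (F x + v) ltac:(lra) ltac:(lra)).
    destruct (CP x (F x + v) B1 B3) as [[G1 _] _].
    destruct (CQ x (F x + v) B1 B3) as [[_ G2] _].
    destruct (CV x (F x + v) B1 B3) as [[G3 G4] _].
    assert (G5 : is_derive (fun u => P u (F x + v)) x (Px x (F x + v))).
    { replace (Px x (F x + v)) with (plus 0 (Px x (F x + v))) by apply Rplus_0_l.
      apply (is_derive_plus (fun _ => F x + v) (fun u => P2 u (F x + v))); auto.
      apply @is_derive_const. }
    assert (I2 : dy Q2 x (F x + v) = Qy x (F x + v)) by exact (is_derive_unique _ _ _ G2).
    assert (I3 : dx V0 x (F x + v) = Ux x (F x + v)) by exact (is_derive_unique _ _ _ G3).
    assert (I4 : dy V0 x (F x + v) = Uy x (F x + v)) by exact (is_derive_unique _ _ _ G4).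
    assert (I5 : dx P x (F x + v) = Px x (F x + v)) by exact (is_derive_unique _ _ _ G5).
    rewrite I2, I3, I4, I5 in E.
    rewrite Ediv. unfold S, V. fold (p x v) in E. rewrite <- E. ring.
  - intros f Hf. simpl in Hf.
    destruct Hf as [<-|[<-|[<-|[<-|[<-|[]]]]]].
    + exact Ep.
    + apply (expandable_plus (box 2)
        (fun e z => Q2 (e * fst z) (F (e * fst z) + e ^ n * snd z))); [ now apply Ex | ].
      exact (expandable_opp _ _ (expandable_mult _ _ _ EdF Ep)).
    + exact (Ex _ AV).
    + apply (expandable_plus (box 2)
        (fun e z => Ux (e * fst z) (F (e * fst z) + e ^ n * snd z))); [ now apply Ex | ].
      exact (expandable_mult _ _ _ (Ex _ AUy) EdF).
    + exact (Ex _ AUy).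
  - intros x v Hxv.
    apply is_lim_ext_loc with (fun e => v + (p (e * x) (e ^ n * v) / e ^ n - v)).
    + apply small_locally', small_true. intros. ring.
    + replace (Finite v) with (Finite (v + 0)) by (f_equal; ring).
      apply is_lim_plus_R; [ apply is_lim_const | ].
      (* After division by e^n the two error terms are O(e^n) and O(e). *)
      apply (is_lim_0_bound _ (CP2 * v ^ 2 + Rabs v * (KP * ((1 + LF) * Rabs x)))).
      generalize (Near x v Hxv). apply small_imp. intros e He [H1 [H2 [H3 H4]]].
      assert (Hen : e ^ n <> 0) by now apply pow_nonzero.
      assert (Hen' := Rabs_pos_lt _ Hen).
      replace (p (e * x) (e ^ n * v) / e ^ n - v)
        with ((p (e * x) (e ^ n * v) - e ^ n * v) / e ^ n) by (field; auto).
      unfold Rdiv. rewrite Rabs_mult, Rabs_inv.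
      apply Rmult_le_reg_r with (Rabs (e ^ n)); auto.
      rewrite Rmult_assoc, Rinv_l, Rmult_1_r by lra.
      eapply Rle_trans; [ now apply Bp | ].
      rewrite <- (pow2_abs (e ^ n * v)), !Rabs_mult, Rpow_mult_distr, (pow2_abs v).
      assert (K : CP2 * (Rabs (e ^ n) * Rabs (e ^ n) * v ^ 2)
        <= CP2 * (Rabs (e ^ n) * Rabs e * v ^ 2)).
      { apply Rmult_le_compat_l; auto. apply Rmult_le_compat_r; [ apply pow2_ge_0 | ].
        apply Rmult_le_compat_l; lra. }
      lra.
  - intros x v Hxv.
    apply is_lim_ext_loc with (fun e => Q2 (e * x) (F (e * x)) / e ^ (2 * n - 1)
      + phi (e * x) / e ^ (n - 1) * v
      + (S (e * x) (e ^ n * v) - Q2 (e * x) (F (e * x)) - e ^ n * v * phi (e * x))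
        / e ^ (2 * n - 1)).
    + apply small_locally'. exists 1. split; [ lra | ]. intros e He _. rewrite Pow2.
      field. split; now apply pow_nonzero.
    + rewrite <- (Rplus_0_r (a * _ + _)). apply is_lim_plus_R; [ apply is_lim_plus_R | ].
      * exact (leading_term_lim _ _ _ x Hlead).
      * apply is_lim_mult_R; [ | apply is_lim_const ].
        apply is_lim_ext_loc with (2 := Hlim x). apply small_locally'.
        generalize (Near x v Hxv). apply small_imp. intros e _ [H1 _]. now rewrite Ephi.
      (* The remainder in v^2 has order e^(2n), one more than the divisor e^(2n-1). *)
      * apply (is_lim_0_bound _ ((CQ2 + D0 * CP2) * v ^ 2)).
        generalize (Near x v Hxv). apply small_imp. intros e He [H1 [H2 [H3 H4]]].
        assert (Hen : e ^ (2 * n - 1) <> 0) by now apply pow_nonzero.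
        assert (Hen' := Rabs_pos_lt _ Hen).
        unfold Rdiv. rewrite Rabs_mult, Rabs_inv.
        apply Rmult_le_reg_r with (Rabs (e ^ (2 * n - 1))); auto.
        rewrite Rmult_assoc, Rinv_l, Rmult_1_r by lra.
        eapply Rle_trans; [ now apply BS | ]. right.
        rewrite <- (pow2_abs (e ^ n * v)), Rabs_mult, Rpow_mult_distr, (pow2_abs v).
        rewrite Pow2, Rabs_mult. replace (Rabs (e ^ n) ^ 2)
          with (Rabs (e ^ n) * (Rabs e * Rabs (e ^ (n - 1))))
          by (rewrite <- Rabs_mult, <- Pow; ring).
        ring.
  - intros x v Hxv.
    apply is_lim_ext_loc with (fun e => phi (e * x) / e ^ (n - 1)
      + (px (e * x) (e ^ n * v) + Sy (e * x) (e ^ n * v) - phi (e * x)) / e ^ (n - 1)).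
    + apply small_locally'. exists 1. split; [ lra | ]. intros e He _.
      field. now apply pow_nonzero.
    + rewrite <- (Rplus_0_r (b * _)). apply is_lim_plus_R.
      * apply is_lim_ext_loc with (2 := Hlim x). apply small_locally'.
        generalize (Near x v Hxv). apply small_imp. intros e _ [H1 _]. now rewrite Ephi.
      * apply (is_lim_0_bound _ ((LP + LQ) * Rabs v)).
        generalize (Near x v Hxv). apply small_imp. intros e He [H1 [H2 [H3 H4]]].
        assert (Hen : e ^ (n - 1) <> 0) by now apply pow_nonzero.
        assert (Hen' := Rabs_pos_lt _ Hen).
        unfold Rdiv. rewrite Rabs_mult, Rabs_inv.
        apply Rmult_le_reg_r with (Rabs (e ^ (n - 1))); auto.
        rewrite Rmult_assoc, Rinv_l, Rmult_1_r by lra.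
        eapply Rle_trans; [ now apply Bd | ]. right.
        rewrite Pow, !Rabs_mult. ring.
Qed.

(** * An even Andreev number excludes spirals *)

Lemma expands2_dy_at_0 (c : nat -> nat -> R) (r : R) (f : R -> R -> R) :
  expands2 c r f -> is_derive (fun y => f 0 y) 0 (c O 1%nat).
Proof.
  intros Hf. assert (Hr : 0 < r) by apply Hf.
  destruct (expands2_dy c r (r / 2) f) as [[_ [Hc He]] HD]; [ lra | auto | ].
  specialize (HD 0 0). rewrite Rabs_R0 in HD. specialize (HD ltac:(lra) ltac:(lra)).
  rewrite He, (sum2_0 _ (r / 2)) in HD; auto; try (rewrite Rabs_R0; lra); [ | lra ].
  unfold dy_coef in HD. simpl in HD. now rewrite Rmult_1_l in HD.
Qed.

Theorem corollary12 (P2 Q2 : R -> R -> R) (n : nat)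
    (hP2 : analytic2_order_ge 2 P2)
    (hQ2 : analytic2_order_ge 2 Q2)
    (hfocus : is_focus (fun x y => y + P2 x y) Q2)
    (hn : andreev_number P2 Q2 n)
    (hV : exists (U : R * R -> Prop) (V0 : R -> R -> R),
        inverse_integrating_factor (fun x y => y + P2 x y) Q2 U V0 /\
        analytic2 V0) :
  Nat.Odd n.
Proof.
  destruct (Nat.Even_or_Odd n) as [Hev|Hodd]; auto. exfalso.
  destruct hP2 as [cP [eP zP]]. destruct hQ2 as [cQ [eQ _]].
  destruct hV as [U [V0 [[oU [U0 [_ [nn pde]]]] [cV eV]]]].
  destruct hn as [Hn2 [F [a [AF [HF0 [HPF [Hlead [Ha Hphi]]]]]]]].
  destruct (expands2_of_has_expansion2 _ _ eP) as [rP XP].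
  destruct (expands2_of_has_expansion2 _ _ eQ) as [rQ XQ].
  destruct (expands2_of_has_expansion2 _ _ eV) as [rV XV].
  assert (AP : Analytic P2) by (now exists cP, rP).
  assert (AQ : Analytic Q2) by (now exists cQ, rQ).
  assert (AV : Analytic V0) by (now exists cV, rV).
  assert (HP0 : is_derive (fun y => P2 0 y) 0 0).
  { assert (HD := expands2_dy_at_0 _ _ _ XP). now rewrite zP in HD by lia. }
  assert (HU : near (fun x y => U (x, y))) by (apply near_locally, oU, U0).
  destruct (sheared_weighted_system P2 Q2 V0 F n a) as
    [b [r [C [px [Sy [Vx [Vy [Hdisc [Hr [HWS [HdF Hp0]]]]]]]]]]]; auto.
  { revert HU. apply near_imp. intros x y. apply pde. }
  set (P := fun x y => y + P2 x y) in *.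
  set (p := fun x v => P x (F x + v)) in *.
  set (S := fun x v => Q2 x (F x + v) - Derive F x * p x v) in *.
  set (V := fun x v => V0 x (F x + v)) in *.
  destruct (weighted_first_integral n a b r p S V px Sy Vx Vy) as [q [h [Hq Hh]]];
    auto; [ lia | | ].
  { apply (not_flat V0 F n); auto; [ lia | now apply Analytic_of_analytic1 | ].
    intros [s [Hs Hz]]. apply (nn 0 0 U0).
    assert (Hb : box s (0, 0)) by (split; simpl; rewrite Rabs_R0; lra).
    generalize (locally_in_box s 0 0 Hb). apply filter_imp. intros [x y] [Hx Hy]. now apply Hz. }
  (* Chosen so that [C * v ^ 2 < v] for 0 < v < [q1]; then [p 0 v], and with it [N 0 v], is
     nonzero. *)
  set (q1 := Rmin q (/ (Rabs C + 1))).
  assert (HC := Rabs_pos C).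
  assert (Hq1 : 0 < q1) by (apply Rmin_glb_lt; [ lra | apply Rinv_0_lt_compat; lra ]).
  assert (L1 : q1 <= q) by apply Rmin_l.
  assert (L2 : q1 <= / (Rabs C + 1)) by apply Rmin_r.
  assert (Hpq : forall u v, punctured q1 u v -> punctured q u v).
  { intros u v [Hu [Hv Huv]]. split; [ lra | split; [ lra | auto ] ]. }
  set (M := fun x v => - S x v / V x v) in *. set (N := fun x v => p x v / V x v) in *.
  assert (HM : forall u v, punctured q1 u v -> continuity_2d_pt M u v).
  { intros u v Huv. apply Hpq in Huv. destruct (Hh u v Huv) as [HV _].
    destruct Huv as [Hu [Hv _]].
    destruct (ws_continuity _ _ _ _ _ _ _ _ _ _ _ HWS u v) as [_ [K1 [K2 _]]]; try lra.
    apply continuity_2d_pt_mult; [ now apply continuity_2d_pt_opp | ].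
    now apply continuity_2d_pt_inv. }
  assert (HN : forall v, 0 < v < q1 -> N 0 v <> 0).
  { intros v Hv. assert (Hpv : punctured q 0 v).
    { apply Hpq. split; [ rewrite Rabs_R0; lra | split; [ rewrite Rabs_pos_eq; lra | right; lra ] ]. }
    destruct (Hh 0 v Hpv) as [HV _]. unfold N. apply Rmult_integral_contrapositive_currified.
    - assert (K : Rabs (p 0 v - v) <= C * v ^ 2) by (apply Hp0; rewrite Rabs_pos_eq; lra).
      assert (K2 : C * v ^ 2 < v).
      { assert (K3 : (Rabs C + 1) * v < 1).
        { apply Rlt_le_trans with ((Rabs C + 1) * / (Rabs C + 1)).
          - apply Rmult_lt_compat_l; lra.
          - right. field. lra. }
        generalize (Rle_abs C). nra. }
      intros E. rewrite E in K. rewrite Rminus_0_l, Rabs_Ropp, Rabs_pos_eq in K by lra. lra.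
    - now apply Rinv_neq_0_compat. }
  assert (Hint : forall u v, punctured q1 u v ->
    M u v * p u v + N u v * (Q2 u (F u + v) - Derive F u * p u v) = 0).
  { intros u v _. fold (S u v). unfold M, N, Rdiv. ring. }
  destruct hfocus as [_ [_ [W [HW Hspiral]]]].
  destruct (near_locally _ HW) as [s [Hs HWs]].
  (* A single orbit is enough for the contradiction. *)
  assert (HWp : W (0, s / 2)) by (apply HWs; [ rewrite Rabs_R0 | rewrite Rabs_pos_eq ]; lra).
  destruct (Hspiral 0 (s / 2) HWp) as [_ [Hsp|Hsp]].
  - intros E. injection E. lra.
  - revert Hsp. apply (no_spiral_with_first_integral _ _ _ _ _ q1 F (Derive F) h M N); auto.
    + intros x Hx. apply HdF. lra.
    + intros u v Huv. apply Hh. auto.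
  (* Time reversal only changes the sign of the field, so the same first integral excludes backward
     spirals. *)
  - revert Hsp. apply (no_spiral_with_first_integral _ _ _ _ _ q1 F (Derive F) h M N); auto.
    + intros x Hx. apply HdF. lra.
    + intros u v Huv. apply Hh. auto.
    + intros u v Huv. specialize (Hint u v Huv). unfold p, P in Hint |- *. lra.
Qed.
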